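(* Let $\alpha\in(0,\pi/4)$. There exist a constant $c>0$ and a function $p$ with $p(n)=O(n^2)$ such that for every $n\ge 1$, with $H\in\mathbb{C}^{n\times n}$ a GUE matrix, there exists a set $E_n\subset\mathbb{C}^{n\times n}$ of exceptional inputs with $$\operatorname{Prob}\{H\in E_n\}\le e^{-n}$$ and $$\mathbb{E}\big[\rho_\alpha(H)\mid H\notin E_n\big]<\frac{p(n)}{1-e^{-cn}}\,\log\cot\alpha .$$ In particular, power iteration runs in weak polynomial time, i.e. the family $\{\rho_\alpha(H)\}_n$ has weak expectation bounded by a polynomial in $n$.
   Context: GUE matrix: $H=\frac12(G+G^* )$, where $G$ is a complex Gaussian $n\times n$ matrix whose entries are independent with independent standard Gaussian real and imaginary parts; in particular, off-diagonal entries of $H$ have real and imaginary parts with mean $0$ and variance $1/2$, and diagonal entries are real with mean $0$ and variance $1$. For a Hermitian matrix $A\in\mathbb{C}^{n\times n}$ order the eigenvalues as $|\lambda_1|\ge|\lambda_2|\ge\cdots\ge|\lambda_n|$ with corresponding eigenvectors $u_1,\dots,u_n$; $u_1$ is called a dominant eigenvector. Power iteration started at $x$ generates unit vectors $p_k=\frac{A^kp_0}{\|A^kp_0\|}$, $k\ge0$, with $p_0=x$ (normalized). The Fubini–Study metric is $d_R(x,y)=\arccos\left(\frac{|\langle x,y\rangle|}{\|x\|\|y\|}\right)$ for the Hermitian inner product on $\mathbb{C}^n$ and its norm. For $0<\alpha\le\pi/2$ define $$\rho_\alpha(A,x)=\min\{k\mid d_R(p_k,u_1)\le\alpha\},\qquad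 \rho_\alpha(A)=\mathbb{E}_{x}\,[\rho_\alpha(A,x)],$$ where $x$ is uniformly distributed on complex projective space $\mathbb{CP}^{n-1}$ (the quantity $\rho_\alpha(A,x)$ is well-defined on $\mathbb{CP}^{n-1}$). Weak expectation: for probability spaces $(M_k,\mu_k)$ and measurable $T_k\colon M_k\to\mathbb{R}$, $k\in\mathbb{N}$, the family $\{T_k\}$ has a weak expectation of $O(f(k))$ if there are sets $E_k\subseteq M_k$ with $\mu_k(E_k)=e^{-\Omega(k)}$ such that the conditional expectation $\mathbb{E}[T_k(x)\mid x\notin E_k]$ is bounded by $f(k)$, constants being disregarded as usual in $O$-notation. *)

(* Defs.v *)
From HB Require Import structures.
From mathcomp Require Import all_boot all_order all_algebra.
From mathcomp Require Import sesquilinear spectral.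
From mathcomp Require Import complex.
From mathcomp Require Import all_classical all_reals all_analysis.

Set Implicit Arguments.
Unset Strict Implicit.
Unset Printing Implicit Defensive.

Import Order.TTheory GRing.Theory Num.Theory.
Import numFieldNormedType.Exports Normc.

Local Open Scope classical_set_scope.
Local Open Scope ring_scope.
Local Open Scope complex_scope.
Local Open Scope sesquilinear_scope.

Section HermitianSpace.
Context {R : realType} {n : nat}.
Implicit Types (x y u : 'cV[R[i]]_n) (A : 'M[R[i]]_n).

Definition herm_dot x y : R[i] := \sum_(i < n) x i ord0 * (y i ord0)^*.

Definition herm_norm x : R := Num.sqrt (\sum_(i < n) normc (x i ord0) ^+ 2).

(* By [0^-1 = 0], [normalize 0 = 0]. *)
Definition normalize x : 'cV[R[i]]_n := ((herm_norm x)^-1)%:C *: x.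

(* By [0^-1 = 0], this is [acos 0 = pi / 2] when [x] or [y] vanishes. *)
Definition fubini_study x y : R :=
  acos (normc (herm_dot x y) / (herm_norm x * herm_norm y)).

Definition power_iterate A x (k : nat) : 'cV[R[i]]_n :=
  normalize (A ^+ k *m normalize x).

(* [u] is an eigenvector for an eigenvalue of maximal modulus. Left and right
   eigenvalues coincide, so the library's [eigenvalue], which is stated with
   row vectors, gives the spectrum of [A]. *)
Definition dominant_eigenvector A u : Prop :=
  u != 0 /\ exists2 l : R[i], A *m u = l *: u &
    forall l' : R[i], eigenvalue A l' -> normc l' <= normc l.

(* A choice of [u_1] for each Hermitian matrix: phases, and ties between
   eigenvalues of maximal modulus, are resolved arbitrarily. *)
Definition dominant_choice (u1 : 'M[R[i]]_n -> 'cV[R[i]]_n) : Prop :=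
  forall A, A \is hermsymmx -> dominant_eigenvector A (u1 A).

Local Open Scope ereal_scope.

(* The infimum is a minimum, except that it is [+oo] when no iterate comes
   within distance [alpha] of [u1 A]. If [A ^+ k *m x = 0] then the [k]-th
   iterate is [0], at distance [pi / 2], hence never counted when
   [alpha < pi / 2]. *)
Definition rho_at (u1 : 'M[R[i]]_n -> 'cV[R[i]]_n) (alpha : R) A x : \bar R :=
  ereal_inf [set (k%:R)%:E | k in
    [set k : nat | (fubini_study (power_iterate A x k) (u1 A) <= alpha)%R]].

End HermitianSpace.

(* The carrier of a [measurableType] has to be pointed. *)
HB.instance Definition _ (R : realType) := isPointed.Build R[i] 0.

Section BorelMatrices.
Context (R : realType) (m n : nat).

(* [false] selects the real part, [true] the imaginary part. *)
Definition entry_part (t : 'I_m * 'I_n * bool) (A : 'M[R[i]]_(m, n)) : R :=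
  let z := A t.1.1 t.1.2 in if t.2 then complex.Im z else complex.Re z.

Definition entry_cylinders : set (set 'M[R[i]]_(m, n)) :=
  [set B | exists t (V : set R), measurable V /\ B = entry_part t @^-1` V].

(* Complex [m x n] matrices with their Borel sigma-algebra, i.e. the one
   generated by the [2 m n] real coordinates. *)
Definition borel_mx : measurableType (sigma_display entry_cylinders) :=
  g_sigma_algebraType entry_cylinders.

End BorelMatrices.

Section Probability.
Context {R : realType}.
Local Open Scope ereal_scope.

Definition cond_expectation (d : measure_display) (T : measurableType d)
    (P : probability T R) (X : T -> \bar R) (A : set T) : \bar R :=
  (\int[P]_(w in A) X w) * ((fine (P A))^-1)%:E.

(* Since [B j] may be [setT], the product rule for the whole finite family
   includes the one for each of its subfamilies. *)
Definition independent_family (d : measure_display) (T : measurableType d)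
    (P : probability T R) (J : finType) (X : J -> T -> R) : Prop :=
  forall B : J -> set R, (forall j, measurable (B j)) ->
    P (\bigcap_(j in [set: J]) X j @^-1` B j) = \prod_(j : J) P (X j @^-1` B j).

Definition standard_gaussian (d : measure_display) (T : measurableType d)
    (P : probability T R) (X : T -> R) : Prop :=
  measurable_fun [set: T] X /\
  forall B : set R, measurable B -> P (X @^-1` B) = normal_prob 0 1 B.

Definition complex_gaussian_mx (d : measure_display) (T : measurableType d)
    (P : probability T R) (n : nat) (G : T -> 'M[R[i]]_n) : Prop :=
  (forall t, standard_gaussian P (fun w => entry_part t (G w))) /\
  independent_family P (fun t w => entry_part t (G w)).

Definition hermitian_part (n : nat) (G : 'M[R[i]]_n) : 'M[R[i]]_n :=
  (2^-1 *: (G + G ^t*))%R.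

Definition GUE (d : measure_display) (T : measurableType d)
    (P : probability T R) (n : nat) (H : T -> 'M[R[i]]_n) : Prop :=
  exists2 G : T -> 'M[R[i]]_n, complex_gaussian_mx P G &
    forall w, H w = hermitian_part (G w).

(* The uniform distribution on the projective space CP^(n-1) is the probability
   measure invariant under U(n). [nu] is the law of a vector of homogeneous
   coordinates: almost surely nonzero, and such that the induced law on lines is
   invariant. Borel sets of lines are Borel sets of vectors stable under
   multiplication by nonzero scalars. *)
Definition uniform_projective (n : nat) (nu : probability (borel_mx R n 1) R) :
    Prop :=
  nu [set (0%R : 'cV[R[i]]_n)] = 0 /\
  forall (U : 'M[R[i]]_n) (B : set (borel_mx R n 1)),
    U \is unitarymx -> measurable B ->
    (forall (c : R[i]) (x : 'cV[R[i]]_n), (c != 0)%R -> B x -> B (c *: x)%R) ->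
    nu [set x : 'cV[R[i]]_n | B (U *m x)] = nu B.

Definition rho (n : nat) (nu : probability (borel_mx R n 1) R)
    (u1 : 'M[R[i]]_n -> 'cV[R[i]]_n) (alpha : R) (A : 'M[R[i]]_n) : \bar R :=
  \int[nu]_x rho_at u1 alpha A x.

(* [T] may take infinite values, on a null set if the expectation is finite. *)
Definition weak_expectation_O (d : nat -> measure_display)
    (M : forall k, measurableType (d k)) (mu : forall k, probability (M k) R)
    (T : forall k, M k -> \bar R) (f : nat -> R) : Prop :=
  exists E : forall k, set (M k),
  [/\ forall k, measurable (E k),
      exists2 c : R, (0 < c)%R &
        \forall k \near \oo, mu k (E k) <= (expR (- (c * k%:R)))%:E
    & exists2 K : R, (0 < K)%R &
        \forall k \near \oo,
          `|cond_expectation (mu k) (T k) (~` E k)| <= (K * f k)%:E].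

End Probability.

Definition cot {R : realType} (x : R) : R := cos x / sin x.

(* Main.v *)
Require Import Defs.
From HB Require Import structures.
From mathcomp Require Import all_boot all_order all_algebra.
From mathcomp Require Import sesquilinear spectral.
From mathcomp Require Import complex.
From mathcomp Require Import all_classical all_reals all_analysis.
From mathcomp Require Import measurable_realfun.
From mathcomp Require Import ring lra zify.
Set Implicit Arguments.
Unset Strict Implicit.
Unset Printing Implicit Defensive.

Import Order.TTheory GRing.Theory Num.Theory.
Import numFieldNormedType.Exports.

Local Open Scope classical_set_scope.
Local Open Scope ring_scope.
Local Open Scope complex_scope.

(** Power iteration separates the dominant eigenvector from another one at the
    rate at which the quotient of the moduli of their eigenvalues is below 1.
    So for a Hermitian matrix [rho] is bounded by the reciprocals of the gaps
    between moduli, relative to the norm, up to logarithms of how badly a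
    uniform starting vector may be placed ([rho_le_gaps]). For a GUE matrix the
    norm is at most [60 * sqrt n] up to an exponentially small probability
    ([large_norm_le]), and two moduli can be within [e] in two ways.

    Two eigenvalues at the same end of the spectrum may be close. Eigenvalues
    repel each other, so this has probability of order [n ^ 2 * e ^ 2]
    ([close_pair_le]), and the reciprocal of this gap has expectation of order
    [n]. Or the largest and the smallest eigenvalue are nearly opposite. There
    is no repulsion in this case: the probability is only of order [e * sqrt n]
    ([small_opposite_gap_le]), and the reciprocal gap just fails to be
    integrable. This is where the exceptional set comes from. Discarding the
    matrices for which this gap is below [2 ^- (12 * n)] leaves [12 * n] dyadic
    scales, each contributing order [sqrt n] to the expectation
    ([integral_inverse_scale_le]). Multiplied by the norm [60 * sqrt n] this is
    of order [n ^ 2], while the close pairs contribute [n * sqrt n * ln n]. For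
    this count the logarithm of [n] that comes from a union over all
    coordinates must not multiply the reciprocal of the opposite gap;
    [rho_le_gaps] treats the eigenvalue at the opposite end apart from all the
    others.

    Every estimate for GUE follows from the behaviour of a Gaussian matrix
    under translation ([cameron_martin]): averaged over the translates by [S]
    and [- S], the probability of an event drops at most by the factor
    [exp (- |S| ^ 2 / 2)] ([GUE_quasi_invariant]). Hence, if many translates of
    an event by matrices of Frobenius norm at most 1 are disjoint, the event
    has small probability ([packing_le]). Scalar matrices move the opposite
    gap. For a close pair at the top, remove a row and the corresponding
    column: both eigenvalues being close to the top eigenvalue of the minor
    forces a weak coupling between the removed row and the top eigenvector of
    the minor ([near_top_weak_coupling]). The coupling is a complex number
    which moves freely with the row, so a two-dimensional grid of translates is
    available, and this gives [e ^ 2]. Starting vectors are treated by the same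
    packing argument, with rotations in place of translations
    ([coord_small_le]).

    The choice of dominant eigenvectors is arbitrary, so [rho] need not be a
    measurable function of the matrix. The expectation is compared with that of
    a measurable majorant by monotonicity, which holds for all nonnegative
    functions ([ge0_le_lower_integral]). *)

(** * Complex scalars and the Hermitian space *)

Lemma natr_dist_ge1 (F : realDomainType) (k l : nat) : k != l -> 1 <= `|k%:R - l%:R| :> F.
Proof.
wlog kl : k l / (k < l)%N => [h kl|_].
  by have [lt|lt|e] := ltngtP k l; [exact: h|rewrite distrC; apply: h; rewrite // eq_sym|rewrite e eqxx in kl].
by rewrite distrC ger0_norm ?subr_ge0 ?ler_nat ?(ltnW kl) // lerBrDr addrC natr1 ler_nat.
Qed.

Section ComplexScalars.
Context {R : realType}.
Local Notation C := R[i].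
Import Normc.
Implicit Types (z w : C) (a : R).

Lemma normcD z w : normc (z + w) <= normc z + normc w.
Proof. exact: le_normcD. Qed.

Lemma normc_sqr z : normc z ^+ 2 = complex.Re z ^+ 2 + complex.Im z ^+ 2.
Proof. by case: z => a b /=; rewrite sqr_sqrtr // addr_ge0 ?sqr_ge0. Qed.

Lemma normc_ge0 z : 0 <= normc z.
Proof. by case: z => a b; rewrite /= sqrtr_ge0. Qed.

Lemma mulr_conj z : z * (z^*)%R = ((normc z) ^+ 2)%:C.
Proof. by rewrite normc_sqr; case: z => a b /=; simpc; congr (_ +i* _); ring. Qed.

Lemma normc_conj z : normc (z^*)%R = normc z.
Proof. by case: z => a b /=; rewrite sqrrN. Qed.

Lemma normc_real a : normc a%:C = `|a|.
Proof. by rewrite /= expr0n addr0 sqrtr_sqr. Qed.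

Lemma conj_real a : ((a%:C)^*)%R = a%:C.
Proof. by apply/eqP; rewrite eq_complex /= oppr0 !eqxx. Qed.

Lemma normc_Re z : `|complex.Re z| <= normc z.
Proof.
rewrite -(@ler_pXn2r _ 2) ?nnegrE ?normc_ge0 ?normr_ge0 //.
by rewrite normc_sqr real_normK ?num_real // lerDl sqr_ge0.
Qed.

Lemma normcN z : normc (- z) = normc z.
Proof. by case: z => a b /=; rewrite !sqrrN. Qed.

Lemma normcB_ge z w : normc z - normc w <= normc (z + w).
Proof. by rewrite lerBlDr -[X in normc X](addrK w) -(normcN w); exact: normcD. Qed.

Lemma ReD z w : complex.Re (z + w) = complex.Re z + complex.Re w.
Proof. by case: z; case: w. Qed.
Lemma ReN z : complex.Re (- z) = - complex.Re z.
Proof. by case: z. Qed.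
Lemma ImD z w : complex.Im (z + w) = complex.Im z + complex.Im w.
Proof. by case: z; case: w. Qed.
Lemma ImN z : complex.Im (- z) = - complex.Im z.
Proof. by case: z. Qed.
Lemma ReZ a z : complex.Re (a%:C * z) = a * complex.Re z.
Proof. by case: z => x y /=; rewrite mul0r subr0. Qed.
Lemma ImZ a z : complex.Im (a%:C * z) = a * complex.Im z.
Proof. by case: z => x y /=; rewrite mul0r addr0. Qed.
Lemma cRe_conj z : complex.Re (z^*)%R = complex.Re z.
Proof. by case: z. Qed.
Lemma cIm_conj z : complex.Im (z^*)%R = - complex.Im z.
Proof. by case: z. Qed.
Lemma Re_sum (I : Type) (r : seq I) (P : pred I) (F : I -> C) :
  complex.Re (\sum_(i <- r | P i) F i) = \sum_(i <- r | P i) complex.Re (F i).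
Proof. by elim/big_ind2 : _ => // x1 x2 y1 y2 <- <-; exact: ReD. Qed.
End ComplexScalars.

Section HermitianForms.
Context {R : realType} {n : nat}.
Local Notation C := R[i].
Import Normc.
Local Open Scope sesquilinear_scope.
Implicit Types (x y z : 'cV[C]_n) (A B V : 'M[C]_n) (c : C) (a : R).

Definition sqn x : R := \sum_(i < n) normc (x i ord0) ^+ 2.

Lemma herm_normE x : herm_norm x = Num.sqrt (sqn x).
Proof. by []. Qed.

Lemma sqn_ge0 x : 0 <= sqn x.
Proof. by apply: sumr_ge0 => i _; exact: sqr_ge0. Qed.

Lemma herm_norm_ge0 x : 0 <= herm_norm x.
Proof. exact: sqrtr_ge0. Qed.

Lemma sqr_herm_norm x : herm_norm x ^+ 2 = sqn x.
Proof. by rewrite sqr_sqrtr // sqn_ge0. Qed.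

Lemma sqn_eq0 x : (sqn x == 0) = (x == 0).
Proof.
apply/idP/eqP => [/eqP h|->]; last first.
  by rewrite /sqn big1 // => i _; rewrite mxE normc0 expr0n.
apply/matrixP => i j; rewrite (ord1 j) mxE.
move: h; rewrite /sqn => /psumr_eq0P h.
have /eqP := h (fun i _ => sqr_ge0 _) i isT.
by rewrite sqrf_eq0 => /eqP /eq0_normc.
Qed.

Lemma sqn_gt0 x : (0 < sqn x) = (x != 0).
Proof. by rewrite lt_def sqn_eq0 sqn_ge0 andbT. Qed.

Lemma herm_norm_gt0 x : (0 < herm_norm x) = (x != 0).
Proof. by rewrite sqrtr_gt0 sqn_gt0. Qed.

Lemma herm_dotDl x y z : herm_dot (x + y) z = herm_dot x z + herm_dot y z.
Proof. by rewrite -big_split; apply: eq_bigr => i _; rewrite mxE mulrDl. Qed.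

Lemma herm_dotZl c x y : herm_dot (c *: x) y = c * herm_dot x y.
Proof. by rewrite mulr_sumr; apply: eq_bigr => i _; rewrite mxE mulrA. Qed.

Lemma herm_dotNl x y : herm_dot (- x) y = - herm_dot x y.
Proof. by rewrite -scaleN1r herm_dotZl mulN1r. Qed.

Lemma herm_dotC x y : herm_dot y x = ((herm_dot x y)^*)%R.
Proof.
rewrite rmorph_sum; apply: eq_bigr => i _.
by rewrite rmorphM /= conjCK mulrC.
Qed.

Lemma herm_dotDr x y z : herm_dot z (x + y) = herm_dot z x + herm_dot z y.
Proof. by rewrite herm_dotC herm_dotDl rmorphD /= -!herm_dotC. Qed.

Lemma herm_dotZr c x y : herm_dot x (c *: y) = (c^*)%R * herm_dot x y.
Proof. by rewrite herm_dotC herm_dotZl rmorphM /= -herm_dotC. Qed.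

Lemma herm_dot0l x : herm_dot 0 x = 0.
Proof. by rewrite -(scale0r 0) herm_dotZl mul0r. Qed.

Lemma herm_dotxx x : herm_dot x x = (sqn x)%:C.
Proof.
by rewrite (rmorph_sum (@real_complex R)); apply: eq_bigr => i _; exact: mulr_conj.
Qed.

Lemma herm_dot_mulmx A x y : herm_dot (A *m x) y = herm_dot x (A ^t* *m y).
Proof.
rewrite /herm_dot.
under eq_bigr do rewrite mxE mulr_suml.
rewrite exchange_big; apply: eq_bigr => j _.
rewrite mxE rmorph_sum mulr_sumr; apply: eq_bigr => i _.
by rewrite !mxE rmorphM /= conjCK mulrCA mulrA.
Qed.

Lemma sqnD x y : sqn (x + y) = sqn x + 2 * complex.Re (herm_dot x y) + sqn y.
Proof.
apply: complexI; rewrite -herm_dotxx herm_dotDl !herm_dotDr !herm_dotxx.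
rewrite (herm_dotC x y); set d := herm_dot x y.
case: d => p q; apply/eqP; rewrite eq_complex /=; apply/andP; split; apply/eqP; ring.
Qed.

Lemma sqnZ c x : sqn (c *: x) = normc c ^+ 2 * sqn x.
Proof. by rewrite mulr_sumr; apply: eq_bigr => i _; rewrite mxE normcM exprMn. Qed.

Lemma sqnN x : sqn (- x) = sqn x.
Proof. by apply: eq_bigr => i _; rewrite mxE normcN. Qed.

Lemma herm_normZ c x : herm_norm (c *: x) = normc c * herm_norm x.
Proof. by rewrite !herm_normE sqnZ sqrtrM ?sqr_ge0 // sqrtr_sqr ger0_norm // normc_ge0. Qed.

(** The square of the norm of [sqn y *: x - <x, y> *: y] is nonnegative. *)
Lemma cauchy_schwarz_sqn x y : normc (herm_dot x y) ^+ 2 <= sqn x * sqn y.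
Proof.
have [y0|y0] := eqVneq y 0.
  by rewrite y0 herm_dotC herm_dot0l rmorph0 normc0 expr0n mulr_ge0 // sqn_ge0.
have yp : 0 < sqn y by rewrite sqn_gt0.
set d := herm_dot x y.
have := sqn_ge0 ((sqn y)%:C *: x + (- d) *: y).
rewrite sqnD !sqnZ herm_dotZl herm_dotZr -/d normcN normc_real.
rewrite [X in complex.Re X](_ : _ = - ((sqn y) * normc d ^+ 2)%:C); last first.
  by rewrite rmorphN mulNr mulrN [(_^*)%R * _]mulrC mulr_conj -rmorphM.
rewrite ReN [complex.Re _]/= real_normK ?num_real // => h.
rewrite -(ler_pM2l yp); move: h; nra.
Qed.

Lemma cauchy_schwarz x y : normc (herm_dot x y) <= herm_norm x * herm_norm y.
Proof.
rewrite -(@ler_pXn2r _ 2) ?nnegrE ?mulr_ge0 ?herm_norm_ge0 ?normc_ge0 //.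
by rewrite exprMn !sqr_herm_norm cauchy_schwarz_sqn.
Qed.

Lemma herm_normD x y : herm_norm (x + y) <= herm_norm x + herm_norm y.
Proof.
rewrite -(@ler_pXn2r _ 2) ?nnegrE ?addr_ge0 ?herm_norm_ge0 //.
rewrite sqr_herm_norm sqnD sqrrD !sqr_herm_norm lerD2r lerD2l -[X in _ <= X]mulr_natl.
rewrite ler_pM2l // (le_trans (ler_norm _)) // (le_trans (normc_Re _)) //.
exact: cauchy_schwarz.
Qed.

Lemma normc_le_herm_norm x i : normc (x i ord0) <= herm_norm x.
Proof.
rewrite -(@ler_pXn2r _ 2) ?nnegrE ?herm_norm_ge0 ?normc_ge0 // sqr_herm_norm.
by rewrite /sqn (bigD1 i) //= lerDl sumr_ge0 // => j _; exact: sqr_ge0.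
Qed.

Lemma unitary_dot V x y : V \is unitarymx ->
  herm_dot (V *m x) (V *m y) = herm_dot x y.
Proof.
move=> Vu; rewrite herm_dot_mulmx mulmxA.
by rewrite -(invmx_unitary Vu) mulVmx ?unitarymx_unit // mul1mx.
Qed.

Lemma unitary_sqn V x : V \is unitarymx -> sqn (V *m x) = sqn x.
Proof. by move=> Vu; apply: complexI; rewrite -!herm_dotxx unitary_dot. Qed.

Lemma herm_normN x : herm_norm (- x) = herm_norm x.
Proof. by rewrite !herm_normE sqnN. Qed.

(** Squared Frobenius norm. *)
Definition frob2 A : R := \sum_(i < n) \sum_(j < n) normc (A i j) ^+ 2.

Lemma frob2_ge0 A : 0 <= frob2 A.
Proof. by apply: sumr_ge0 => i _; apply: sumr_ge0 => j _; exact: sqr_ge0. Qed.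

Lemma sqn_mulmx_le A x : sqn (A *m x) <= frob2 A * sqn x.
Proof.
rewrite mulr_suml; apply: ler_sum => i _.
pose r : 'cV[C]_n := \col_j ((A i j)^*)%R.
have -> : (A *m x) i ord0 = herm_dot x r.
  by rewrite mxE; apply: eq_bigr => j _; rewrite mxE conjCK mulrC.
apply: le_trans (cauchy_schwarz_sqn _ _) _.
rewrite mulrC ler_wpM2r ?sqn_ge0 // le_eqVlt; apply/orP; left; apply/eqP.
by apply: eq_bigr => j _; rewrite mxE normc_conj.
Qed.

Lemma herm_norm_mulmx_le A x :
  herm_norm (A *m x) <= Num.sqrt (frob2 A) * herm_norm x.
Proof. by rewrite !herm_normE -sqrtrM ?frob2_ge0 // ler_wsqrtr // sqn_mulmx_le. Qed.

Lemma hermsymmxP A : reflect (A ^t* = A) (A \is hermsymmx).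
Proof.
rewrite qualifE /= expr0 scale1r eq_sym.
exact: eqP.
Qed.

Lemma herm_dot_sym A x y : A \is hermsymmx ->
  herm_dot (A *m x) y = herm_dot x (A *m y).
Proof. by move=> /hermsymmxP Ah; rewrite herm_dot_mulmx Ah. Qed.

(** The real part makes this a real number for every matrix; it is then the
    quadratic form of the Hermitian part ([qform_hermitian_part]). *)
Definition qform A x : R := complex.Re (herm_dot (A *m x) x).

Lemma qformDl A B x : qform (A + B) x = qform A x + qform B x.
Proof. by rewrite /qform mulmxDl herm_dotDl ReD. Qed.

Lemma qformN A x : qform (- A) x = - qform A x.
Proof. by rewrite /qform mulNmx herm_dotNl ReN. Qed.

Lemma qformZ A c x : qform A (c *: x) = normc c ^+ 2 * qform A x.
Proof.
rewrite /qform -scalemxAr herm_dotZl herm_dotZr mulrA mulr_conj.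
exact: ReZ.
Qed.

Lemma qform_scalar a x : qform (a%:C%:M) x = a * sqn x.
Proof. by rewrite /qform mul_scalar_mx herm_dotZl herm_dotxx ReZ. Qed.

Lemma qformD A x y : A \is hermsymmx ->
  qform A (x + y) = qform A x + 2 * complex.Re (herm_dot (A *m x) y) + qform A y.
Proof.
move=> Ah; rewrite /qform mulmxDr !herm_dotDl !herm_dotDr !ReD.
by rewrite (herm_dot_sym y x Ah) (herm_dotC (A *m x) y) cRe_conj; ring.
Qed.

Lemma qform_le A x : `|qform A x| <= Num.sqrt (frob2 A) * sqn x.
Proof.
rewrite (le_trans (normc_Re _)) // (le_trans (cauchy_schwarz _ _)) //.
rewrite -sqr_herm_norm expr2 mulrA ler_wpM2r ?herm_norm_ge0 //.
exact: herm_norm_mulmx_le.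
Qed.

End HermitianForms.

(** * Diagonalization and convergence of power iteration *)

Section Spectral.
Context {R : realType} {n : nat}.
Local Notation C := R[i].
Import Normc.
Local Open Scope sesquilinear_scope.
Implicit Types (x y z u : 'cV[C]_n) (A B V : 'M[C]_n) (d : 'I_n -> R).

(** A unitary diagonalization with a named spectrum: the rows of [V] are the
    conjugates of an orthonormal eigenbasis, and [V *m x] lists the coordinates
    of [x]. *)
Definition diagonalizes V d A :=
  V \is unitarymx /\ A = V ^t* *m diag_mx (\row_i (d i)%:C) *m V.

Lemma hermitian_diagonalizes A : A \is hermsymmx ->
  exists V d, diagonalizes V d A.
Proof.
move=> Ah; exists (spectralmx A), (fun i => complex.Re (spectral_diag A ord0 i)).
split; first exact: spectral_unitarymx.
rewrite -(invmx_unitary (spectral_unitarymx A)).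
rewrite [LHS](orthomx_spectralP (hermitian_normalmx Ah)).
suff <- : spectral_diag A = \row_i (complex.Re (spectral_diag A ord0 i))%:C by [].
apply/rowP => i; rewrite mxE.
have /mxOverP/(_ ord0 i) := hermitian_spectral_diag_real Ah.
by move=> /complex_realP[r ->].
Qed.

Lemma diagonalizes_opp V d A : diagonalizes V d A -> diagonalizes V (fun i => - d i) (- A).
Proof.
move=> [Vu ->]; split; first exact: Vu.
rewrite -mulNmx -mulmxN (_ : - diag_mx _ = diag_mx (\row_i (- d i)%:C)) //.
by apply/matrixP => i j; rewrite !mxE rmorphN mulNrn.
Qed.

Section Diagonalized.
Variables (V A : 'M[C]_n) (d : 'I_n -> R).
Hypothesis VdA : diagonalizes V d A.

Let Vu : V \is unitarymx. Proof. by case: VdA. Qed.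

Lemma diag_mulmx x i : (V *m (A *m x)) i ord0 = (d i)%:C * (V *m x) i ord0.
Proof.
have [_ ->] := VdA.
rewrite !mulmxA (unitarymxP Vu) mul1mx -mulmxA mul_diag_mx mxE.
by rewrite [in LHS]mxE.
Qed.

Lemma diag_expmx x k i : (V *m (A ^+ k *m x)) i ord0 = ((d i) ^+ k)%:C * (V *m x) i ord0.
Proof.
elim: k x => [|k IH] x; first by rewrite !expr0 mul1mx mul1r.
by rewrite exprSr -mulmxE -mulmxA IH diag_mulmx mulrA -rmorphM exprSr.
Qed.

Lemma diag_qform x : qform A x = \sum_i d i * normc ((V *m x) i ord0) ^+ 2.
Proof.
rewrite /qform -(unitary_dot _ _ Vu) Re_sum; apply: eq_bigr => i _.
by rewrite diag_mulmx -mulrA mulr_conj ReZ.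
Qed.

Definition eigvec i : 'cV[C]_n := V ^t* *m delta_mx i ord0.

Lemma mul_eigvec i : V *m eigvec i = delta_mx i ord0.
Proof. by rewrite /eigvec mulmxA (unitarymxP Vu) mul1mx. Qed.

Lemma unitary_inj x y : V *m x = V *m y -> x = y.
Proof.
by move=> h; rewrite -[x]mul1mx -[y]mul1mx -(mulVmx (unitarymx_unit Vu)) -!mulmxA h.
Qed.

Lemma eigvecP i : A *m eigvec i = (d i)%:C *: eigvec i.
Proof.
apply: unitary_inj; apply/colP => j; rewrite diag_mulmx -scalemxAr mul_eigvec !mxE.
by case: eqVneq => [->|] //; rewrite !mulr0.
Qed.

Lemma sqn_eigvec i : sqn (eigvec i) = 1.
Proof.
rewrite -(unitary_sqn _ Vu) mul_eigvec /sqn (bigD1 i) //= big1 => [|j /negPf ji].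
  by rewrite mxE !eqxx normc1 expr1n addr0.
by rewrite mxE ji normc0 expr0n.
Qed.

Lemma herm_dot_eigvec x i : herm_dot x (eigvec i) = (V *m x) i ord0.
Proof.
rewrite -(unitary_dot _ _ Vu) mul_eigvec /herm_dot (bigD1 i) //= big1 => [|j /negPf ji].
  by rewrite [delta_mx _ _ _ _]mxE !eqxx rmorph1 mulr1 addr0.
by rewrite [delta_mx _ _ _ _]mxE ji rmorph0 mulr0.
Qed.

Lemma eigenvalue_diag i : eigenvalue A (d i)%:C.
Proof.
have [_ hA] := VdA.
apply/eigenvalueP; exists (row i V).
  rewrite {1}hA -!row_mul !mulmxA (unitarymxP Vu) mul1mx.
  by apply/rowP => j; rewrite mxE mul_diag_mx !mxE.
apply/eqP => h; have /eqP := oner_eq0 C; apply.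
have /matrixP/(_ i i) := unitarymxP Vu.
rewrite [1%:M _ _]mxE eqxx mulr1n => <-; rewrite mxE; apply: big1 => j _.
by move/rowP: h => /(_ j); rewrite !mxE => ->; rewrite mul0r.
Qed.

(** The eigenvalue of [u] has modulus at least [`|d i0|], so it differs from
    [d i]; comparing coordinates in [A *m u = l *: u] kills the other ones. In
    particular [u] is unique up to a scalar when there is a gap in modulus. *)
Lemma dominant_coord u i0 : (forall i, i != i0 -> `|d i| < `|d i0|) ->
  dominant_eigenvector A u ->
  forall i, i != i0 -> (V *m u) i ord0 = 0.
Proof.
move=> gap [u0 [l Au lmax]] i ii0.
have := lmax _ (eigenvalue_diag i0); rewrite normc_real => dl.
have /colP/(_ i) : V *m (A *m u) = V *m (l *: u) by rewrite Au.
rewrite diag_mulmx -scalemxAr [in RHS]mxE => /eqP.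
rewrite -subr_eq0 -mulrBl mulf_eq0 => /orP[|/eqP//].
rewrite subr_eq0 => /eqP h; move: dl; rewrite -h normc_real leNgt gap //.
Qed.

End Diagonalized.

Lemma acos_le (c a : R) : 0 <= a -> a <= pi -> cos a <= c -> c <= 1 -> acos c <= a.
Proof.
move=> a0 api ac c1.
have cm1 : -1 <= c <= 1 by rewrite c1 (le_trans _ ac) // cos_geN1.
rewrite leNgt; apply/negP => h.
have : cos (acos c) < cos a.
  by rewrite ltr_cos // in_itv /= ?a0 ?api // acos_ge0 // acos_lepi.
by rewrite acosK ?in_itv //= ltNge ac.
Qed.

Section Convergence.
Variables (V A : 'M[C]_n) (d : 'I_n -> R) (i0 : 'I_n) (u : 'cV[C]_n) (alpha : R).
Hypotheses (VdA : diagonalizes V d A) (gap : forall i, i != i0 -> `|d i| < `|d i0|).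
Hypotheses (Adom : dominant_eigenvector A u) (a0 : 0 <= alpha) (api : alpha < pi / 2).

(** The dominant eigenvector is the basis vector [i0] up to a scalar, so the
    cosine of the distance is the share of the coordinate [i0] in the norm of
    [x], and the hypothesis says that the tangent is at most [tan alpha]. *)
Lemma fubini_study_dominant_le x : (V *m x) i0 ord0 != 0 ->
  cos alpha ^+ 2 * (\sum_(i | i != i0) normc ((V *m x) i ord0) ^+ 2) <=
    sin alpha ^+ 2 * normc ((V *m x) i0 ord0) ^+ 2 ->
  fubini_study x u <= alpha.
Proof.
set y := V *m x => y0 hy.
have [Vu _] := VdA.
have apii : alpha <= pi by apply: ltW (lt_le_trans api _); rewrite ler_pdivrMr // ler_peMr ?pi_ge0 // ler1n.
have cos_ge : 0 <= cos alpha by apply: cos_ge0_pihalf; rewrite (ltW api) (le_trans _ a0) // oppr_le0 divr_ge0 ?pi_ge0.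
have hu0 := dominant_coord VdA gap Adom.
have u0 : u != 0 by have [] := Adom.
have sqnu : sqn u = normc ((V *m u) i0 ord0) ^+ 2.
  rewrite -(unitary_sqn _ Vu) /sqn (bigD1 i0) //= big1 ?addr0 // => i ii0.
  by rewrite hu0 // normc0 expr0n.
have nu : herm_norm u = normc ((V *m u) i0 ord0).
  by rewrite herm_normE sqnu sqrtr_sqr ger0_norm // normc_ge0.
have dxu : normc (herm_dot x u) = normc (y i0 ord0) * herm_norm u.
  rewrite nu -(unitary_dot _ _ Vu) /herm_dot (bigD1 i0) //= big1 => [|i ii0].
    by rewrite addr0 normcM normc_conj.
  by rewrite hu0 // rmorph0 mulr0.
have np : 0 < herm_norm u by rewrite herm_norm_gt0.
have yp : 0 < normc (y i0 ord0).
  by rewrite lt_def normc_ge0 andbT; apply: contra y0 => /eqP /eq0_normc ->.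
have sqnx : sqn x = normc (y i0 ord0) ^+ 2 + \sum_(i | i != i0) normc (y i ord0) ^+ 2.
  by rewrite -(unitary_sqn _ Vu) /sqn (bigD1 i0).
have xp : 0 < herm_norm x.
  rewrite sqrtr_gt0 -/(sqn x) sqnx ltr_pwDl ?exprn_gt0 //.
  by apply: sumr_ge0 => i _; exact: sqr_ge0.
rewrite /fubini_study dxu invfM [(herm_norm x)^-1 * _]mulrC mulrA mulfK ?gt_eqF //.
apply: acos_le => //; last first.
  rewrite ler_pdivrMr // mul1r -(@ler_pXn2r _ 2) ?nnegrE ?(ltW yp) ?(ltW xp) //.
  rewrite sqr_herm_norm sqnx lerDl; apply: sumr_ge0 => i _; exact: sqr_ge0.
rewrite ler_pdivlMr // -(@ler_pXn2r _ 2) ?nnegrE ?(ltW yp) ?mulr_ge0 ?(ltW xp) //.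
rewrite exprMn sqr_herm_norm sqnx mulrDr.
apply: le_trans (lerD (lexx _) hy) _.
by rewrite -mulrDl cos2Dsin2 mul1r.
Qed.

(** Normalization does not change the line, and in eigencoordinates [A ^+ k]
    multiplies the coordinate [i] by [d i ^+ k]. *)
Lemma power_iterate_le x k : d i0 != 0 -> (V *m x) i0 ord0 != 0 ->
  cos alpha ^+ 2 * (\sum_(i | i != i0) (`|d i| ^+ k * normc ((V *m x) i ord0)) ^+ 2) <=
    sin alpha ^+ 2 * (`|d i0| ^+ k * normc ((V *m x) i0 ord0)) ^+ 2 ->
  fubini_study (power_iterate A x k) u <= alpha.
Proof.
move=> d0 y0 h.
have x0 : x != 0 by apply: contra y0 => /eqP ->; rewrite mulmx0 mxE.
have xp : 0 < herm_norm x by rewrite herm_norm_gt0.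
set w := A ^+ k *m normalize x.
have hw i : (V *m w) i ord0 = ((herm_norm x)^-1 * d i ^+ k)%:C * (V *m x) i ord0.
  rewrite (diag_expmx VdA) /normalize -scalemxAr [in LHS]mxE mulrA -rmorphM.
  by rewrite [(d i ^+ k / _)%R]mulrC.
have w0 : w != 0.
  apply/eqP => w0; have := hw i0; rewrite w0 mulmx0 mxE => /esym/eqP.
  rewrite mulf_eq0 (negPf y0) orbF => /eqP /(congr1 (@complex.Re R)) /= /eqP.
  by rewrite mulf_eq0 invr_eq0 gt_eqF //= expf_eq0 (negPf d0) andbF.
have wp : 0 < herm_norm w by rewrite herm_norm_gt0.
pose b := (herm_norm w)^-1 * (herm_norm x)^-1.
have bp : 0 < b by rewrite mulr_gt0 // invr_gt0.
have hp i : (V *m power_iterate A x k) i ord0 = (b * d i ^+ k)%:C * (V *m x) i ord0.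
  by rewrite /power_iterate -/w /normalize -scalemxAr mxE hw mulrA -rmorphM mulrA.
have hn i : normc ((V *m power_iterate A x k) i ord0) =
    b * (`|d i| ^+ k * normc ((V *m x) i ord0)).
  by rewrite hp normcM normc_real normrM normrX gtr0_norm // mulrA.
apply: fubini_study_dominant_le.
  rewrite hp mulf_neq0 //; apply/eqP => /(congr1 (@complex.Re R)) /= /eqP.
  by rewrite mulf_eq0 gt_eqF //= expf_eq0 (negPf d0) andbF.
under eq_bigr do rewrite hn exprMn.
rewrite -mulr_sumr hn (exprMn _ b) !(mulrCA _ (b ^+ 2)) ler_pM2l ?exprn_gt0 //.
Qed.

End Convergence.

End Spectral.

Section HittingTime.
Context {R : realType}.
Local Open Scope ereal_scope.

(** A first hitting time is the number of earlier steps, and each of these is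
    counted by [b]. If [good] is never reached both sides are infinite. *)
Lemma ereal_inf_hitting_le (good : set nat) (b : nat -> R) :
  (forall k, (0 <= b k)%R) -> (forall k, ~ good k -> (1 <= b k)%R) ->
  ereal_inf [set (k%:R)%:E | k in good] <= \sum_(0 <= k <oo) (b k)%:E.
Proof.
move=> b0 hb.
have partial N : (forall k, (k < N)%N -> ~ good k) -> N%:R%:E <= \sum_(0 <= k <oo) (b k)%:E.
  move=> hN; apply: le_trans (nneseries_lim_ge N _) => //; last by move=> *; rewrite lee_fin.
  rewrite sumEFin lee_fin (_ : N%:R = \sum_(0 <= k < N) 1)%R; last by rewrite sumr_const_nat subn0.
  by apply: ler_sum_nat => k kN; exact: hb (hN _ kN).
have [[k0 gk0]|nex] := pselect (exists k, good k).
  have ex : exists k, `[< good k >] by exists k0; exact/asboolP.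
  case: (ex_minnP ex) => m /asboolP gm mmin.
  apply: le_trans (partial m _); first by apply: ereal_inf_lbound; exists m.
  by move=> k km gk; have := mmin k (asboolT gk); rewrite leqNgt km.
suff -> : \sum_(0 <= k <oo) (b k)%:E = +oo by rewrite leey.
apply/eq_infty => r.
apply: le_trans (partial (Num.truncn `|r|).+1 _).
  by rewrite lee_fin (le_trans (ler_norm r)) // ltW // truncnS_gt.
by move=> k _ gk; apply: nex; exists k.
Qed.

End HittingTime.

(** * Measurability of matrix expressions *)

Section ComplexMeasurability.
Context {R : realType} {dd : measure_display} {T : measurableType dd}.
Local Notation C := R[i].
Import Normc.
Implicit Types z w : T -> C.

(** Measurability for the Borel sets of the plane, tested on the two real
    coordinates. *)
Definition cmeasurable z :=
  measurable_fun [set: T] (fun t => complex.Re (z t)) /\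
  measurable_fun [set: T] (fun t => complex.Im (z t)).

Lemma cmeasurable_cst c : cmeasurable (fun=> c).
Proof. by split; exact: measurable_cst. Qed.

Lemma cmeasurableD z w : cmeasurable z -> cmeasurable w ->
  cmeasurable (fun t => z t + w t).
Proof.
move=> [z1 z2] [w1 w2]; split.
- by under eq_fun do rewrite ReD; exact: measurable_funD.
- by under eq_fun do rewrite ImD; exact: measurable_funD.
Qed.

Lemma cmeasurableM z w : cmeasurable z -> cmeasurable w ->
  cmeasurable (fun t => z t * w t).
Proof.
move=> [z1 z2] [w1 w2]; split.
- rewrite (_ : (fun _ => _) = fun t => complex.Re (z t) * complex.Re (w t) - complex.Im (z t) * complex.Im (w t)).
    by apply: measurable_funB; exact: measurable_funM.
  by apply/funext => t; case: (z t); case: (w t).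
- rewrite (_ : (fun _ => _) = fun t => complex.Re (z t) * complex.Im (w t) + complex.Im (z t) * complex.Re (w t)).
    by apply: measurable_funD; exact: measurable_funM.
  by apply/funext => t; case: (z t); case: (w t).
Qed.

Lemma cmeasurable_conj z : cmeasurable z -> cmeasurable (fun t => (z t)^*)%R.
Proof.
move=> [z1 z2]; split.
- by under eq_fun do rewrite cRe_conj.
- by under eq_fun do rewrite cIm_conj; exact: measurableT_comp.
Qed.

Lemma cmeasurable_sum (I : Type) (r : seq I) (F : I -> T -> C) :
  (forall i, cmeasurable (F i)) -> cmeasurable (fun t => \sum_(i <- r) F i t).
Proof.
move=> hF; elim: r => [|i r IH].
  by under eq_fun do rewrite big_nil; exact: cmeasurable_cst.
by under eq_fun do rewrite big_cons; exact: cmeasurableD.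
Qed.

Lemma measurable_normc z : cmeasurable z -> measurable_fun [set: T] (fun t => normc (z t)).
Proof.
move=> [z1 z2].
rewrite (_ : (fun _ => _) = fun t => Num.sqrt (complex.Re (z t) ^+ 2 + complex.Im (z t) ^+ 2)).
  apply: (measurableT_comp (f := @Num.sqrt R)); first by apply: continuous_measurable_fun => t0; exact: sqrt_continuous.
  by apply: measurable_funD; exact: measurable_funX.
by apply/funext => t; case: (z t).
Qed.

End ComplexMeasurability.

Section BorelMatrix.
Context {R : realType} {m n : nat}.
Local Notation C := R[i].

Lemma measurable_entry_part (t : 'I_m * 'I_n * bool) :
  measurable_fun [set: borel_mx R m n] (entry_part t : borel_mx R m n -> R).
Proof.
move=> _ B mB; rewrite setTI; apply: sub_sigma_algebra.
by exists t, B.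
Qed.

Lemma cmeasurable_entry (i : 'I_m) (j : 'I_n) :
  cmeasurable (fun X : borel_mx R m n => X i j).
Proof.
split; [exact: (measurable_entry_part (i, j, false))
       |exact: (measurable_entry_part (i, j, true))].
Qed.

Context {dd : measure_display} {T : measurableType dd}.

Lemma measurable_borel_mx (F : T -> borel_mx R m n) :
  (forall t, measurable_fun [set: T] (fun w => entry_part t (F w))) ->
  measurable_fun [set: T] F.
Proof.
move=> hF; apply: (@measurability _ _ _ _ _ F (@entry_cylinders R m n)) => //.
move=> _ [_ [t [B [mB ->]] <-]].
have := hF t measurableT B mB.
by rewrite !setTI.
Qed.

Lemma measurable_borel_mxP (F : T -> borel_mx R m n) :
  measurable_fun [set: T] F -> forall i j, cmeasurable (fun w => F w i j).
Proof.
move=> mF i j; have [h1 h2] := cmeasurable_entry i j.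
by split; [exact: (measurableT_comp h1 mF)|exact: (measurableT_comp h2 mF)].
Qed.

Lemma cmeasurable_borel_mx (F : T -> borel_mx R m n) :
  (forall i j, cmeasurable (fun w => F w i j)) -> measurable_fun [set: T] F.
Proof.
move=> h; apply: measurable_borel_mx => -[[i j] []].
- exact: (h i j).2.
- exact: (h i j).1.
Qed.

End BorelMatrix.

Section MatrixMeasurability.
Context {R : realType} {dd : measure_display} {T : measurableType dd} {n : nat}.
Local Notation C := R[i].
Variable (F : T -> borel_mx R n n).
Hypothesis mF : measurable_fun [set: T] F.

Lemma cmeasurable_mulmx (v : 'cV[C]_n) i : cmeasurable (fun w => ((F w : 'M[C]_n) *m v) i ord0).
Proof.
under eq_fun do rewrite mxE.
apply: cmeasurable_sum => j; apply: cmeasurableM; last exact: cmeasurable_cst.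
exact: measurable_borel_mxP.
Qed.

Lemma cmeasurable_herm_dot (v u : 'cV[C]_n) :
  cmeasurable (fun w => herm_dot ((F w : 'M[C]_n) *m v) u).
Proof.
apply: cmeasurable_sum => j; apply: cmeasurableM; last exact: cmeasurable_cst.
exact: cmeasurable_mulmx.
Qed.

Lemma measurable_qform (v : 'cV[C]_n) : measurable_fun [set: T] (fun w => qform (F w : 'M[C]_n) v).
Proof. by have [] := cmeasurable_herm_dot v v. Qed.

End MatrixMeasurability.

(** * Integrals, measures and series *)

Section IntegrationTools.
Context {R : realType} {dd : measure_display} {T : measurableType dd}.
Variable mu : {measure set T -> \bar R}.
Local Open Scope ereal_scope.

Lemma measurable_lt_set (f g : T -> R) :
  measurable_fun [set: T] f -> measurable_fun [set: T] g ->
  measurable [set x | (f x < g x)%R].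
Proof.
move=> mf mg; rewrite (_ : [set _ | _] = ~` ([set: T] `&` [set x | (g x <= f x)%R])).
  by apply: measurableC; exact: measurable_fun_le.
by rewrite setTI; apply/seteqP; split => x /=; [rewrite leNgt => -> |move/negP; rewrite -ltNge].
Qed.

Lemma measurable_le_set (f g : T -> R) :
  measurable_fun [set: T] f -> measurable_fun [set: T] g ->
  measurable [set x | (f x <= g x)%R].
Proof. by move=> mf mg; rewrite -[X in measurable X]setTI; exact: measurable_fun_le. Qed.

(** The integral of a nonnegative function is the supremum of the integrals of
    the simple functions below it, so it is monotone on all nonnegative
    functions. *)
Lemma ge0_le_lower_integral (D : set T) (f g : T -> \bar R) :
  (forall x, D x -> 0 <= f x) -> (forall x, D x -> f x <= g x) ->
  \int[mu]_(x in D) f x <= \int[mu]_(x in D) g x.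
Proof.
move=> f0 fg; have g0 x : D x -> 0 <= g x by move=> Dx; apply: le_trans (f0 x Dx) (fg x Dx).
rewrite !ge0_integralE //; apply: le_ereal_sup => _ /= [h hf <-]; exists h => // x.
apply: le_trans (hf x) _; rewrite /patch; case: ifPn => // /set_mem; exact: fg.
Qed.

Lemma sum_measure_disjoint_le (I : finType) (F : I -> set T) (B : set T) :
  (forall i, measurable (F i)) -> measurable B ->
  (forall i j x, F i x -> F j x -> i = j) ->
  (forall i, F i `<=` B) ->
  \sum_(i : I) mu (F i) <= mu B.
Proof.
move=> mF mB dF FB.
rewrite (reindex (@enum_val I predT)) /=; last first.
  by apply: onW_bij; exact: enum_val_bij.
rewrite -measure_bigsetU_ord //; last first.
  move=> i j _ _ [x [Fi Fj]]; apply: enum_val_inj; exact: dF Fi Fj.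
apply: le_measure; rewrite ?inE //; first by apply: bigsetU_measurable => i _; exact: mF.
by apply: (big_ind (fun A => A `<=` B)) => [|A1 A2 h1 h2|i _]; [exact: sub0set|by rewrite subUset|exact: FB].
Qed.

End IntegrationTools.

Section GeometricSeries.
Context {R : realType}.

Lemma sum_geometric_le (q : R) (N : nat) : 0 < q -> q <= 1 ->
  \sum_(0 <= k < N) (1 - q) ^+ k <= q^-1.
Proof.
move=> q0 q1; rewrite -(ler_pM2l q0) mulfV ?gt_eqF // big_mkord.
have h := subrX1 (1 - q) N.
rewrite (_ : 1 - q - 1 = - q) in h; last by ring.
have -> : q * \sum_(i < N) (1 - q) ^+ i = 1 - (1 - q) ^+ N.
  by apply: oppr_inj; rewrite opprB h mulNr.
by rewrite lerBlDr lerDl exprn_ge0 // subr_ge0.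
Qed.

(** Bound the terms by 1 up to the index [ln B / q], and by a geometric series
    from there on. *)
Lemma nneseries_truncated_geometric_le (B q : R) : 1 <= B -> 0 < q -> q <= 1 ->
  (\sum_(0 <= k <oo) (Num.min 1 (B * (1 - q) ^+ k))%:E <= ((2 + ln B) / q)%:E)%E.
Proof.
move=> B1 q0 q1; have r0 : 0 <= 1 - q by rewrite subr_ge0.
have B0 : 0 < B by exact: lt_le_trans B1.
have lnB : 0 <= ln B by exact: ln_ge0.
pose b k : R := Num.min 1 (B * (1 - q) ^+ k).
have b0 k : 0 <= b k by rewrite le_min ler01 mulr_ge0 ?exprn_ge0 // ltW.
pose K := (Num.truncn (ln B / q)).+1.
have hK : B * (1 - q) ^+ K <= 1.
  have : (1 - q) ^+ K <= (expR (- q)) ^+ K.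
    by rewrite lerXn2r ?nnegrE ?expR_ge0 // expR_ge1Dx.
  move=> /le_trans h; rewrite -ler_pdivlMl // mulr1; apply: h.
  rewrite -expRM_natl -[B in leRHS]lnK ?posrE // -expRN ler_expR mulrN lerN2.
  by rewrite -ler_pdivrMr // ltW // truncnS_gt.
have hKle : K%:R <= ln B / q + 1.
  by rewrite /K -natr1 lerD2r truncn_le // divr_ge0 // ltW.
apply: lime_le; first by apply: is_cvg_nneseries => k _ _; rewrite lee_fin; exact: b0.
near=> N; rewrite sumEFin lee_fin.
apply: (@le_trans _ _ (\sum_(0 <= k < K + N) b k)).
  rewrite addnC [leRHS](@big_cat_nat _ _ _ N 0 (N + K)) //=; last exact: leq_addr.
  by rewrite lerDl sumr_ge0.
rewrite (@big_cat_nat _ _ _ K 0 (K + N)) //=; last exact: leq_addr.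
apply: (@le_trans _ _ (K%:R + q^-1)).
  apply: lerD.
    rewrite (_ : K%:R = \sum_(0 <= k < K) 1); last by rewrite sumr_const_nat subn0.
    by apply: ler_sum_nat => k _; rewrite ge_min lexx.
  rewrite -{1}[K]add0n big_addn addKn.
  apply: le_trans (sum_geometric_le N q0 q1); apply: ler_sum_nat => k _.
  rewrite ge_min; apply/orP; right; rewrite addnC exprD mulrA.
  by rewrite ler_piMl // exprn_ge0.
rewrite mulrDl; apply: le_trans (lerD hKle (lexx _)) _.
have : 1 <= q^-1 by rewrite invf_ge1.
by move: (ln B / q) (q^-1) => x y; lra.
Unshelve. all: by end_near.
Qed.

End GeometricSeries.

(** * Uniform starting vectors *)

Section UniformDirections.
Context {R : realType} {n : nat}.
Local Notation C := R[i].
Import Normc.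
Local Open Scope sesquilinear_scope.
Implicit Types (V U : 'M[C]_n).

(** A rotation of the plane of coordinates [i] and [j] by the angle whose
    tangent is [s]. *)
Lemma unitary_plane_rotation (i j : 'I_n) (s : R) : i != j ->
  exists2 U : 'M[C]_n, U \is unitarymx &
    exists2 c : R, 0 < c & forall x : 'cV[C]_n,
      (U *m x) i ord0 = c%:C * (x i ord0 + s%:C * x j ord0) /\
      (U *m x) j ord0 = c%:C * (x j ord0 - s%:C * x i ord0).
Proof.
move=> ij; have ji : j != i by rewrite eq_sym.
pose c : R := (Num.sqrt (1 + s ^+ 2))^-1.
have s1 : 0 < 1 + s ^+ 2 by rewrite ltr_pwDl // sqr_ge0.
have c0 : 0 < c by rewrite invr_gt0 sqrtr_gt0.
have cs : c ^+ 2 + (c * s) ^+ 2 = 1.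
  rewrite exprMn -[X in X + _]mulr1 -mulrDr /c exprVn sqr_sqrtr ?ltW //.
  by rewrite mulVf // gt_eqF.
(* The projection [P] onto the plane and the quarter turn [J] satisfy
   [P *m P = P], [P *m J = J *m P = J] and [J *m J = - P]. *)
pose P : 'M[C]_n := delta_mx i i + delta_mx j j.
pose J : 'M[C]_n := delta_mx i j - delta_mx j i.
have PP : P *m P = P.
  by rewrite mulmxDl !mulmxDr !mul_delta_mx_cond !eqxx (negPf ij) (negPf ji) !mulr1n !mulr0n addr0 add0r.
have PJ : P *m J = J.
  by rewrite mulmxDl !mulmxBr !mul_delta_mx_cond !eqxx (negPf ij) (negPf ji) !mulr1n !mulr0n subr0 sub0r.
have JP : J *m P = J.
  by rewrite mulmxDr !mulmxBl !mul_delta_mx_cond !eqxx (negPf ij) (negPf ji) !mulr1n !mulr0n subr0 sub0r addrC.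
have JJ : J *m J = - P.
  by rewrite mulmxBl !mulmxBr !mul_delta_mx_cond !eqxx (negPf ij) (negPf ji) !mulr1n !mulr0n !subr0 sub0r opprD.
have [a aE] : {a : C | a = (c - 1)%:C} by exists (c - 1)%:C.
have [b bE] : {b : C | b = (c * s)%:C} by exists (c * s)%:C.
have ac : (a^*)%R = a by rewrite aE conj_real.
have bc : (b^*)%R = b by rewrite bE conj_real.
exists (1%:M + a *: P + b *: J).
  apply/unitarymxP.
  have -> : (1%:M + a *: P + b *: J) ^t* = 1%:M + a *: P - b *: J.
    apply/matrixP => k l; rewrite !mxE !rmorphD !rmorphM rmorphB !rmorphD /= ac bc !rmorph_nat /=.
    rewrite [l == k]eq_sym (andbC (l == i)) (andbC (l == j)) (andbC (l == i)) (andbC (l == j)).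
    rewrite -mulrN opprB; congr (_ + _ * _ + _ * _).
  rewrite mulmxBr !mulmxDr !mulmxDl mul1mx !mulmx1 -!scalemxAl -!scalemxAr ?mulmx1 ?mul1mx PP PJ JP JJ.
  rewrite !scalerA scalerN.
  have -> : 1%:M + a *: P + b *: J + (a *: P + (a * a) *: P + (b * a) *: J) - (b *: J + (a * b) *: J - (b * b) *: P)
     = 1%:M + (a + a + a * a + b * b) *: P.
    by rewrite (mulrC b a) !scalerDl; apply/matrixP => k l; rewrite !mxE; ring.
  have -> : a + a + a * a + b * b = 0.
    rewrite aE bE -!rmorphM -!rmorphD (_ : _ + _ = 0) ?rmorph0 //.
    by have := cs; rewrite !expr2 => h; nra.
  by rewrite scale0r addr0.
exists c => // x.
have mxd k l m : (delta_mx k l *m x) m ord0 = (m == k)%:R * x l ord0.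
  rewrite mxE (bigD1 l) //= mxE eqxx andbT big1 ?addr0 // => q /negPf ql.
  by rewrite mxE ql andbF mul0r.
rewrite !mulmxDl -!scalemxAl mul1mx mulmxDl mulmxBl.
have mxD (X Y : 'cV[C]_n) l : (X + Y) l ord0 = X l ord0 + Y l ord0 by rewrite mxE.
have mxN (X : 'cV[C]_n) l : (- X) l ord0 = - X l ord0 by rewrite mxE.
have mxZ e (X : 'cV[C]_n) l : (e *: X) l ord0 = e * X l ord0 by rewrite mxE.
split; rewrite !(mxD, mxZ, mxN) !mxd !eqxx ?(negPf ij) ?(negPf ji) aE bE rmorphM rmorphB rmorph1 /=.
  ring.
 ring.
Qed.

Variable nu : probability (borel_mx R n 1) R.
Hypothesis nu_unif : uniform_projective nu.

Definition coord_small_set V (i j : 'I_n) (t : R) : set (borel_mx R n 1) :=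
  [set x : 'cV[C]_n | normc ((V *m x) i ord0) < t * normc ((V *m x) j ord0)].

Lemma measurable_coord V i :
  cmeasurable (fun x : borel_mx R n 1 => (V *m (x : 'cV[C]_n)) i ord0).
Proof.
under eq_fun do rewrite mxE.
apply: cmeasurable_sum => k; apply: cmeasurableM; first exact: cmeasurable_cst.
exact: cmeasurable_entry.
Qed.

Lemma measurable_coord_small_set V i j t : measurable (coord_small_set V i j t).
Proof.
apply: measurable_lt_set.
  exact: measurable_normc (measurable_coord V i).
by apply: measurable_funM => //; exact: measurable_normc (measurable_coord V j).
Qed.

Lemma coord_small_set_unitary V i j t : V \is unitarymx ->
  nu (coord_small_set V i j t) = nu (coord_small_set 1%:M i j t).
Proof.
move=> Vu; have [_ inv] := nu_unif.
rewrite -(inv V (coord_small_set 1%:M i j t)) //; last 2 first.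
- exact: measurable_coord_small_set.
- move=> c x c0; rewrite /coord_small_set /= !mul1mx !mxE !normcM mulrCA ltr_pM2l //.
  by rewrite lt_def normc_ge0 andbT; apply: contra c0 => /eqP /eq0_normc ->.
by congr (nu _); apply/funext => x; rewrite /coord_small_set /= !mul1mx.
Qed.

(** Rotating the plane of the two coordinates by slopes [6 * t * k], [k < K],
    moves the event to pairwise disjoint events of the same probability, and
    about [1 / (6 * t)] copies of it fit into total mass 1. *)
Lemma coord_small_le V (i j : 'I_n) (t : R) : V \is unitarymx -> i != j -> 0 <= t ->
  (nu (coord_small_set V i j t) <= (6 * t)%:E)%E.
Proof.
move=> Vu ij t0; rewrite coord_small_set_unitary //.
have [t6|t6] := leP 1 (6 * t).
  by apply: (@le_trans _ _ 1%E); [exact: probability_le1 (measurable_coord_small_set _ _ _ _)|rewrite lee_fin].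
move: t0; rewrite le_eqVlt => /orP[/eqP <-|t0].
  rewrite mulr0 (_ : coord_small_set _ _ _ _ = set0) ?measure0 //.
  by apply/seteqP; split=> // x; rewrite /coord_small_set /= mul0r ltNge normc_ge0.
pose K := (Num.truncn (6 * t)^-1).+1.
have t6i : 0 <= (6 * t)^-1 by rewrite invr_ge0 mulr_ge0 // ltW.
have Kgt : (6 * t)^-1 < K%:R by exact: truncnS_gt.
have sle (k : 'I_K) : 6 * t * k%:R <= 1.
  rewrite -ler_pdivlMl ?mulr1 ?mulr_gt0 //.
  apply: le_trans (_ : (Num.truncn (6 * t)^-1)%:R <= _); last by rewrite truncn_le.
  by rewrite ler_nat -ltnS.
have ex (k : 'I_K) := unitary_plane_rotation (6 * t * k%:R) ij.
pose U (k : 'I_K) := s2val (cid2 (ex k)).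
have Uu k : U k \is unitarymx by exact: (s2valP (cid2 (ex k))).
have hU (k : 'I_K) (x : 'cV[C]_n) : coord_small_set (U k) i j t x ->
    normc (x i ord0 + (6 * t * k%:R)%:C * x j ord0) < t * normc (x j ord0 - (6 * t * k%:R)%:C * x i ord0).
  have [c c0 /(_ x)[h1 h2]] := s2valP' (cid2 (ex k)).
  rewrite /coord_small_set /= h1 h2 !normcM normc_real gtr0_norm // mulrCA ltr_pM2l //.
have : (\sum_(k < K) nu (coord_small_set (U k) i j t) <= nu setT)%E.
  apply: sum_measure_disjoint_le => //.
  - by move=> k; exact: measurable_coord_small_set.
  - move=> k l x /hU hk /hU hl; apply/ord_inj/eqP/contraT => kl.
    have kl1 := natr_dist_ge1 R kl.
    pose p : R := normc (x i ord0); pose q : R := normc (x j ord0).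
    have p0 : 0 <= p by exact: normc_ge0.
    have q0 : 0 <= q by exact: normc_ge0.
    (* If [x] lies in two of the events, their two linear forms in [x i] and
       [x j] are both small, hence so is their difference, a multiple of [x j];
       then both coordinates are too small compared with each other. *)
    have ub (m : 'I_K) : normc (x j ord0 - (6 * t * m%:R)%:C * x i ord0) <= q + p.
      rewrite (le_trans (normcD _ _)) // lerD2l normcN normcM normc_real ger0_norm ?mulr_ge0 ?(ltW t0) //.
      by rewrite ler_piMl.
    have lb (m : 'I_K) : p - q <= normc (x i ord0 + (6 * t * m%:R)%:C * x j ord0).
      apply: le_trans (normcB_ge _ _); rewrite lerD2l lerN2 normcM normc_real ger0_norm ?mulr_ge0 ?(ltW t0) //.
      by rewrite ler_piMl.
    have d1 : p - q < t * (q + p).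
      by apply: le_lt_trans (lb k) (lt_le_trans hk _); rewrite ler_wpM2l ?(ltW t0).
    have d2 : 6 * t * q <= normc (x i ord0 + (6 * t * k%:R)%:C * x j ord0) + normc (x i ord0 + (6 * t * l%:R)%:C * x j ord0).
      rewrite -(normcN (_ + (6 * t * l%:R)%:C * _)); apply: le_trans (normcD _ _).
      rewrite opprD addrACA subrr add0r -mulrBl -rmorphB -mulrBr normcM normc_real normrM.
      rewrite ler_wpM2r //.
      by rewrite gtr0_norm ?mulr_gt0 // ler_peMr // mulr_ge0 // ltW.
    have d3 := ub k; have d4 := ub l.
    have e1 : t * normc (x j ord0 - (6 * t * k%:R)%:C * x i ord0) <= t * (q + p) by rewrite ler_wpM2l ?(ltW t0).
    have e2 : t * normc (x j ord0 - (6 * t * l%:R)%:C * x i ord0) <= t * (q + p) by rewrite ler_wpM2l ?(ltW t0).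
    have d5 : 6 * t * q < 2 * (t * (q + p)).
      apply: le_lt_trans d2 _; rewrite [ltRHS](_ : _ = t * (q + p) + t * (q + p)); last by ring.
      by apply: ltrD; [exact: lt_le_trans hk e1|exact: lt_le_trans hl e2].
    clear d2 e1 e2 d3 d4 ub lb hk hl.
    have d6 : 3 * q < q + p by rewrite -(ltr_pM2l t0); lra.
    have d7 : t * (q + p) <= (q + p) / 6 by rewrite mulrC ler_wpM2l ?addr_ge0 //; lra.
    lra.
under eq_bigr do rewrite (coord_small_set_unitary _ _ _ (Uu _)).
rewrite probability_setT.
have fin : nu (coord_small_set 1%:M i j t) \is a fin_num by exact: fin_num_measure (measurable_coord_small_set _ _ _ _).
rewrite -(fineK fin) sumEFin lee_fin sumr_const card_ord => h.
rewrite -mulr_natr in h.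
rewrite lee_fin (_ : 6 * t = ((6 * t)^-1)^-1); last by rewrite invrK.
have K0 : (0 : R) < K%:R by rewrite ltr0n.
apply: (@le_trans _ _ (K%:R^-1)); first rewrite -(ler_pM2r K0) mulVf ?gt_eqF //.
rewrite lef_pV2 ?posrE //; first exact: ltW.
by rewrite invr_gt0 mulr_gt0.
Qed.

End UniformDirections.

(** * Expected number of iterations in terms of gaps *)

Section TrigFacts.
Context {R : realType} (alpha : R).
Hypotheses (alpha_gt0 : 0 < alpha) (alpha_lt : alpha < pi / 4).

Lemma alpha_lt_pihalf : alpha < pi / 2.
Proof. by apply: lt_trans alpha_lt _; rewrite ltr_pM2l ?pi_gt0 // ltf_pV2 ?posrE // ltr_nat. Qed.

Lemma sin_alpha_gt0 : 0 < sin alpha.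
Proof. by apply: sin_gt0_pi; rewrite alpha_gt0 (lt_trans alpha_lt_pihalf) // ltr_pdivrMr // ltr_pMr ?pi_gt0 // ltr1n. Qed.

Lemma cos_alpha_gt0 : 0 < cos alpha.
Proof. by apply: cos_gt0_pihalf; rewrite alpha_lt_pihalf (lt_trans _ alpha_gt0) // oppr_lt0 divr_gt0 // pi_gt0. Qed.

Lemma cot_gt1 : 1 < cot alpha.
Proof.
rewrite /cot ltr_pdivlMr ?sin_alpha_gt0 // mul1r.
have : 0 < cos (alpha + alpha).
  apply: cos_gt0_pihalf; apply/andP; split.
    by rewrite (@lt_trans _ _ 0) // ?addr_gt0 // oppr_lt0 divr_gt0 // pi_gt0.
  by have := alpha_lt; lra.
by rewrite cosD -!expr2 subr_gt0 ltr_pXn2r // nnegrE ltW // ?sin_alpha_gt0 ?cos_alpha_gt0.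
Qed.

End TrigFacts.

Section RhoBound.
Context {R : realType} {n : nat}.
Local Notation C := R[i].
Import Normc.
Local Open Scope sesquilinear_scope.
Variable nu : probability (borel_mx R n 1) R.
Hypothesis nu_unif : uniform_projective nu.
Variables (V : 'M[C]_n) (i0 : 'I_n).
Hypothesis Vu : V \is unitarymx.

Definition coords_small_set (Q : pred 'I_n) (t : R) : set (borel_mx R n 1) :=
  \big[setU/set0]_(i | Q i) coord_small_set V i0 i t.

Lemma coords_small_setP (Q : pred 'I_n) (t : R) x :
  coords_small_set Q t x <-> exists2 i, Q i & coord_small_set V i0 i t x.
Proof.
split.
  rewrite /coords_small_set; elim/big_ind : _ => [[]|A B hA hB [/hA|/hB]|i Qi h] //.
  by exists i.
by move=> [i Qi h]; rewrite /coords_small_set (bigD1 i) //=; left.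
Qed.

Lemma coords_small_le (Q : pred 'I_n) (t : R) (N : nat) : (#|Q| <= N)%N ->
  (forall i, Q i -> i != i0) -> 0 <= t ->
  measurable (coords_small_set Q t) /\ (nu (coords_small_set Q t) <= (N%:R * (6 * t))%:E)%E.
Proof.
move=> QN Qi0 t0.
have : measurable (coords_small_set Q t) /\ (nu (coords_small_set Q t) <= \sum_(i | Q i) (6 * t)%:E)%E.
  rewrite /coords_small_set; apply: (big_ind2 (fun A y => measurable A /\ (nu A <= y)%E)).
  - by rewrite measure0; split.
  - move=> A a B b [mA Aa] [mB Bb]; split; first exact: measurableU.
    by apply: le_trans (measureU2 _ _ _) _ => //; exact: leeD.
  - move=> i Qi; split; first exact: measurable_coord_small_set.
    by apply: coord_small_le => //; rewrite eq_sym Qi0.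
move=> [mS h]; split => //; apply: le_trans h _.
rewrite sumEFin lee_fin sumr_const -[leLHS]mulr_natl ler_wpM2r ?mulr_ge0 //.
by rewrite ler_nat.
Qed.

Definition coord_zero_set : set (borel_mx R n 1) :=
  [set x : 'cV[C]_n | (V *m x) i0 ord0 = 0].

Lemma coord_zero_setE : coord_zero_set = [set x : borel_mx R n 1 | normc ((V *m (x : 'cV[C]_n)) i0 ord0) <= 0].
Proof.
apply/seteqP; split => x; rewrite /coord_zero_set /= => h; first by rewrite h normc0.
by apply: eq0_normc; apply/eqP; rewrite eq_le h normc_ge0.
Qed.

Lemma measurable_coord_zero_set : measurable coord_zero_set.
Proof.
rewrite coord_zero_setE; apply: measurable_le_set => //.
exact: measurable_normc (measurable_coord V i0).
Qed.

(** A nonzero vector with a vanishing coordinate [i0] lies in the events of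
    [coord_small_set] for every [t > 0], and their probability tends to 0 with
    [t]. *)
Lemma coord_zero_set_null : nu coord_zero_set = 0%E.
Proof.
have [nu0 _] := nu_unif.
have m0 : measurable ([set (0 : 'cV[C]_n)] : set (borel_mx R n 1)).
  rewrite (_ : [set _] = \big[setI/setT]_(i : 'I_n) [set x : borel_mx R n 1 | normc ((1%:M *m (x : 'cV[C]_n)) i ord0) <= 0]).
    apply: bigsetI_measurable => i _; apply: measurable_le_set => //.
    exact: measurable_normc (measurable_coord 1%:M i).
  apply/seteqP; split=> [x -> |x].
    by elim/big_ind : _ => // i _ /=; rewrite mulmx0 mxE normc0.
  move=> h; apply/colP => i; have := h.
  rewrite (bigD1 i) //= => -[]; rewrite /= mul1mx => hi _; rewrite mxE.
  by apply: eq0_normc; apply/eqP; rewrite eq_le hi normc_ge0.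
apply/eqP; rewrite eq_le measure_ge0 andbT; apply/lee_addgt0Pr => e e0; rewrite add0e.
pose Q := [pred i | i != i0].
have n0 : 0 < n%:R :> R by rewrite ltr0n (leq_ltn_trans (leq0n i0) (ltn_ord i0)).
have t0 : 0 <= e / (6 * n%:R) by rewrite divr_ge0 ?mulr_ge0 ?ltW.
have QN : (#|Q| <= n)%N by rewrite -[leqRHS]card_ord max_card.
have [mS hS] := coords_small_le QN (fun i h => h) t0.
apply: (@le_trans _ _ (nu ([set (0 : 'cV[C]_n)] `|` coords_small_set Q (e / (6 * n%:R))))).
  apply: le_measure; rewrite ?inE //; first exact: measurable_coord_zero_set.
    exact: measurableU.
  move=> x; rewrite /coord_zero_set /= => y0.
  have [->|x0] := eqVneq (x : 'cV[C]_n) 0; first by left.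
  right; apply/coords_small_setP.
  have [i yi] : exists i, (V *m (x : 'cV[C]_n)) i ord0 != 0.
    apply/existsP; apply: contraR x0; rewrite negb_exists => /forallP h.
    rewrite -sqn_eq0 -(unitary_sqn _ Vu) sqn_eq0; apply/eqP/colP => i.
    by rewrite [RHS]mxE; apply/eqP; rewrite -[_ == _]negbK.
  exists i; first by apply: contra yi => /eqP ->; rewrite y0.
  rewrite /coord_small_set /= y0 normc0 mulr_gt0 // ?divr_gt0 ?mulr_gt0 //.
  by rewrite lt_def normc_ge0 andbT; apply: contra yi => /eqP /eq0_normc ->.
apply: le_trans (measureU2 _ _ _) _ => //.
rewrite [X in (X + _)%E](_ : _ = 0%E) // add0e; apply: le_trans hS _.
rewrite lee_fin le_eqVlt; apply/orP; left; apply/eqP.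
by field; rewrite gt_eqF.
Qed.

Variables (A : 'M[C]_n) (d : 'I_n -> R) (i2 : 'I_n) (u1 : 'M[C]_n -> 'cV[C]_n).
Variables (alpha gam2 gam3 : R).
Hypotheses (VdA : diagonalizes V d A) (Adom : dominant_eigenvector A (u1 A)).
Hypotheses (alpha_gt0 : 0 < alpha) (alpha_lt : alpha < pi / 4).
Hypotheses (gam2_gt0 : 0 < gam2) (gam2_le1 : gam2 <= 1).
Hypotheses (gam3_gt0 : 0 < gam3) (gam3_le1 : gam3 <= 1).
Hypothesis d_gt0 : 0 < `|d i0|.
Hypothesis d_i2 : i2 != i0 -> `|d i2| <= (1 - gam2) * `|d i0|.
Hypothesis d_i3 : forall i, i != i0 -> i != i2 -> `|d i| <= (1 - gam3) * `|d i0|.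

(** The tangent of the angle to the dominant eigenvector adds the squares of
    the coordinate [i2] and of all the others. Half of the square of
    [tan alpha] is allotted to [i2], the other half is shared by the at most
    [n] remaining coordinates; [a] and [c3] are the resulting thresholds. *)
Let a : R := Num.sqrt 2 * cot alpha.
Let c3 : R := a * Num.sqrt n%:R.
Let Q2 := [pred i : 'I_n | (i != i0) && (i == i2)].
Let Q3 := [pred i : 'I_n | (i != i0) && (i != i2)].

Let a_ge1 : 1 <= a.
Proof.
apply: mulr_ege1; last by rewrite ltW // cot_gt1.
by rewrite -[leLHS]sqrtr1 ler_wsqrtr // ler1n.
Qed.

Let n_ge1 : 1 <= n%:R :> R.
Proof. by rewrite ler1n (leq_ltn_trans (leq0n i0) (ltn_ord i0)). Qed.

Let c3_ge1 : 1 <= c3.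
Proof. by apply: mulr_ege1 => //; rewrite -[leLHS]sqrtr1 ler_wsqrtr. Qed.

Let gap : forall i, i != i0 -> `|d i| < `|d i0|.
Proof.
move=> i ii0; have [ii2|ii2] := eqVneq i i2.
  rewrite ii2 in ii0 *; apply: le_lt_trans (d_i2 ii0) _.
  by rewrite gtr_pMl // gtrBl.
by apply: le_lt_trans (d_i3 ii0 ii2) _; rewrite gtr_pMl // gtrBl.
Qed.

(** If all coordinates were below their thresholds, the squared tangent of the
    angle to the dominant eigenvector would be at most [tan alpha ^ 2]. *)
Lemma not_yet_close_sub x k :
  ~ (fubini_study (power_iterate A x k) (u1 A) <= alpha) ->
  coord_zero_set x \/ coords_small_set Q2 (a * (1 - gam2) ^+ k) x \/
  coords_small_set Q3 (c3 * (1 - gam3) ^+ k) x.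
Proof.
move=> h; apply: contrapT => hn; apply: h.
have y0 : (V *m x) i0 ord0 != 0 by apply/eqP => y0; apply: hn; left.
pose M : R := `|d i0| ^+ k * normc ((V *m x) i0 ord0).
pose t i : R := `|d i| ^+ k * normc ((V *m x) i ord0).
have M0 : 0 <= M by rewrite mulr_ge0 ?exprn_ge0 ?normc_ge0.
have t0 i : 0 <= t i by rewrite mulr_ge0 ?exprn_ge0 ?normc_ge0.
have key i (g c : R) : 0 <= c -> `|d i| <= (1 - g) * `|d i0| -> g <= 1 ->
    ~ coord_small_set V i0 i (c * (1 - g) ^+ k) x -> (c * t i) ^+ 2 <= M ^+ 2.
  move=> c0 hd g1 /negP; rewrite /coord_small_set /= -leNgt => hs.
  apply: lerXn2r; rewrite ?nnegrE; [exact: mulr_ge0|exact: M0|].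
  apply: (@le_trans _ _ (`|d i0| ^+ k * (c * (1 - g) ^+ k * normc ((V *m x) i ord0)))).
    rewrite /t (_ : `|d i0| ^+ k * _ = c * (((1 - g) * `|d i0|) ^+ k * normc ((V *m x) i ord0))); last first.
      by rewrite exprMn; ring.
    rewrite ler_wpM2l // ler_wpM2r ?normc_ge0 //.
    by apply: lerXn2r => //; rewrite nnegrE // mulr_ge0 // subr_ge0.
  by rewrite ler_wpM2l ?exprn_ge0.
have a0 : 0 < a by exact: lt_le_trans a_ge1.
have sq2 : Num.sqrt (2 : R) ^+ 2 = 2 by rewrite sqr_sqrtr.
have sqn : Num.sqrt (n%:R : R) ^+ 2 = n%:R by rewrite sqr_sqrtr // ler0n.
have ti i : i != i0 -> a ^+ 2 * t i ^+ 2 <= (if i == i2 then M ^+ 2 else M ^+ 2 / n%:R).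
  move=> ii0; case: eqVneq => [ii2|ii2].
    rewrite -exprMn; apply: (key i gam2 a) => //; first exact: ltW.
      by rewrite ii2; apply: d_i2; rewrite -ii2.
    by move=> hs; apply: hn; right; left; apply/coords_small_setP; exists i => //=; rewrite ii0 ii2 eqxx.
  rewrite ler_pdivlMr; last exact: lt_le_trans n_ge1.
  rewrite (_ : a ^+ 2 * _ * _ = (c3 * t i) ^+ 2); last by rewrite /c3 !exprMn sqn; ring.
  apply: (key i gam3 c3) => //; [exact: le_trans c3_ge1|exact: d_i3|].
  by move=> hs; apply: hn; right; right; apply/coords_small_setP; exists i => //=; rewrite ii0 ii2.
have sum_le : a ^+ 2 * \sum_(i | i != i0) t i ^+ 2 <= 2 * M ^+ 2.
  rewrite mulr_sumr; apply: le_trans (ler_sum _ ti) _.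
  apply: (@le_trans _ _ (\sum_i ((if i == i2 then M ^+ 2 else 0) + M ^+ 2 / n%:R))).
    rewrite [leRHS](bigID (fun i => i != i0)) /= -[leLHS]addr0 lerD //.
      apply: ler_sum => i _; case: ifP => _; rewrite ?add0r //.
      by rewrite lerDl divr_ge0 ?sqr_ge0 ?ler0n.
    by apply: sumr_ge0 => i _; rewrite addr_ge0 ?divr_ge0 ?sqr_ge0 ?ler0n //; case: ifP; rewrite ?sqr_ge0.
  rewrite big_split /= -big_mkcond /= big_pred1_eq sumr_const card_ord -[X in _ + X]mulr_natr.
  by rewrite mulfVK ?gt_eqF ?(lt_le_trans _ n_ge1) // mulr2n mulrDl mul1r.
apply: (power_iterate_le VdA gap Adom (ltW alpha_gt0) (alpha_lt_pihalf alpha_lt)) => //.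
  by rewrite -normr_gt0.
rewrite -/(t _) -/M.
have s0 : 0 < sin alpha by exact: sin_alpha_gt0.
have asin : a ^+ 2 * sin alpha ^+ 2 = 2 * cos alpha ^+ 2.
  by rewrite /a exprMn sq2 /cot -mulrA -exprMn divfK ?gt_eqF.
rewrite -(ler_pM2l (_ : 0 < 2 :> R)) // mulrA -asin.
rewrite [leLHS](_ : _ = sin alpha ^+ 2 * (a ^+ 2 * \sum_(i | i != i0) t i ^+ 2)); last by ring.
rewrite [leRHS](_ : _ = sin alpha ^+ 2 * (2 * M ^+ 2)); last by rewrite /M /t; ring.
by rewrite ler_pM2l // exprn_gt0.
Qed.

(** The probability of not being close after [k] steps is at most [6 * a * (1 -
    gam2) ^+ k + n * (6 * c3) * (1 - gam3) ^+ k], each summand truncated at 1;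
    summing over [k] bounds the expected hitting time. Only the gap [gam3]
    comes with a logarithm of [n]. *)
Lemma rho_le_gaps :
  (rho nu u1 alpha A <= ((2 + ln (6 * a)) / gam2 + (2 + ln (n%:R * (6 * c3))) / gam3)%:E)%E.
Proof.
pose S2 k := coords_small_set Q2 (a * (1 - gam2) ^+ k).
pose S3 k := coords_small_set Q3 (c3 * (1 - gam3) ^+ k).
have p2 k : 0 <= (1 - gam2) ^+ k by rewrite exprn_ge0 // subr_ge0.
have p3 k : 0 <= (1 - gam3) ^+ k by rewrite exprn_ge0 // subr_ge0.
have a0 : 0 <= a by exact: le_trans a_ge1.
have c0 : 0 <= c3 by exact: le_trans c3_ge1.
have card2 : (#|Q2| <= 1)%N.
  by rewrite -(card1 i2); apply: subset_leq_card; apply/fintype.subsetP => i /andP[].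
have card3 : (#|Q3| <= n)%N by rewrite -[leqRHS]card_ord max_card.
have q2 i : Q2 i -> i != i0 by case/andP.
have q3 i : Q3 i -> i != i0 by case/andP.
have h2 k := coords_small_le card2 q2 (mulr_ge0 a0 (p2 k)).
have h3 k := coords_small_le card3 q3 (mulr_ge0 c0 (p3 k)).
have mS2 k : measurable (S2 k) := (h2 k).1.
have mS3 k : measurable (S3 k) := (h3 k).1.
have mZ := measurable_coord_zero_set.
pose b k (x : borel_mx R n 1) : R := \1_coord_zero_set x + (\1_(S2 k) x + \1_(S3 k) x).
have b0 k x : 0 <= b k x by rewrite /b !addr_ge0 // !indicE.
apply: (@le_trans _ _ (\int[nu]_x \sum_(0 <= k <oo) (b k x)%:E)%E).
  apply: ge0_le_lower_integral => x _.
    by apply: le_ereal_inf_tmp => _ [k _ <-]; rewrite lee_fin ler0n.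
  apply: ereal_inf_hitting_le => // k /not_yet_close_sub; rewrite /b !indicE.
  case=> [h|[h|h]].
  - by rewrite mem_set //= lerDl addr_ge0.
  - by rewrite [x \in S2 k]mem_set //= addrCA lerDl addr_ge0.
  - by rewrite [x \in S3 k]mem_set //= addrA lerDr addr_ge0.
have mb k : measurable_fun setT (b k).
  by apply: measurable_funD => //; apply: measurable_funD => //; exact: measurable_indic.
rewrite integral_nneseries //; last 2 first.
- by move=> k; apply/measurable_EFinP; exact: mb.
- by move=> k x _; rewrite lee_fin.
pose m2 k : R := Num.min 1 ((6 * a) * (1 - gam2) ^+ k).
pose m3 k : R := Num.min 1 ((n%:R * (6 * c3)) * (1 - gam3) ^+ k).
have m20 k : 0 <= m2 k by rewrite /m2 le_min ler01 /=; apply: mulr_ge0 => //; apply: mulr_ge0.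
have m30 k : 0 <= m3 k by rewrite /m3 le_min ler01 /=; apply: mulr_ge0 => //; do 2 apply: mulr_ge0 => //.
apply: (@le_trans _ _ (\sum_(0 <= k <oo) ((m2 k)%:E + (m3 k)%:E))%E).
  apply: lee_nneseries => k _; first by move=> _; apply: integral_ge0 => x _; rewrite lee_fin.
  rewrite (_ : (\int[nu]_x (b k x)%:E)%E = (nu coord_zero_set + (nu (S2 k) + nu (S3 k)))%E); last first.
    under eq_integral do rewrite /b !EFinD.
    have mi B : measurable B -> measurable_fun [set: borel_mx R n 1] (fun x => (\1_B x : R)%:E).
      by move=> mB; apply/measurable_EFinP; exact: measurable_indic.
    have pi B x : (0 <= (\1_B x : R)%:E)%E by rewrite lee_fin indicE.
    rewrite (ge0_integralD nu measurableT (fun x _ => pi _ _ x) (mi _ mZ)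
      (fun x _ => adde_ge0 (pi _ _ x) (pi _ _ x)) (emeasurable_funD (mi _ (mS2 k)) (mi _ (mS3 k)))).
    rewrite (ge0_integralD nu measurableT (fun x _ => pi _ _ x) (mi _ (mS2 k)) (fun x _ => pi _ _ x) (mi _ (mS3 k))).
    by rewrite !integral_indic // !setIT.
  rewrite coord_zero_set_null add0e; apply: leeD; rewrite /m2 /m3.
    rewrite EFin_min le_min; apply/andP; split; first exact: probability_le1.
    by apply: le_trans (h2 k).2 _; rewrite lee_fin mul1r mulrA.
  rewrite EFin_min le_min; apply/andP; split; first exact: probability_le1.
  by apply: le_trans (h3 k).2 _; rewrite lee_fin !mulrA.
rewrite nneseriesD //; last 2 first.
- by move=> k _ _; rewrite lee_fin.
- by move=> k _ _; rewrite lee_fin.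
rewrite EFinD; apply: leeD; apply: nneseries_truncated_geometric_le => //.
- by apply: mulr_ege1 => //; rewrite ler1n.
- by apply: mulr_ege1 => //; apply: mulr_ege1 => //; rewrite ler1n.
Qed.

End RhoBound.

(** * Translating a Gaussian matrix *)

Lemma measurable_fun_mfun (d d' : measure_display) (T : measurableType d)
    (U : measurableType d') (f : T -> U) :
  measurable_fun [set: T] f -> exists g : {mfun T >-> U}, (g : T -> U) = f.
Proof. by move=> mf; exists (mfun_Sub (mem_set mf)). Qed.

Section GaussianShift.
Context {R : realType}.
Local Notation mu := (@lebesgue_measure R).
Local Notation gauss := (@normal_prob R 0 1).
Local Open Scope ereal_scope.

Lemma ge0_integral_lebesgue_shift (f : R -> \bar R) (s : R) :
  measurable_fun [set: R] f -> (forall x, 0 <= f x) ->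
  \int[mu]_x f (x + s)%R = \int[mu]_x f x.
Proof.
move=> mf f0.
have msh : measurable_fun [set: measurableTypeR R] (fun x : measurableTypeR R => (x + s)%R : measurableTypeR R).
  by apply: measurable_funD.
have [g gE] := measurable_fun_mfun msh.
have inv A : measurable A -> mu A = pushforward mu g A.
  apply: lebesgue_measure_unique => _ [[a b] _ <-].
  rewrite /=; change (mu `]a, b]%classic = mu (g @^-1` `]a, b]%classic)).
  rewrite gE (_ : _ @^-1` _ = `](a - s)%R, (b - s)%R]%classic); last first.
    by apply/seteqP; split => x; rewrite /= !in_itv /= ltrBlDr lerBrDr.
  by rewrite !lebesgue_measure_itv /= !lte_fin ltrD2r -!EFinD opprB addrA subrK.
rewrite [RHS](eq_measure_integral (pushforward mu g)); last by move=> A mA _; exact: inv.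
rewrite ge0_integral_pushforward //.
by rewrite preimage_setT; apply: eq_integral => x _; rewrite /= gE.
Qed.

Lemma ge0_integral_normal (f : R -> \bar R) :
  measurable_fun [set: R] f -> (forall x, 0 <= f x) ->
  \int[gauss]_x f x = \int[mu]_x (f x * (normal_pdf 0 1 x)%:E).
Proof.
move=> mf f0; have dom := @normal_prob_dominates R 0 1.
rewrite -(Radon_Nikodym_SigmaFinite.change_of_variables dom f0 measurableT mf).
have mrn : measurable_fun [set: R] (Radon_Nikodym_SigmaFinite.f gauss mu).
  exact: measurable_int (Radon_Nikodym_SigmaFinite.f_integrable dom).
have mpdf : measurable_fun [set: R] (fun x : R => (normal_pdf 0 1 x)%:E).
  by apply/measurable_EFinP; exact: measurable_normal_pdf.
apply: ge0_ae_eq_integral => //.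
- exact: emeasurable_funM.
- exact: emeasurable_funM.
- by move=> x _; rewrite mule_ge0 // Radon_Nikodym_SigmaFinite.f_ge0.
- by move=> x _; rewrite mule_ge0 // lee_fin normal_pdf_ge0.
have : ae_eq mu setT (Radon_Nikodym_SigmaFinite.f gauss mu) (fun x : R => (normal_pdf 0 1 x)%:E).
  apply: integral_ae_eq => //; first exact: Radon_Nikodym_SigmaFinite.f_integrable.
  by move=> E _ mE; rewrite -Radon_Nikodym_SigmaFinite.f_integral.
by apply: filterS => x h xT; rewrite h.
Qed.

(** Completing the square: the density of the shifted Gaussian with respect to
    the Gaussian. *)
Lemma ge0_integral_normal_shift (f : R -> \bar R) (s : R) :
  measurable_fun [set: R] f -> (forall x, 0 <= f x) ->
  \int[gauss]_x f (x + s)%R = \int[gauss]_x (f x * (expR (s * x - s ^+ 2 / 2))%:E).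
Proof.
move=> mf f0.
have mpdf : measurable_fun [set: R] (fun x : R => (normal_pdf 0 1 x)%:E).
  by apply/measurable_EFinP; exact: measurable_normal_pdf.
have mexp : measurable_fun [set: R] (fun x : R => (expR (s * x - s ^+ 2 / 2))%:E).
  apply/measurable_EFinP; apply: measurableT_comp => //.
  by apply: measurable_funB => //; exact: measurable_funM.
rewrite ge0_integral_normal //; last by apply: measurableT_comp => //; exact: measurable_funD.
rewrite ge0_integral_normal; last 2 first.
- exact: emeasurable_funM.
- by move=> x; rewrite mule_ge0 // lee_fin expR_ge0.
rewrite -[RHS](@ge0_integral_lebesgue_shift _ s); last 2 first.
- by do 2 apply: emeasurable_funM => //.
- by move=> x; rewrite !mule_ge0 // lee_fin ?expR_ge0 ?normal_pdf_ge0.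
apply: eq_integral => x _; rewrite -muleA -EFinM; congr (_ * _%:E).
rewrite normal_pdfE ?oner_neq0 // mulrCA; congr (_ * _)%R.
rewrite /normal_fun -expRD; congr expR.
by rewrite !subr0 expr1n; field.
Qed.

End GaussianShift.

Section EntryParts.
Context {R : realType} {n : nat}.
Local Notation C := R[i].
Local Notation J := ('I_n * 'I_n * bool)%type.
Implicit Types (A B : 'M[C]_n) (t : J).

Definition unit_shift t (x : R) : 'M[C]_n :=
  (if t.2 then 0 +i* x else x%:C) *: delta_mx t.1.1 t.1.2.

Lemma entry_partD t A B : entry_part t (A + B) = entry_part t A + entry_part t B.
Proof. by case: t => [[i j] []]; rewrite /entry_part /= mxE ?ReD ?ImD. Qed.

Lemma entry_partN t A : entry_part t (- A) = - entry_part t A.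
Proof. by case: t => [[i j] []]; rewrite /entry_part /= mxE ?ReN ?ImN. Qed.

Lemma entry_part_unit_shift t u x :
  entry_part t (unit_shift u x) = if t == u then x else 0.
Proof.
case: t => [[i j] b]; case: u => [[k l] c]; rewrite /entry_part /unit_shift /= !mxE.
rewrite -pair_eqE /= -pair_eqE /=.
case: (eqVneq i k) => _ /=; last by rewrite mulr0; case: b.
case: (eqVneq j l) => _ /=; last by rewrite mulr0; case: b.
by rewrite mulr1; case: b; case: c.
Qed.

Lemma entry_part_inj A B : (forall t, entry_part t A = entry_part t B) -> A = B.
Proof.
move=> h; apply/matrixP => i j.
have := h (i, j, false); have := h (i, j, true); rewrite /entry_part /=.
by case: (A i j) => a b; case: (B i j) => c e /= -> ->.
Qed.

Lemma entry_part0 t : entry_part t (0 : 'M[C]_n) = 0.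
Proof. by case: t => [[i j] []]; rewrite /entry_part /= mxE. Qed.

Lemma unit_shift0 t : unit_shift t 0 = 0.
Proof. by apply: entry_part_inj => u; rewrite entry_part_unit_shift entry_part0; case: eqP. Qed.

Lemma sum_unit_shift A : \sum_t unit_shift t (entry_part t A) = A.
Proof.
apply: entry_part_inj => t.
transitivity (\sum_u entry_part t (unit_shift u (entry_part u A))).
  elim/big_ind2 : _ => // [|x1 x2 y1 y2 <- <-]; last by rewrite entry_partD.
  exact: entry_part0.
rewrite (bigD1 t) //= entry_part_unit_shift eqxx big1 ?addr0 // => u.
by rewrite entry_part_unit_shift eq_sym => /negPf ->.
Qed.

Lemma measurable_oppmx :
  measurable_fun [set: borel_mx R n n] (fun A : borel_mx R n n => - (A : 'M[C]_n) : borel_mx R n n).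
Proof.
apply: measurable_borel_mx => t; under eq_fun do rewrite entry_partN.
by apply: measurableT_comp => //; exact: measurable_entry_part.
Qed.

Lemma measurable_addmx (S : 'M[C]_n) :
  measurable_fun [set: borel_mx R n n] (fun A : borel_mx R n n => (A : 'M[C]_n) + S : borel_mx R n n).
Proof.
apply: measurable_borel_mx => t; under eq_fun do rewrite entry_partD.
by apply: measurable_funD => //; exact: measurable_entry_part.
Qed.

(** Boxes form a generating class stable under intersection, so a finite
    measure on matrices is determined by the probabilities that the product
    rule for independent coordinates controls. *)
Definition boxes : set (set (borel_mx R n n)) :=
  [set D | exists2 B : J -> set R, (forall t, measurable (B t)) &
    D = \bigcap_(t in [set: J]) (entry_part t : borel_mx R n n -> R) @^-1` B t].

Lemma measurable_box (B : J -> set R) : (forall t, measurable (B t)) ->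
  measurable (\bigcap_(t in [set: J]) (entry_part t : borel_mx R n n -> R) @^-1` B t).
Proof.
move=> mB; apply: fin_bigcap_measurable => // t _.
by rewrite -[X in measurable X]setTI; exact: measurable_entry_part.
Qed.

Lemma boxes_generate : @measurable _ (borel_mx R n n) = <<s boxes >>.
Proof.
apply/seteqP; split; last first.
  apply: smallest_sub; first exact: sigma_algebra_measurable.
  by move=> _ [B mB ->]; exact: measurable_box.
apply: smallest_sub; first exact: smallest_sigma_algebra.
move=> _ [t [V [mV ->]]]; apply: sub_sigma_algebra.
exists (fun u => if u == t then V else setT); first by move=> u; case: ifP.
apply/seteqP; split => A /=; first by move=> h u _ /=; case: eqP => // ->.
by move=> /(_ t I); rewrite /= eqxx.
Qed.

Lemma borel_mx_measure_unique (m1 m2 : {measure set (borel_mx R n n) -> \bar R}) :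
  (m1 setT < +oo)%E -> (forall D, boxes D -> m1 D = m2 D) ->
  forall D, measurable D -> m1 D = m2 D.
Proof.
move=> m1T h A mA; apply: (measure_unique boxes (fun=> setT)) => //.
- exact: boxes_generate.
- move=> _ _ [B1 mB1 ->] [B2 mB2 ->]; exists (fun t => B1 t `&` B2 t).
    by move=> t; exact: measurableI.
  by apply/seteqP; split => X /=; [move=> [h1 h2] t _; split; [exact: h1|exact: h2]
                                  |move=> h1; split => t tT; have [] := h1 t tT].
- move=> _; exists (fun=> setT) => //; apply/seteqP; split => // X _ t _ //.
- by rewrite bigcup_const.
Qed.

End EntryParts.

Section CameronMartin.
Context {R : realType} {n : nat}.
Local Notation C := R[i].
Local Notation J := ('I_n * 'I_n * bool)%type.
Local Open Scope ereal_scope.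
Context {dd : measure_display} {T : measurableType dd}.
Variables (P : probability T R) (G : T -> 'M[C]_n).
Hypothesis hG : complex_gaussian_mx P G.

Let X t w : R := entry_part t (G w).
Let mX t : measurable_fun [set: T] (X t). Proof. by case: hG => h _; case: (h t). Qed.
Let lawX t B : measurable B -> P (X t @^-1` B) = normal_prob 0 1 B.
Proof. by case: hG => h _; case: (h t) => _; apply. Qed.
Let indX : independent_family P X. Proof. by case: hG. Qed.

Lemma measurable_gaussian_mx : measurable_fun [set: T] (G : T -> borel_mx R n n).
Proof. exact: measurable_borel_mx. Qed.

(** All coordinates of [G] but [t], kept as a matrix with a zero at that place,
    so that [G w] is the sum of [others t w] and a [unit_shift]. *)
Definition others t w : borel_mx R n n := (G w - unit_shift t (entry_part t (G w)))%R.

Lemma measurable_others t : measurable_fun [set: T] (others t).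
Proof.
apply: measurable_borel_mx => u; rewrite /others.
under eq_fun do rewrite entry_partD entry_partN entry_part_unit_shift.
apply: measurable_funB; first exact: mX.
by case: eqP => _ //; exact: mX.
Qed.

Let mpre t B : measurable B -> measurable (X t @^-1` B).
Proof. by move=> mB; rewrite -[Y in measurable Y]setTI; exact: mX. Qed.

Lemma entry_part_others t u w :
  entry_part u (others t w : 'M[C]_n) = (if u == t then 0 else X u w)%R.
Proof.
rewrite /others entry_partD entry_partN entry_part_unit_shift.
by case: eqP => [->|_]; rewrite ?subrr ?subr0.
Qed.

(** Independence is known as a product rule for all coordinates, that is on
    boxes; both sides are finite measures in [D], so it extends to all Borel
    sets of the other coordinates. *)
Lemma independent_others t B D : measurable B -> measurable D ->
  P (X t @^-1` B `&` others t @^-1` D) = P (X t @^-1` B) * P (others t @^-1` D).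
Proof.
move=> mB mD; have mXB := mpre t mB.
have [g gE] := measurable_fun_mfun (measurable_others t).
have c0 : (0 <= fine (P (X t @^-1` B)))%R by rewrite fine_ge0.
have cE : (fine (P (X t @^-1` B)))%:E = P (X t @^-1` B).
  by rewrite fineK // fin_num_measure.
suff : pushforward (mrestr P mXB) g D = mscale (NngNum c0) (distribution P g) D.
  move=> h; have : P (g @^-1` D `&` X t @^-1` B) = (fine (P (X t @^-1` B)))%:E * P (g @^-1` D) by exact: h.
  by rewrite cE gE setIC.
apply: borel_mx_measure_unique => //.
  change (P (g @^-1` setT `&` X t @^-1` B) < +oo).
  rewrite preimage_setT setTI; apply: le_lt_trans (ltry 1%R).
  exact: probability_le1.
move=> _ [V mV ->].
set W := \bigcap_(u in _) _.
change (P (g @^-1` W `&` X t @^-1` B) = (fine (P (X t @^-1` B)))%:E * P (g @^-1` W)).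
rewrite cE gE setIC {}/W.
(* The coordinate [t] of [others t w] is 0, so its preimage of the box is empty
   unless [V t] contains 0. *)
have [V0|V0] := pselect (V t 0%R); last first.
  rewrite (_ : others t @^-1` _ = set0) ?setI0 ?measure0 ?mule0 //.
  by apply/seteqP; split => // w /= /(_ t I) /=; rewrite entry_part_others eqxx.
pose V1 u := if u == t then B else V u.
pose V2 u := if u == t then setT else V u.
have mV1 u : measurable (V1 u) by rewrite /V1; case: ifP.
have mV2 u : measurable (V2 u) by rewrite /V2; case: ifP.
rewrite (_ : _ `&` _ = \bigcap_(u in [set: J]) X u @^-1` V1 u); last first.
  apply/seteqP; split => w /=.
    move=> [h1 h2] u _; rewrite /= /V1; case: eqP => [->//|/eqP /negPf ut].
    by have := h2 u I; rewrite /= entry_part_others ut.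
  move=> h; split; first by have := h t I; rewrite /= /V1 eqxx.
  move=> u _ /=; rewrite entry_part_others; case: eqP => [-> //|/eqP /negPf ut].
  by have := h u I; rewrite /= /V1 ut.
rewrite (_ : others t @^-1` _ = \bigcap_(u in [set: J]) X u @^-1` V2 u); last first.
  apply/seteqP; split => w /= h u _ /=.
    rewrite /V2; case: eqP => [->//|/eqP /negPf ut].
    by have := h u I; rewrite /= entry_part_others ut.
  rewrite entry_part_others; case: eqP => [-> //|/eqP /negPf ut].
  by have := h u I; rewrite /= /V2 ut.
rewrite !indX // (bigD1 t) //= [X in _ = _ * X](bigD1 t) //=.
have V1t : V1 t = B by rewrite /V1 eqxx.
have V2t : V2 t = setT by rewrite /V2 eqxx.
rewrite V1t V2t preimage_setT probability_setT mul1e.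
congr (_ * _); apply: eq_bigr => u /negPf ut.
by rewrite /V1 /V2 ut.
Qed.

(** The pair of the coordinate [t] and the other ones has a product law. *)
Lemma ge0_integral_coordinate (t : J) (h : measurableTypeR R * borel_mx R n n -> \bar R) :
  measurable_fun [set: measurableTypeR R * borel_mx R n n] h -> (forall p, 0 <= h p) ->
  \int[P]_w h (X t w, others t w) =
  \int[pushforward P (others t)]_y \int[normal_prob 0 1]_x h (x, y).
Proof.
move=> mh h0.
have [g gE] := measurable_fun_mfun (measurable_others t); rewrite -gE.
have mj : measurable_fun [set: T] (fun w => (X t w, g w) : measurableTypeR R * borel_mx R n n).
  by apply: measurable_fun_pair => //; exact: mX.
have [j jE] := measurable_fun_mfun mj.
transitivity (\int[normal_prob 0 1 \x distribution P g]_p h p); last by rewrite fubini_tonelli2.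
transitivity (\int[distribution P j]_p h p).
  rewrite ge0_integral_pushforward // preimage_setT.
  by apply: eq_integral => w _ /=; rewrite jE.
have eqm A : measurable A -> (normal_prob 0 1 \x distribution P g) A = distribution P j A.
  move=> mA; apply: (@product_measure_unique _ _ (measurableTypeR R) (borel_mx R n n) R (normal_prob 0 1) (distribution P g) (distribution P j)) => // B D mB mD.
  change (P (j @^-1` (B `*` D)) = normal_prob 0 1 B * P (g @^-1` D)).
  by rewrite jE gE -(lawX t mB) -independent_others.
by apply/esym; apply: (eq_measure_integral (distribution P j)) => A mA _; exact: eqm.
Qed.

(** Integrate first over the coordinate [t], where the one-dimensional formula
    applies. *)
Lemma ge0_integral_unit_shift (t : J) (s : R) (f : borel_mx R n n -> \bar R) :
  measurable_fun [set: borel_mx R n n] f -> (forall A, 0 <= f A) ->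
  \int[P]_w f (G w + unit_shift t s)%R =
  \int[P]_w (f (G w) * (expR (s * entry_part t (G w) - s ^+ 2 / 2))%:E).
Proof.
move=> mf f0.
have mjoin (c : R) : measurable_fun [set: measurableTypeR R * borel_mx R n n]
    (fun p => (p.2 : 'M[C]_n) + unit_shift t (p.1 + c) : borel_mx R n n)%R.
  apply: measurable_borel_mx => u.
  under eq_fun do rewrite entry_partD entry_part_unit_shift.
  apply: measurable_funD.
    by apply: (measurableT_comp (measurable_entry_part u)); exact: measurable_snd.
  by case: eqP => _ //; apply: measurable_funD => //; exact: measurable_fst.
have split_G c w : ((others t w : 'M[C]_n) + unit_shift t (X t w + c) = G w + unit_shift t c)%R.
  apply: entry_part_inj => u; rewrite [LHS]entry_partD [in LHS]entry_part_others [RHS]entry_partD !entry_part_unit_shift.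
  by case: eqP => [->|_]; rewrite ?add0r ?addr0.
have mexp : measurable_fun [set: measurableTypeR R * borel_mx R n n] (fun p => (expR (s * p.1 - s ^+ 2 / 2))%:E).
  apply/measurable_EFinP; apply: measurableT_comp => //; apply: measurable_funB => //.
  by apply: measurable_funM => //; exact: measurable_fst.
transitivity (\int[P]_w (fun p => f ((p.2 : 'M[C]_n) + unit_shift t (p.1 + s))%R) (X t w, others t w)).
  by apply: eq_integral => w _ /=; rewrite split_G.
rewrite (@ge0_integral_coordinate t (fun p => f ((p.2 : 'M[C]_n) + unit_shift t (p.1 + s))%R)) //; last exact: measurableT_comp mf (mjoin s).
transitivity (\int[P]_w (fun p => f ((p.2 : 'M[C]_n) + unit_shift t (p.1 + 0))%R * (expR (s * p.1 - s ^+ 2 / 2))%:E) (X t w, others t w)); last first.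
  by apply: eq_integral => w _ /=; rewrite split_G unit_shift0 addr0.
rewrite (@ge0_integral_coordinate t (fun p => f ((p.2 : 'M[C]_n) + unit_shift t (p.1 + 0))%R * (expR (s * p.1 - s ^+ 2 / 2))%:E)); last 2 first.
- by apply: emeasurable_funM => //; exact: measurableT_comp mf (mjoin 0%R).
- by move=> p; rewrite mule_ge0 // lee_fin expR_ge0.
apply: eq_integral; first exact: measurable_others.
move=> y yT /=.
under [RHS]eq_integral do rewrite addr0.
rewrite -(ge0_integral_normal_shift (f := fun x => f (y + unit_shift t x)%R)) //.
apply: measurableT_comp mf _; apply: measurable_borel_mx => u.
under eq_fun do rewrite entry_partD entry_part_unit_shift.
by apply: measurable_funD => //; case: eqP.
Qed.

(** Induction on the list of shifted coordinates: the density of the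
    coordinates in [l] is not affected by a shift of a coordinate outside
    [l]. *)
Lemma ge0_integral_partial_shift (S : 'M[C]_n) (l : seq J) : uniq l ->
  forall f : borel_mx R n n -> \bar R,
  measurable_fun [set: borel_mx R n n] f -> (forall A, 0 <= f A) ->
  \int[P]_w f (G w + \sum_(t <- l) unit_shift t (entry_part t S))%R =
  \int[P]_w (f (G w) * (\prod_(t <- l)
     expR (entry_part t S * entry_part t (G w) - entry_part t S ^+ 2 / 2))%:E).
Proof.
pose wt t (A : borel_mx R n n) : R := expR (entry_part t S * entry_part t (A : 'M[C]_n) - entry_part t S ^+ 2 / 2).
have mwt t : measurable_fun [set: borel_mx R n n] (wt t).
  apply: measurableT_comp => //; apply: measurable_funB => //.
  by apply: measurable_funM => //; exact: measurable_entry_part.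
elim: l => [_ f mf f0|t l IH /= /andP[tl ul] f mf f0].
  by apply: eq_integral => w _; rewrite !big_nil addr0 mule1.
pose s := entry_part t S.
pose f2 (A : borel_mx R n n) := f ((A : 'M[C]_n) + unit_shift t s)%R.
have mf2 : measurable_fun [set: borel_mx R n n] f2 by exact: measurableT_comp mf (measurable_addmx _).
transitivity (\int[P]_w f2 (G w + \sum_(u <- l) unit_shift u (entry_part u S))%R).
  by apply: eq_integral => w _; rewrite /f2 big_cons -addrA [in RHS](addrC (\sum_(u <- l) _))%R.
rewrite IH //; last by move=> A; exact: f0.
pose W (A : borel_mx R n n) : R := (\prod_(u <- l) wt u A)%R.
have mW : measurable_fun [set: borel_mx R n n] W.
  rewrite /W; elim: (l) => [|u r h]; first by under eq_fun do rewrite big_nil; exact: measurable_cst.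
  by under eq_fun do rewrite big_cons; exact: measurable_funM.
have W0 A : (0 <= W A)%R by apply: prodr_ge0 => u _; exact: expR_ge0.
transitivity (\int[P]_w (fun A : borel_mx R n n => f A * (W A)%:E) (G w + unit_shift t s)%R).
  apply: eq_integral => w _ /=; rewrite /f2 /W; congr (_ * (_)%:E).
  rewrite big_seq [in RHS]big_seq; apply: eq_bigr => u ul'.
  rewrite /wt entry_partD entry_part_unit_shift; case: eqP => [ut|_]; last by rewrite addr0.
  by move: tl; rewrite -ut ul'.
rewrite (@ge0_integral_unit_shift t s (fun A : borel_mx R n n => f A * (W A)%:E)); last 2 first.
- by apply: emeasurable_funM => //; exact/measurable_EFinP.
- by move=> A; rewrite mule_ge0 // lee_fin.
apply: eq_integral => w _; rewrite big_cons -muleA; congr (_ * _).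
by rewrite -EFinM mulrC.
Qed.

Definition mx_inner (S A : 'M[C]_n) : R := (\sum_(t : J) entry_part t S * entry_part t A)%R.

(** Shift one real coordinate after the other; the exponents add up to
    [<S, G> - |S| ^ 2 / 2]. *)
Theorem cameron_martin (S : 'M[C]_n) (A : set (borel_mx R n n)) : measurable A ->
  P [set w | A (G w + S)%R] =
  \int[P]_(w in [set w | A (G w)]) (expR (mx_inner S (G w) - mx_inner S S / 2))%:E.
Proof.
move=> mA; have mGA : measurable [set w | A (G w)].
  by rewrite -[Y in measurable Y]setTI; exact: measurable_gaussian_mx.
have mGS : measurable_fun [set: T] (fun w => G w + S : borel_mx R n n)%R.
  exact: measurableT_comp (measurable_addmx S) measurable_gaussian_mx.
have mGSA : measurable [set w | A (G w + S)%R].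
  by rewrite -[Y in measurable Y]setTI; exact: mGS.
have := @ge0_integral_partial_shift S (index_enum J) (index_enum_uniq _) (fun X => (\1_A X)%:E).
rewrite sum_unit_shift => h.
transitivity (\int[P]_w ((\1_A (G w + S)%R : R)%:E)).
  rewrite -[in LHS](setIT [set w | A (G w + S)%R]) -integral_indic //; apply: eq_integral => w _.
rewrite h; last 2 first.
- by apply/measurable_EFinP; exact: measurable_indic.
- by move=> B; rewrite lee_fin indicE.
rewrite [RHS]integral_mkcond; apply: eq_integral => w _.
rewrite patchE indicE (_ : (w \in _) = (G w \in A)) //.
case: (G w \in A); last by rewrite mul0e.
rewrite mul1e -expR_sum; congr (expR _)%:E.
by rewrite sumrB /mx_inner mulr_suml; congr (_ - _)%R; apply: eq_bigr => t _; rewrite expr2.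
Qed.

End CameronMartin.

(** * Quasi-invariance of the GUE *)

Section HermitianShifts.
Context {R : realType} {n : nat}.
Local Notation C := R[i].
Local Notation J := ('I_n * 'I_n * bool)%type.
Import Normc.
Local Open Scope sesquilinear_scope.
Implicit Types (S A : 'M[C]_n).

Lemma mx_innerE S A :
  mx_inner S A = \sum_i \sum_j (complex.Re (S i j) * complex.Re (A i j) + complex.Im (S i j) * complex.Im (A i j)).
Proof.
rewrite /mx_inner pair_bigA /=.
rewrite -(pair_bigA _ (fun p b => entry_part (p, b) S * entry_part (p, b) A)) /=.
by apply: eq_bigr => -[i j] _; rewrite big_bool /= addrC.
Qed.

Lemma mx_inner_frob2 S : mx_inner S S = frob2 S.
Proof.
rewrite mx_innerE; apply: eq_bigr => i _; apply: eq_bigr => j _.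
by rewrite normc_sqr !expr2.
Qed.

Lemma mx_innerNl S A : mx_inner (- S) A = - mx_inner S A.
Proof. by rewrite /mx_inner -sumrN; apply: eq_bigr => t _; rewrite entry_partN mulNr. Qed.

Lemma entry_partZ t (a : R) A : entry_part t (a%:C *: A) = a * entry_part t A.
Proof. by case: t => [[i j] []]; rewrite /entry_part /= mxE ?ReZ ?ImZ. Qed.

Lemma mx_innerZl (a : R) S A : mx_inner (a%:C *: S) A = a * mx_inner S A.
Proof. by rewrite /mx_inner mulr_sumr; apply: eq_bigr => t _; rewrite entry_partZ mulrA. Qed.

Lemma mx_innerZr (a : R) S A : mx_inner S (a%:C *: A) = a * mx_inner S A.
Proof. by rewrite /mx_inner mulr_sumr; apply: eq_bigr => t _; rewrite entry_partZ mulrCA. Qed.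

Lemma frob2N S : frob2 (- S) = frob2 S.
Proof. by rewrite -!mx_inner_frob2 /mx_inner; apply: eq_bigr => t _; rewrite entry_partN mulrNN. Qed.

Lemma half_complex : (2^-1 : C) = (2^-1 : R)%:C.
Proof. by rewrite fmorphV rmorph_nat. Qed.

Lemma hermitian_partE A i j : hermitian_part A i j = (2^-1 : R)%:C * (A i j + (A j i)^*)%R.
Proof.
by rewrite !mxE half_complex.
Qed.

Lemma hermitian_part_sym A : hermitian_part A \is hermsymmx.
Proof.
apply/hermsymmxP/matrixP => i j; rewrite !mxE rmorphM rmorphD /= conjCK addrC.
by rewrite half_complex conj_real.
Qed.

Lemma hermitian_part_id S : S \is hermsymmx -> hermitian_part S = S.
Proof.
move=> /hermsymmxP Sh; apply/matrixP => i j; rewrite hermitian_partE.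
have -> : ((S j i)^*)%R = S i j by rewrite -[in RHS]Sh !mxE.
by rewrite -half_complex -mulr2n -[in X in _ * X]mulr_natl mulKf // pnatr_eq0.
Qed.

Lemma hermitian_partD A S : hermitian_part (A + S) = hermitian_part A + hermitian_part S.
Proof.
rewrite /hermitian_part -scalerDr; congr (_ *: _).
by apply/matrixP => i j; rewrite !mxE rmorphD addrACA.
Qed.

Lemma qform_hermitian_part A x : qform (hermitian_part A) x = qform A x.
Proof.
rewrite /qform /hermitian_part half_complex -scalemxAl mulmxDl herm_dotZl herm_dotDl ReZ ReD.
rewrite (herm_dot_mulmx (A ^t*)) (_ : (A ^t*) ^t* = A); last first.
  by apply/matrixP => i j; rewrite !mxE conjCK.
by rewrite (herm_dotC (A *m x)) cRe_conj; field.
Qed.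

Lemma hermitian_part_measurable :
  measurable_fun [set: borel_mx R n n] (fun A : borel_mx R n n => hermitian_part (A : 'M[C]_n) : borel_mx R n n).
Proof.
apply: cmeasurable_borel_mx => i j.
under eq_fun do rewrite hermitian_partE.
apply: cmeasurableM; first exact: cmeasurable_cst.
apply: cmeasurableD; first exact: cmeasurable_entry.
by apply: cmeasurable_conj; exact: cmeasurable_entry.
Qed.

Lemma hermsymmxN S : S \is hermsymmx -> - S \is hermsymmx.
Proof.
by move=> /hermsymmxP Sh; apply/hermsymmxP; rewrite -{2}Sh; apply/matrixP => i j; rewrite !mxE rmorphN.
Qed.

(** The rank-one matrix whose Frobenius product with [A] is the quadratic form
    of [A] at [z]. *)
Definition outer (z : 'cV[C]_n) : 'M[C]_n := \matrix_(i, j) (z i ord0 * (z j ord0)^*)%R.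

Lemma mx_inner_outer z A : mx_inner (outer z) A = qform A z.
Proof.
rewrite mx_innerE /qform Re_sum; apply: eq_bigr => i _.
rewrite mxE mulr_suml Re_sum; apply: eq_bigr => j _; rewrite mxE.
by case: (A i j) => a b; case: (z i ord0) => c e; case: (z j ord0) => f g /=; ring.
Qed.

Lemma frob2_outer z : frob2 (outer z) = sqn z ^+ 2.
Proof.
rewrite -mx_inner_frob2 mx_inner_outer /qform.
rewrite (_ : outer z *m z = (sqn z)%:C *: z); first by rewrite herm_dotZl herm_dotxx ReZ expr2.
apply/colP => i; rewrite !mxE -herm_dotxx /herm_dot mulr_suml; apply: eq_bigr => j _.
by rewrite !mxE [RHS]mulrC -mulrA; congr (_ * _); rewrite mulrC.
Qed.

Context {dd : measure_display} {T : measurableType dd}.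
Variable P : probability T R.
Local Open Scope ereal_scope.

(** Averaging over the translates by [S] and [- S] removes the linear term
    [<S, G>] of the exponent of the density, which has no sign; what remains is
    the factor [exp (- |S| ^ 2 / 2)]. *)
Definition quasi_invariant (H : T -> 'M[C]_n) :=
  measurable_fun [set: T] (H : T -> borel_mx R n n) /\
  forall S (A : set (borel_mx R n n)), S \is hermsymmx -> measurable A ->
    (2 * expR (- (frob2 S / 2)))%:E * P [set w | A (H w)] <=
    P [set w | A (H w + S)%R] + P [set w | A (H w - S)%R].

Lemma measurable_preimage_mx (H : T -> 'M[C]_n) (A : set (borel_mx R n n)) :
  measurable_fun [set: T] (H : T -> borel_mx R n n) -> measurable A -> measurable [set w | A (H w)].
Proof. by move=> mH mA; rewrite -[X in measurable X]setTI; exact: mH. Qed.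

Lemma quasi_invariantN (H : T -> 'M[C]_n) :
  quasi_invariant H -> quasi_invariant (fun w => - H w)%R.
Proof.
move=> [mH qi].
split; first exact: measurableT_comp measurable_oppmx mH.
move=> S A Sh mA; pose A' : set (borel_mx R n n) := [set X : 'M[C]_n | A (- X)%R].
have mA' : measurable A' by rewrite -[X in measurable X]setTI; exact: measurable_oppmx.
have := qi S A' Sh mA'; rewrite /A' /= addeC.
rewrite (_ : [set w | A (- (H w - S))%R] = [set w | A (- H w + S)%R]); last first.
  by apply/seteqP; split => w /=; rewrite opprB addrC.
by rewrite (_ : [set w | A (- (H w + S))%R] = [set w | A (- H w - S)%R]) //; apply/seteqP; split => w /=; rewrite opprD.
Qed.

(** A shift of the Hermitian part by a Hermitian [S] is the Hermitian part of a
    shift by [S]. The densities of the two translates add up to [(exp a + exp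
    (- a)) * exp (- |S| ^ 2 / 2)], and [exp a + exp (- a)] is at least 2. *)
Lemma GUE_quasi_invariant (H : T -> 'M[C]_n) : GUE P H -> quasi_invariant H.
Proof.
move=> [G hG HG]; have mG := measurable_gaussian_mx hG.
have HE : H = fun w => hermitian_part (G w) by apply/funext.
split; first by rewrite HE; exact: measurableT_comp hermitian_part_measurable mG.
move=> S A Sh mA.
pose A' : set (borel_mx R n n) := [set X : 'M[C]_n | A (hermitian_part X)].
have mA' : measurable A'.
  by rewrite -[X in measurable X]setTI; exact: hermitian_part_measurable.
have sE S' : S' \is hermsymmx -> [set w | A (H w + S')%R] = [set w | A' (G w + S')%R].
  by move=> S'h; apply/funext => w; rewrite /A' /= hermitian_partD (hermitian_part_id S'h) HE.
rewrite sE // sE ?hermsymmxN // !(cameron_martin hG) //.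
have mGA : measurable [set w | A' (G w)] := measurable_preimage_mx mG mA'.
have mexp S' : measurable_fun [set w | A' (G w)] (fun w => (expR (mx_inner S' (G w) - mx_inner S' S' / 2))%:E).
  apply/measurable_EFinP; apply: measurableT_comp => //; apply: measurable_funB => //.
  apply: measurable_funTS; rewrite /mx_inner; elim: (index_enum _) => [|t r h].
    by under eq_fun do rewrite big_nil; exact: measurable_cst.
  under eq_fun do rewrite big_cons; apply: measurable_funD => //; apply: measurable_funM => //.
  by case: hG => h1 _; case: (h1 t).
rewrite -ge0_integralD //.
rewrite (_ : [set w | A (H w)] = [set w | A' (G w)]); last by rewrite HE.
rewrite -integral_cst //; apply: ge0_le_integral => //.
- by move=> w _; rewrite lee_fin mulr_ge0 // expR_ge0.
- by apply: emeasurable_funD; exact: mexp.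
move=> w _; rewrite lee_fin !mx_inner_frob2 frob2N mx_innerNl.
set a := mx_inner _ _; set c := (_ / 2)%R.
have h1 : (1 + a <= expR a)%R by exact: expR_ge1Dx.
have h2 : (1 - a <= expR (- a))%R by exact: expR_ge1Dx.
rewrite !expRD -mulrDl ler_wpM2r ?expR_ge0 //; lra.
Qed.

(** Each translate of [A] by plus or minus [S i] keeps, on average over the two
    signs, at least the fraction [exp (- 1 / 2) >= 1 / 2] of the probability,
    and each of the two families of disjoint translates fits into [B]. *)
Lemma packing_le (H : T -> 'M[C]_n) (I : finType) (S : I -> 'M[C]_n) (A B : set (borel_mx R n n)) :
  quasi_invariant H -> measurable A -> measurable B ->
  (forall i, S i \is hermsymmx) -> (forall i, frob2 (S i) <= 1)%R ->
  (forall i j (X : 'M[C]_n), A (X + S i)%R -> A (X + S j)%R -> i = j) ->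
  (forall i j (X : 'M[C]_n), A (X - S i)%R -> A (X - S j)%R -> i = j) ->
  (forall i (X : 'M[C]_n), A (X + S i)%R -> B X) -> (forall i (X : 'M[C]_n), A (X - S i)%R -> B X) ->
  (0 < #|I|)%N ->
  P [set w | A (H w)] <= (2 / #|I|%:R)%:E * P [set w | B (H w)].
Proof.
move=> [mH qi] mA mB Sh S1 dp dm bp bm I0.
have mpre := measurable_preimage_mx mH.
have mS S' : measurable [set w | A (H w + S')%R].
  apply: (measurable_preimage_mx (H := fun w => (H w + S')%R)) => //.
  exact: measurableT_comp (measurable_addmx S') mH.
have fA := fin_num_measure P _ (mpre _ mA); have fB := fin_num_measure P _ (mpre _ mB).
have hp : \sum_(i : I) P [set w | A (H w + S i)%R] <= P [set w | B (H w)].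
  apply: sum_measure_disjoint_le => //; first exact: mpre.
  - by move=> i j w; exact: dp.
  - by move=> i w; exact: bp.
have hm : \sum_(i : I) P [set w | A (H w - S i)%R] <= P [set w | B (H w)].
  apply: sum_measure_disjoint_le => //; first exact: mpre.
  - by move=> i j w; exact: dm.
  - by move=> i w; exact: bm.
have e2 : ((2 : R)^-1 <= expR (- (2^-1)))%R.
  by apply: le_trans (expR_ge1Dx _); lra.
have : \sum_(i : I) P [set w | A (H w)] <= P [set w | B (H w)] + P [set w | B (H w)].
  apply: le_trans (leeD hp hm); rewrite -big_split /=; apply: lee_sum => i _.
  apply: le_trans (qi _ _ (Sh i) mA).
  rewrite -(fineK fA) -EFinM lee_fin ler_peMl ?fine_ge0 //.
  rewrite -ler_pdivrMl // mulr1; apply: le_trans e2 _.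
  by rewrite ler_expR lerN2 -[leRHS]mul1r ler_pM2r.
rewrite -(fineK fA) -(fineK fB) sumEFin sumr_const -EFinD -EFinM !lee_fin => h.
have I0R : (0 < #|I|%:R :> R)%R by rewrite ltr0n.
rewrite -(ler_pM2r I0R) mulr_natr mulrAC divfK ?gt_eqF //.
by apply: le_trans h _; rewrite mulr2n mulrDl !mul1r.
Qed.

(** A Chernoff bound: translating by [th * outer z] has total mass at most 1,
    and on the event its density is at least [exp (a ^ 2 / (2 * |z| ^ 4))] for
    the optimal [th = s * a / |z| ^ 4]. *)
Lemma qform_tail (H : T -> 'M[C]_n) (z : 'cV[C]_n) (s a : R) : GUE P H -> (0 < sqn z)%R ->
  (s ^+ 2 = 1)%R -> (0 <= a)%R ->
  P [set w | (a <= s * qform (H w) z)%R] <= (expR (- (a ^+ 2 / (2 * sqn z ^+ 2))))%:E.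
Proof.
move=> [G hG HG] z0 s1 a0; have mG := measurable_gaussian_mx hG.
pose A : set (borel_mx R n n) := [set X : 'M[C]_n | (a <= s * qform X z)%R].
have mA : measurable A.
  apply: measurable_le_set => //; apply: measurable_funM => //.
  exact: (@measurable_qform _ _ (borel_mx R n n) _ id).
have AE : [set w | (a <= s * qform (H w) z)%R] = [set w | A (G w)].
  by apply/funext => w; rewrite /A /= HG qform_hermitian_part.
rewrite AE; pose th := (s * (a / sqn z ^+ 2))%R.
have mGA : measurable [set w | A (G w)] := measurable_preimage_mx mG mA.
have mGS S' : measurable_fun [set: T] (fun w => G w + S' : borel_mx R n n)%R.
  exact: measurableT_comp (measurable_addmx S') mG.
have : P [set w | A (G w + th%:C *: outer z)%R] <= 1.
  by apply: probability_le1; apply: (measurable_preimage_mx (mGS _)).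
rewrite (cameron_martin hG) // => h1.
have fA := fin_num_measure P _ mGA.
suff h2 : (expR (a ^+ 2 / (2 * sqn z ^+ 2)))%:E * P [set w | A (G w)] <= 1.
  move: h2; rewrite -(fineK fA) -EFinM !lee_fin expRN => h2.
  by rewrite -(ler_pM2l (expR_gt0 (a ^+ 2 / (2 * sqn z ^+ 2)))) divff // gt_eqF // expR_gt0.
apply: le_trans h1; rewrite -integral_cst //; apply: ge0_le_lower_integral => w Aw.
  by rewrite lee_fin expR_ge0.
rewrite lee_fin ler_expR !mx_innerZl mx_innerZr mx_inner_frob2 frob2_outer mx_inner_outer.
have : (a <= s * qform (G w) z)%R by exact: Aw.
have th0 : (0 <= a / sqn z ^+ 2)%R by rewrite divr_ge0 // sqr_ge0.
move=> /(ler_wpM2l th0) h3.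
rewrite (_ : th * (th * _) = s ^+ 2 * (a / sqn z ^+ 2) * (a / sqn z ^+ 2 * sqn z ^+ 2))%R; last by rewrite /th; ring.
rewrite s1 mul1r (_ : a ^+ 2 / _ = a / sqn z ^+ 2 * a - a / sqn z ^+ 2 * (a / sqn z ^+ 2 * sqn z ^+ 2) / 2)%R; last first.
  by field; rewrite gt_eqF.
by rewrite lerD2r (le_trans h3) // /th; lra.
Qed.

End HermitianShifts.

(** * Countable families of test vectors *)

Section RationalVectors.
Context {R : realType} {n : nat}.
Local Notation C := R[i].
Import Normc.
Implicit Types (x y : 'cV[C]_n) (A B : 'M[C]_n).

(** Indices that are not codes are sent to 0, so this is a total enumeration of
    the vectors with coordinates in [Q(i)]. *)
Definition rational_vector (m : nat) : 'cV[C]_n :=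
  if unpickle m is Some f then
    \col_i (ratr ((f : {ffun 'I_n -> rat * rat}) i).1 +i* ratr (f i).2)
  else 0.

Lemma rational_approx (a e : R) : 0 < e ->
  exists q : rat, `|ratr q - a| < e /\ (a = 0 -> q = 0).
Proof.
move=> e0; have [->|a0] := eqVneq a 0.
  by exists 0; rewrite rmorph0 subr0 normr0.
have ae : a - e < a + e by lra.
have [q] := rat_in_itvoo ae.
rewrite in_itv /= => /andP[h1 h2]; exists q; split.
  by rewrite ltr_norml; apply/andP; split; lra.
by move=> /eqP; rewrite (negPf a0).
Qed.

Lemma rational_vector_dense x (e : R) : 0 < e ->
  exists m, herm_norm (rational_vector m - x) < e /\
    forall i, x i ord0 = 0 -> rational_vector m i ord0 = 0.
Proof.
move=> e0; pose d := e / (2 * n%:R + 1).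
have D0 : 0 < 2 * n%:R + 1 :> R by rewrite ltr_wpDl ?mulr_ge0 ?ler0n.
have d0 : 0 < d by rewrite divr_gt0.
have ex1 i := rational_approx (complex.Re (x i ord0)) d0.
have ex2 i := rational_approx (complex.Im (x i ord0)) d0.
pose f : {ffun 'I_n -> rat * rat} := [ffun i => (sval (cid (ex1 i)), sval (cid (ex2 i)))].
exists (pickle f); rewrite /rational_vector pickleK.
split; last first.
  move=> i xi; rewrite !mxE !ffunE /=.
  have [_ ->] := svalP (cid (ex1 i)); last by rewrite xi.
  have [_ ->] := svalP (cid (ex2 i)); last by rewrite xi.
  by rewrite !rmorph0.
have le1 y : herm_norm y <= \sum_i normc (y i ord0).
  rewrite -(@ler_pXn2r _ 2) ?nnegrE ?herm_norm_ge0 ?sumr_ge0 //; last by move=> i _; exact: normc_ge0.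
  rewrite sqr_herm_norm /sqn [leRHS]expr2 mulr_suml; apply: ler_sum => i _.
  rewrite expr2 ler_wpM2l ?normc_ge0 // (bigD1 i) //= lerDl sumr_ge0 // => j _.
  exact: normc_ge0.
apply: le_lt_trans (le1 _) _.
apply: (@le_lt_trans _ _ (\sum_(i < n) (d + d))).
  apply: ler_sum => i _; rewrite !mxE !ffunE /=.
  have [/ltW h1 _] := svalP (cid (ex1 i)); have [/ltW h2 _] := svalP (cid (ex2 i)).
  move: h1 h2; set p := ratr _; set q := ratr _; case: (x i ord0) => a b /= h1 h2.
  rewrite -(@ler_pXn2r _ 2) ?nnegrE ?sqrtr_ge0 ?addr_ge0 ?(ltW d0) //.
  rewrite sqr_sqrtr ?addr_ge0 ?sqr_ge0 // -[(p - a) ^+ 2]real_normK ?num_real // -[(q - b) ^+ 2]real_normK ?num_real //.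
  have := normr_ge0 (p - a); have := normr_ge0 (q - b); move: h1 h2.
  move: `|p - a| `|q - b| => u v; have := ltW d0; nra.
rewrite sumr_const card_ord -[ltLHS]mulr_natr /d.
have -> : (e / (2 * n%:R + 1) + e / (2 * n%:R + 1)) * n%:R = e * ((2 * n%:R) / (2 * n%:R + 1)).
  by field; rewrite gt_eqF.
by rewrite gtr_pMr // ltr_pdivrMr // mul1r ltrDl.
Qed.

Lemma qform_perturb A x e : herm_norm e <= 1 ->
  qform A x - (2 * Num.sqrt (frob2 A) * herm_norm x + Num.sqrt (frob2 A)) * herm_norm e <= qform A (x + e).
Proof.
move=> e1; set b := Num.sqrt _.
have b0 : 0 <= b by exact: sqrtr_ge0.
rewrite /qform mulmxDr !herm_dotDl !herm_dotDr !ReD -/(qform A x).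
have cs y z : `|complex.Re (herm_dot (A *m y) z)| <= b * herm_norm y * herm_norm z.
  rewrite (le_trans (normc_Re _)) // (le_trans (cauchy_schwarz _ _)) //.
  by rewrite ler_wpM2r ?herm_norm_ge0 // herm_norm_mulmx_le.
have := cs x e; have := cs e x; have := cs e e; rewrite !ler_norml => /andP[h1 _] /andP[h2 _] /andP[h3 _].
have h4 : b * herm_norm e * herm_norm e <= b * herm_norm e.
  by rewrite -[leRHS]mulr1 ler_wpM2l // mulr_ge0 // herm_norm_ge0.
move: h1 h2 h3 h4; set p := complex.Re _; set q := complex.Re _; set r := complex.Re _.
move: (herm_norm x) (herm_norm e) (qform A x) => X E0 Q h1 h2 h3 h4.
have -> : (2 * b * X + b) * E0 = b * X * E0 + b * E0 * X + b * E0 by ring.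
lra.
Qed.

(** A quadratic form inequality on a coordinate subspace holds by density once
    it holds on rational vectors; this turns such a condition on a matrix into
    a countable, hence measurable, one. *)
Lemma qform_le_rational (Z : pred 'I_n) A (a : R) :
  (forall m, (forall i, Z i -> rational_vector m i ord0 = 0) ->
    qform A (rational_vector m) <= a * sqn (rational_vector m)) ->
  forall x, (forall i, Z i -> x i ord0 = 0) -> qform A x <= a * sqn x.
Proof.
move=> h x xZ; pose B := A - a%:C%:M.
have BE y : qform B y = qform A y - a * sqn y.
  by rewrite /B qformDl qformN qform_scalar.
rewrite -subr_le0 -BE leNgt; apply/negP => B0.
pose K := 2 * Num.sqrt (frob2 B) * herm_norm x + Num.sqrt (frob2 B) + 1.
have K0 : 0 < K by rewrite ltr_wpDl // addr_ge0 ?mulr_ge0 ?sqrtr_ge0 ?herm_norm_ge0.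
have d0 : 0 < Num.min 1 (qform B x / (2 * K)).
  by rewrite lt_min ltr01 divr_gt0 // mulr_gt0.
have [m [hm hZ]] := rational_vector_dense x d0.
move: hm; rewrite lt_min => /andP[/ltW e1 e2].
have h1 := qform_perturb B x e1; rewrite [x + _]addrC subrK in h1.
have : qform B (rational_vector m) <= 0.
  by rewrite BE subr_le0; apply: h => i Zi; apply: hZ; exact: xZ.
have : herm_norm (rational_vector m - x) * (2 * K) < qform B x by rewrite -ltr_pdivlMr // mulr_gt0.
move: h1; rewrite [X in X * _](_ : _ = K - 1); last by rewrite /K; ring.
have := herm_norm_ge0 (rational_vector m - x).
move: (herm_norm _) (qform B _) (qform B _) => u v w; move: K0; nra.
Qed.

Lemma qform_sqn0 A x : sqn x = 0 -> qform A x = 0.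
Proof. by move=> /eqP; rewrite sqn_eq0 => /eqP ->; rewrite /qform mulmx0 herm_dot0l. Qed.

End RationalVectors.

(** * Largest eigenvalue and nearly opposite extreme eigenvalues *)

Section LargestEigenvalue.
Context {R : realType} {n : nat}.
Local Notation C := R[i].
Import Normc.
Hypothesis n_gt0 : (0 < n)%N.
Implicit Types (x y : 'cV[C]_n) (A B : 'M[C]_n).

Lemma exists_max_index (d : 'I_n -> R) : exists i, forall j, d j <= d i.
Proof.
have i0 := Ordinal n_gt0.
exists [arg max_(i > i0) d i]%O; case: Order.TotalTheory.arg_maxP => // i _ h j.
exact: h.
Qed.

Lemma diag_qform_le V A d x (l : R) : diagonalizes V d A -> (forall i, d i <= l) ->
  qform A x <= l * sqn x.
Proof.
move=> VdA dl; rewrite (diag_qform VdA) -(unitary_sqn x (proj1 VdA)) mulr_sumr.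
by apply: ler_sum => i _; rewrite ler_wpM2r // sqr_ge0.
Qed.

Lemma exists_top_eigenvalue A : exists l : R,
  (exists2 v, sqn v = 1 & qform A v = l) /\ forall x, qform A x <= l * sqn x.
Proof.
have [V [d VdA]] := hermitian_diagonalizes (hermitian_part_sym A).
have [i hi] := exists_max_index d.
exists (d i); split; last first.
  by move=> x; rewrite -qform_hermitian_part; exact: diag_qform_le VdA hi.
exists (eigvec V i); first exact: sqn_eigvec VdA i.
rewrite -qform_hermitian_part /qform (eigvecP VdA) herm_dotZl herm_dotxx ReZ.
by rewrite (sqn_eigvec VdA) mulr1.
Qed.

(** The largest eigenvalue of the Hermitian part, hence a total function of the
    matrix. *)
Definition lmax A : R := sval (cid (exists_top_eigenvalue A)).

Lemma qform_lmax A x : qform A x <= lmax A * sqn x.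
Proof. by have [_ h] := svalP (cid (exists_top_eigenvalue A)). Qed.

Lemma lmax_le A (a : R) : lmax A <= a <-> forall x, qform A x <= a * sqn x.
Proof.
split=> [h x|h].
  by apply: le_trans (qform_lmax A x) _; rewrite ler_wpM2r // sqn_ge0.
have [[v v1 vl] _] := svalP (cid (exists_top_eigenvalue A)).
by have := h v; rewrite v1 mulr1 vl.
Qed.

Lemma lmax_diag V A d i : diagonalizes V d A -> (forall j, d j <= d i) -> lmax A = d i.
Proof.
move=> VdA hi; apply/eqP; rewrite eq_le; apply/andP; split.
  by apply/lmax_le => x; exact: diag_qform_le VdA hi.
have := qform_lmax A (eigvec V i).
by rewrite /qform (eigvecP VdA) herm_dotZl herm_dotxx ReZ (sqn_eigvec VdA) !mulr1.
Qed.

Lemma lmax_shift A (s : R) : lmax (A + s%:C%:M) = lmax A + s.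
Proof.
have le B (t : R) : lmax (B + t%:C%:M) <= lmax B + t.
  apply/lmax_le => x; rewrite qformDl qform_scalar mulrDl lerD2r; exact: qform_lmax.
apply/eqP; rewrite eq_le le /=.
have := le (A + s%:C%:M) (- s).
by rewrite -addrA -raddfD -rmorphD subrr /= raddf0 addr0; lra.
Qed.

Lemma measurable_lmax : measurable_fun [set: borel_mx R n n] (fun A : borel_mx R n n => lmax (A : 'M[C]_n)).
Proof.
apply: (measurability _ (RGenOInfty.measurableE R)) => //.
move=> _ [_ [a ->] <-]; rewrite setTI.
rewrite (_ : _ @^-1` _ = ~` \bigcap_m [set A : borel_mx R n n |
    qform (A : 'M[C]_n) (rational_vector m) <= a * sqn (rational_vector m : 'cV[C]_n)]).
  apply: measurableC; apply: bigcapT_measurable => m.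
  apply: measurable_le_set => //.
  exact: (@measurable_qform _ _ (borel_mx R n n) _ id).
apply/seteqP; split=> A /=; rewrite in_itv /= andbT.
  move=> h1 h2; move: h1; apply/negP; rewrite -leNgt; apply/lmax_le => x.
  by apply: (@qform_le_rational _ _ pred0) => // m _; exact: h2.
move=> h; rewrite ltNge; apply/negP => h1; apply: h => m _.
exact: (lmax_le A a).1.
Qed.

(** [lmax A + lmin A]: it vanishes exactly when the two extreme eigenvalues
    have the same modulus and opposite signs. *)
Definition opposite_gap A : R := lmax A - lmax (- A).

Lemma opposite_gap_shift A (s : R) : opposite_gap (A + s%:C%:M) = opposite_gap A + 2 * s.
Proof.
rewrite /opposite_gap lmax_shift opprD -raddfN -rmorphN lmax_shift; ring.
Qed.

Lemma opposite_gap_shiftN A (s : R) : opposite_gap (A - s%:C%:M) = opposite_gap A - 2 * s.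
Proof. by have := opposite_gap_shift (A - s%:C%:M) s; rewrite subrK => ->; rewrite addrK. Qed.

Definition small_opposite_gap (e : R) : set (borel_mx R n n) :=
  [set A : 'M[C]_n | `|opposite_gap A| <= e].

Lemma measurable_small_opposite_gap e : measurable (small_opposite_gap e).
Proof.
apply: measurable_le_set => //; apply: measurableT_comp => //.
apply: measurable_funB; first exact: measurable_lmax.
exact: measurableT_comp measurable_lmax measurable_oppmx.
Qed.

Lemma scalar_hermsymmx (s : R) : (s%:C%:M : 'M[C]_n) \is hermsymmx.
Proof.
apply/hermsymmxP/matrixP => i j; rewrite !mxE eq_sym.
by case: eqP => _; rewrite ?mulr1n ?mulr0n ?conj_real ?rmorph0.
Qed.

Lemma frob2_scalar (s : R) : frob2 (s%:C%:M : 'M[C]_n) = n%:R * s ^+ 2.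
Proof.
rewrite /frob2 (eq_bigr (fun=> s ^+ 2)); first by rewrite sumr_const card_ord mulr_natl.
move=> i _; rewrite (bigD1 i) //= big1 => [|j ji].
  by rewrite mxE eqxx mulr1n normc_real real_normK ?num_real ?addr0.
by rewrite mxE eq_sym (negPf ji) mulr0n normc0 expr0n.
Qed.

(** Adding [s] to the diagonal moves both extreme eigenvalues by [s], hence
    their sum by [2 * s]. About [1 / (2 * e * sqrt n)] scalar matrices
    [2 * e * k] have Frobenius norm at most 1, and the corresponding translates
    are disjoint. *)
Lemma small_opposite_gap_le (dd : measure_display) (T : measurableType dd)
    (P : probability T R) (H : T -> 'M[C]_n) (e : R) :
  quasi_invariant P H -> 0 < e ->
  (P [set w | small_opposite_gap e (H w)] <= (4 * e * Num.sqrt n%:R)%:E)%E.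
Proof.
move=> qi e0; pose s := 2 * e * Num.sqrt n%:R.
have n0 : 0 < n%:R :> R by rewrite ltr0n.
have sn0 : 0 < Num.sqrt n%:R :> R by rewrite sqrtr_gt0.
have s0 : 0 < s by rewrite !mulr_gt0.
pose K := (Num.truncn s^-1).+1.
have si : 0 <= s^-1 by rewrite invr_ge0 ltW.
have Kgt : s^-1 < K%:R by exact: truncnS_gt.
pose S (k : 'I_K) : 'M[C]_n := (2 * e * k%:R : R)%:C%:M.
have key (k l : 'I_K) (g : R) : `|g + 2 * (2 * e * k%:R)| <= e -> `|g + 2 * (2 * e * l%:R)| <= e -> k = l.
  move=> hk hl; apply/ord_inj/eqP/contraT => kl.
  have kl1 := natr_dist_ge1 R kl.
  have h : `|(g + 2 * (2 * e * k%:R)) - (g + 2 * (2 * e * l%:R))| <= e + e.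
    by apply: le_trans (ler_normB _ _) _; exact: lerD.
  have e4 : 4 * e * `|k%:R - l%:R| <= e + e.
    apply: le_trans h; rewrite [X in _ <= `|X|](_ : _ = 4 * e * (k%:R - l%:R)); last by ring.
    by rewrite normrM gtr0_norm // mulr_gt0.
  have : 4 * e * 1 <= 4 * e * `|k%:R - l%:R| by rewrite ler_wpM2l // mulr_ge0 // ltW.
  by move: e0 e4; lra.
have -> : 4 * e * Num.sqrt n%:R = 2 * s by rewrite /s; ring.
have := @packing_le _ _ _ _ P H 'I_K S (small_opposite_gap e) setT qi (measurable_small_opposite_gap e) measurableT.
rewrite card_ord => /(_ _ _ _ _ _ _ _)/le_trans; apply => //.
- by move=> k; exact: scalar_hermsymmx.
- move=> k; rewrite frob2_scalar.
  have -> : n%:R * (2 * e * k%:R) ^+ 2 = (s * k%:R) ^+ 2.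
    by rewrite /s !exprMn sqr_sqrtr ?(ltW n0) //; ring.
  apply: exprn_ile1; first by rewrite mulr_ge0 // ltW.
  rewrite -ler_pdivlMl ?mulr1 //.
  apply: le_trans (_ : (Num.truncn s^-1)%:R <= _); last by rewrite truncn_le.
  by rewrite ler_nat -ltnS.
- by move=> k l X; rewrite /small_opposite_gap /S /= !opposite_gap_shift; exact: key.
- move=> k l X; rewrite /small_opposite_gap /S /= !opposite_gap_shiftN => hk hl.
  by apply: (key _ _ (- opposite_gap X)); rewrite -normrN opprD opprK.
rewrite probability_setT mule1 lee_fin ler_pM2l // -[leRHS]invrK lef_pV2 ?posrE ?invr_gt0 ?ltr0n //.
exact: ltW.
Qed.

End LargestEigenvalue.

(** * Close eigenvalues at the top: probability *)

Lemma sqr_le_add_sqr (F : realDomainType) (p q r : F) :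
  0 <= r -> r <= p + q -> r ^+ 2 <= 2 * p ^+ 2 + 2 * q ^+ 2.
Proof. move=> r0 h; have := sqr_ge0 (p - q); nra. Qed.

Section Arrows.
Context {R : realType} {n : nat}.
Local Notation C := R[i].
Import Normc.
Local Open Scope sesquilinear_scope.
Implicit Types (x y w : 'cV[C]_n) (A B : 'M[C]_n) (j : 'I_n).

(** The Hermitian perturbation supported by row and column [j]. *)
Definition arrow j x : 'M[C]_n :=
  \matrix_(a, b) ((if a == j then ((x b ord0)^*)%R else 0) + (if b == j then x a ord0 else 0)).

Lemma arrow_sym j x : arrow j x \is hermsymmx.
Proof.
apply/hermsymmxP/matrixP => a b; rewrite !mxE rmorphD addrC.
by case: (a == j); case: (b == j); rewrite /= ?conjCK ?rmorph0.
Qed.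

Lemma arrowN j x : arrow j (- x) = - arrow j x.
Proof.
apply/matrixP => a b; rewrite !mxE opprD.
by congr (_ + _); case: ifP; rewrite ?rmorphN ?oppr0.
Qed.

(** On vectors supported off [j] the perturbation acts on the coordinate [j]
    only; so it leaves the minor without row and column [j] untouched. *)
Lemma arrow_mul j x w : w j ord0 = 0 -> arrow j x *m w = herm_dot w x *: delta_mx j ord0.
Proof.
move=> wj; apply/colP => a; rewrite !mxE eqxx andbT.
under eq_bigr do rewrite mxE mulrDl.
rewrite big_split /= [X in _ + X]big1 ?addr0; last first.
  by move=> b _; case: eqP => [->|_]; rewrite ?wj ?mulr0 ?mul0r.
case: eqP => _; last by rewrite mulr0 big1 // => b _; rewrite mul0r.
by rewrite mulr1; apply: eq_bigr => b _; rewrite mulrC.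
Qed.

Lemma frob2_arrow_le j x : frob2 (arrow j x) <= 4 * sqn x.
Proof.
apply: (@le_trans _ _ (\sum_a \sum_b (2 * (if a == j then normc (x b ord0) ^+ 2 else 0) + 2 * (if b == j then normc (x a ord0) ^+ 2 else 0)))).
  apply: ler_sum => a _; apply: ler_sum => b _; rewrite mxE.
  pose u : C := if a == j then ((x b ord0)^*)%R else 0; pose v : C := if b == j then x a ord0 else 0.
  rewrite -/u -/v.
  have -> : (if a == j then normc (x b ord0) ^+ 2 else 0) = normc u ^+ 2.
    by rewrite /u; case: ifP; rewrite ?normc_conj // normc0 expr0n.
  have -> : (if b == j then normc (x a ord0) ^+ 2 else 0) = normc v ^+ 2.
    by rewrite /v; case: ifP; rewrite // normc0 expr0n.
  by apply: sqr_le_add_sqr; [exact: normc_ge0|exact: normcD].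
under eq_bigr do rewrite big_split /= -!mulr_sumr -[X in _ + 2 * X]big_mkcond big_pred1_eq.
rewrite big_split /= -!mulr_sumr.
rewrite (eq_bigr (fun a => if a == j then sqn x else 0)); last first.
  by move=> a _; case: ifP => // _; rewrite big1.
by rewrite -big_mkcond big_pred1_eq -/(sqn x) -mulrDl; lra.
Qed.

End Arrows.

Section CloseTopPair.
Context {R : realType} {n : nat}.
Local Notation C := R[i].
Import Normc.
Implicit Types (x y w : 'cV[C]_n) (A B : 'M[C]_n) (j : 'I_n).

(** The test vector and the test value are decoded from one index, so that
    pairs can be enumerated. *)
Definition test_vector (m : nat) : 'cV[C]_n := rational_vector (odflt (0%N, 0) (unpickle m : option (nat * rat))).1.
Definition test_value (m : nat) : R := ratr (odflt (0%N, 0) (unpickle m : option (nat * rat))).2.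

(** Up to the tolerance [e], the test vector and the test value are a top
    eigenpair of the minor obtained by erasing row and column [j]. *)
Definition near_top j (e : R) (m : nat) : set (borel_mx R n n) :=
  [set A : 'M[C]_n | [/\ test_vector m j ord0 = 0, 0 < sqn (test_vector m),
    \sum_(i | i != j) normc ((A *m test_vector m) i ord0 - (test_value m)%:C * test_vector m i ord0) ^+ 2
      <= e ^+ 2 * sqn (test_vector m)
    & forall k, (rational_vector k : 'cV[C]_n) j ord0 = 0 -> qform A (rational_vector k) <= (test_value m + e) * sqn (rational_vector k : 'cV[C]_n)]].

Lemma measurable_constset (d : measure_display) (T : measurableType d) (Q : Prop) : measurable [set _ : T | Q].
Proof.
have [q|q] := pselect Q.
  by rewrite (_ : [set _ | _] = setT) //; apply/seteqP; split.
by rewrite (_ : [set _ | _] = set0) //; apply/seteqP; split.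
Qed.

Lemma measurable_near_top j e m : measurable (near_top j e m).
Proof.
rewrite (_ : near_top j e m = [set _ | test_vector m j ord0 = 0 /\ 0 < sqn (test_vector m)] `&`
   ([set A : borel_mx R n n | \sum_(i | i != j) normc (((A : 'M[C]_n) *m test_vector m) i ord0 - (test_value m)%:C * test_vector m i ord0) ^+ 2
      <= e ^+ 2 * sqn (test_vector m)] `&`
   \bigcap_k ([set _ | ~ (rational_vector k j ord0 = 0 :> C)] `|`
     [set A : borel_mx R n n | qform (A : 'M[C]_n) (rational_vector k) <= (test_value m + e) * sqn (rational_vector k : 'cV[C]_n)]))).
  apply: measurableI; first exact: measurable_constset.
  apply: measurableI.
    apply: measurable_le_set => //.
    rewrite /=; elim: (index_enum _) => [|i r h]; first by under eq_fun do rewrite big_nil; exact: measurable_cst.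
    under eq_fun do rewrite big_cons; case: (i != j) => //.
    apply: measurable_funD => //; apply: measurable_funX; apply: measurable_normc.
    apply: cmeasurableD; last exact: cmeasurable_cst.
    exact: (@cmeasurable_mulmx _ _ (borel_mx R n n) _ id).
  apply: bigcapT_measurable => k; apply: measurableU; first exact: measurable_constset.
  by apply: measurable_le_set => //; exact: (@measurable_qform _ _ (borel_mx R n n) _ id).
apply/seteqP; split => A.
  move=> [h1 h2 h3 h4]; split => //; split => // k _ /=.
  by have [/h4|] := pselect (rational_vector k j ord0 = 0 :> C); [right|left].
by move=> [[h1 h2] [h3 h4]]; split => // k hk; have [] := h4 k I.
Qed.

Lemma near_top_arrow j e m A x : near_top j e m A -> near_top j e m (A + arrow j x).
Proof.
move=> [h1 h2 h3 h4]; split => //.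
  rewrite (eq_bigr (fun i => normc ((A *m test_vector m) i ord0 - (test_value m)%:C * test_vector m i ord0) ^+ 2)) //.
  move=> i /negPf ij; rewrite (_ : ((A + _) *m _) i ord0 = (A *m test_vector m) i ord0) //.
  by rewrite mulmxDl arrow_mul // mxE [X in _ + X]mxE [X in _ * X]mxE ij mulr0 addr0.
move=> k hk; rewrite qformDl (_ : qform (arrow j x) _ = 0) ?addr0; first exact: h4.
rewrite /qform arrow_mul // herm_dotZl (_ : herm_dot (delta_mx j ord0) _ = 0) ?mulr0 //.
rewrite /herm_dot big1 // => i _; have [->|/negPf ij] := eqVneq i j.
  by rewrite hk rmorph0 mulr0.
by rewrite mxE ij mul0r.
Qed.

(** The cells of a partition according to the first test pair that fits the
    minor: a measurable choice of a top eigenpair of the minor, which is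
    unchanged when row and column [j] move. *)
Definition first_near_top j e := seqDU (near_top j e).

Lemma first_near_top_arrow j e m A x : first_near_top j e m A -> first_near_top j e m (A + arrow j x).
Proof.
rewrite /first_near_top /seqDU -!bigcup_mkord => -[h1 h2]; split; first exact: near_top_arrow.
move=> [k km hk]; apply: h2; exists k => //.
have := near_top_arrow (- x) hk.
by rewrite arrowN addrK.
Qed.

Lemma measurable_first_near_top j e m : measurable (first_near_top j e m).
Proof.
apply: measurableD; first exact: measurable_near_top.
by apply: bigsetU_measurable => k _; exact: measurable_near_top.
Qed.

(** The coupling is the inner product of row [j] with the test vector, a
    complex number. *)
Definition weak_coupling j (e : R) (m : nat) : set (borel_mx R n n) :=
  [set A : 'M[C]_n | normc ((A *m test_vector m) j ord0) <= e * herm_norm (test_vector m)].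

Lemma measurable_weak_coupling j e m : measurable (weak_coupling j e m).
Proof.
apply: measurable_le_set => //; apply: measurable_normc.
exact: (@cmeasurable_mulmx _ _ (borel_mx R n n) _ id).
Qed.

Context {dd : measure_display} {T : measurableType dd}.
Variables (P : probability T R) (H : T -> 'M[C]_n).
Hypothesis qi : quasi_invariant P H.

(** Moving row and column [j] along the test vector translates the coupling in
    the complex plane and keeps the cell, which depends on the minor only. A
    square grid of mesh [3 * t], with about [1 / (9 * t)] points on each side,
    gives disjoint translates by matrices of Frobenius norm at most 1. *)
Lemma weak_coupling_le j e m (t : R) : 0 < t ->
  (P [set w | (first_near_top j e m `&` weak_coupling j t m) (H w)] <=
   (162 * t ^+ 2)%:E * P [set w | first_near_top j e m (H w)])%E.
Proof.
move=> t0.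
have [[q0 qn]|bad] := pselect (test_vector m j ord0 = 0 :> C /\ 0 < sqn (test_vector m : 'cV[C]_n)); last first.
  rewrite (_ : [set w | (first_near_top j e m `&` _) (H w)] = set0).
    by rewrite measure0 mule_ge0 // lee_fin mulr_ge0 // sqr_ge0.
  by apply/seteqP; split => // w [h _]; have [h1 h2 _ _] := subset_seqDU h; apply: bad.
set q : 'cV[C]_n := test_vector m in q0 qn *.
have nq : 0 < herm_norm q by rewrite sqrtr_gt0.
pose K := (Num.truncn (9 * t)^-1).+1.
have ti : 0 < (9 * t)^-1 by rewrite invr_gt0 mulr_gt0.
have Kgt : (9 * t)^-1 < K%:R by exact: truncnS_gt.
have kle (k : 'I_K) : 9 * t * k%:R <= 1.
  rewrite -ler_pdivlMl ?mulr1 ?mulr_gt0 //.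
  apply: le_trans (_ : (Num.truncn (9 * t)^-1)%:R <= _); last by rewrite truncn_le // ltW.
  by rewrite ler_nat -ltnS.
pose c (k : 'I_K * 'I_K) : C := (3 * t * k.1%:R) +i* (3 * t * k.2%:R).
pose S k := arrow j (((c k)^*)%R * ((herm_norm q)^-1)%:C *: q).
have Sq k : S k *m q = (c k * (herm_norm q)%:C) *: delta_mx j ord0.
  rewrite arrow_mul // herm_dotZr rmorphM /= conjCK conj_real herm_dotxx -mulrA -rmorphM.
  by rewrite -sqr_herm_norm expr2 mulKf // gt_eqF.
have addE X k : ((X + S k) *m q) j ord0 = (X *m q) j ord0 + c k * (herm_norm q)%:C.
  by rewrite mulmxDl Sq mxE [X in _ + X]mxE [X in _ * X]mxE !eqxx mulr1.
have subE X k : ((X - S k) *m q) j ord0 = (X *m q) j ord0 - c k * (herm_norm q)%:C.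
  by rewrite mulmxBl Sq mxE [X in _ + X]mxE [X in - X]mxE [X in _ * X]mxE !eqxx mulr1.
have cK (k l : 'I_K * 'I_K) (z : C) : normc (z + c k * (herm_norm q)%:C) <= t * herm_norm q ->
    normc (z + c l * (herm_norm q)%:C) <= t * herm_norm q -> k = l.
  move=> hk hl.
  have : normc (c k - c l) * herm_norm q <= 2 * t * herm_norm q.
    rewrite -[X in _ * X](gtr0_norm nq) -normc_real -normcM.
    rewrite (_ : _ * _ = (z + c k * (herm_norm q)%:C) + - (z + c l * (herm_norm q)%:C)); last by ring.
    apply: le_trans (normcD _ _) _; rewrite normcN.
    by apply: le_trans (lerD hk hl) _; rewrite -mulrDl; lra.
  rewrite ler_pM2r // => hc.
  have sep (a b : 'I_K) : `|3 * t * a%:R - 3 * t * b%:R| <= 2 * t -> a = b.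
    move=> hab; apply/ord_inj/eqP/contraT => ab.
    have ab1 := natr_dist_ge1 R ab.
    move: hab; rewrite -mulrBr normrM gtr0_norm ?mulr_gt0 //.
    have : 3 * t * 1 <= 3 * t * `|a%:R - b%:R| by rewrite ler_wpM2l // mulr_ge0 // ltW.
    by move: t0; lra.
  have h1 : k.1 = l.1.
    apply: sep; apply: le_trans hc; apply: le_trans (normc_Re _); by rewrite ReD ReN.
  have h2 : k.2 = l.2.
    apply: sep; apply: le_trans hc.
    rewrite -(@ler_pXn2r _ 2) ?nnegrE ?normc_ge0 ?normr_ge0 //.
    by rewrite normc_sqr ImD ImN real_normK ?num_real // lerDr sqr_ge0.
  by case: k l h1 h2 {hk hl hc} => [k1 k2] [l1 l2] /= -> ->.
have mF := measurable_first_near_top j e m.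
have := @packing_le _ _ _ _ P H ('I_K * 'I_K)%type S
  (first_near_top j e m `&` weak_coupling j t m) (first_near_top j e m) qi
  (measurableI _ _ mF (measurable_weak_coupling j t m)) mF.
rewrite card_prod card_ord => /(_ _ _ _ _ _ _ _)/le_trans; apply => //.
- by move=> k; exact: arrow_sym.
- move=> k; apply: le_trans (frob2_arrow_le _ _) _.
  rewrite sqnZ normcM normc_conj exprMn normc_real real_normK ?num_real // exprVn sqr_herm_norm.
  rewrite -mulrA mulVf ?gt_eqF // mulr1 normc_sqr /=.
  have := kle k.1; have := kle k.2.
  have : 0 <= t * k.1%:R by rewrite mulr_ge0 // ltW.
  have : 0 <= t * k.2%:R by rewrite mulr_ge0 // ltW.
  rewrite -!mulrA; move: (t * k.1%:R) (t * k.2%:R) => u v; nra.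
- move=> k l X [_]; rewrite /weak_coupling /= -/q => hk [_]; rewrite /= -/q => hl.
  by rewrite addE in hk; rewrite addE in hl; exact: (cK k l _ hk hl).
- move=> k l X [_]; rewrite /weak_coupling /= -/q => hk [_]; rewrite /= -/q => hl.
  rewrite subE in hk; rewrite subE in hl; apply: (cK k l (- (X *m q) j ord0)).
    by rewrite -normcN opprD opprK.
  by rewrite -normcN opprD opprK.
- by move=> k X [h _]; have := first_near_top_arrow (- (((c k)^*)%R * ((herm_norm q)^-1)%:C *: q)) h; rewrite arrowN addrK.
- by move=> k X [h _]; have := first_near_top_arrow (((c k)^*)%R * ((herm_norm q)^-1)%:C *: q) h; rewrite subrK.
apply: lee_wpmul2r => //; rewrite lee_fin natrM invfM mulrA.
have K0 : 0 < K%:R :> R by rewrite ltr0n.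
have Ki : K%:R^-1 <= 9 * t by rewrite -[leRHS]invrK lef_pV2 ?posrE // ltW.
have Ki0 : 0 <= K%:R^-1 :> R by rewrite invr_ge0 ltW.
move: Ki Ki0; move: (K%:R^-1 : R) => u; nra.
Qed.

Definition close_pair_at j (e : R) : set (borel_mx R n n) :=
  \bigcup_m (first_near_top j e m `&` weak_coupling j (3 * e * Num.sqrt n%:R) m).

Lemma measurable_close_pair_at j e : measurable (close_pair_at j e).
Proof.
apply: bigcupT_measurable => m; apply: measurableI; first exact: measurable_first_near_top.
exact: measurable_weak_coupling.
Qed.

(** The cells are disjoint, so their probabilities add up to at most 1. *)
Lemma close_pair_at_le j (e : R) : 0 < e ->
  (P [set w | close_pair_at j e (H w)] <= (1458 * n%:R * e ^+ 2)%:E)%E.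
Proof.
move=> e0; have [mH _] := qi.
have n0 : 0 < n%:R :> R by rewrite ltr0n (leq_ltn_trans (leq0n j) (ltn_ord j)).
pose t : R := 3 * e * Num.sqrt n%:R.
have t0 : 0 < t by rewrite !mulr_gt0 // sqrtr_gt0.
pose Y m := [set w | (first_near_top j e m `&` weak_coupling j t m) (H w)].
pose D m := [set w | first_near_top j e m (H w)].
have mD m : measurable (D m) by apply: (measurable_preimage_mx mH); exact: measurable_first_near_top.
have mY m : measurable (Y m).
  apply: (measurable_preimage_mx mH); apply: measurableI; first exact: measurable_first_near_top.
  exact: measurable_weak_coupling.
rewrite (_ : [set w | _] = \bigcup_m Y m); last by apply/seteqP; split.
have mU : measurable (\bigcup_m Y m) by exact: bigcupT_measurable.
apply: le_trans (generalized_Boole_inequality P mY mU) _.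
have t2 : (162 * t ^+ 2) = 1458 * n%:R * e ^+ 2.
  by rewrite /t !exprMn sqr_sqrtr ?(ltW n0) //; ring.
rewrite -t2.
have tp : (0 <= (162 * t ^+ 2)%:E)%E by rewrite lee_fin mulr_ge0 // sqr_ge0.
apply: (@le_trans _ _ (\sum_(0 <= m <oo) ((162 * t ^+ 2)%:E * P (D m)))%E).
  by apply: lee_nneseries => m *; [exact: measure_ge0|exact: weak_coupling_le].
rewrite nneseriesZl //.
rewrite -[leRHS]mule1; apply: lee_wpmul2l => //.
rewrite -measure_semi_bigcup //.
- by apply: probability_le1; exact: bigcupT_measurable.
- move=> a b _ _ [w [ha hb]]; apply: (@trivIset_seqDU _ (near_top j e) a b) => //.
  by exists (H w).
- exact: bigcupT_measurable.
Qed.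

(** A measurable event that contains all Hermitian matrices whose two largest
    eigenvalues are within [e] ([close_pair_cover]). A unit vector has a
    coordinate of modulus at least [1 / sqrt n], but which one depends on the
    matrix; hence the union over [j]. *)
Definition close_pair (e : R) : set (borel_mx R n n) := \big[setU/set0]_(j : 'I_n) close_pair_at j e.

Lemma measurable_close_pair e : measurable (close_pair e).
Proof. by apply: bigsetU_measurable => j _; exact: measurable_close_pair_at. Qed.

Lemma close_pair_le (e : R) : 0 < e ->
  (P [set w | close_pair e (H w)] <= (1458 * n%:R ^+ 2 * e ^+ 2)%:E)%E.
Proof.
move=> e0; have [mH _] := qi.
pose Y j := [set w | close_pair_at j e (H w)].
have mY j : measurable (Y j) by apply: (measurable_preimage_mx mH); exact: measurable_close_pair_at.
have -> : [set w | close_pair e (H w)] = \big[setU/set0]_(j : 'I_n) Y j.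
  by rewrite /close_pair; elim/big_ind2: _ => // A A' B B' <- <-.
have [] : measurable (\big[setU/set0]_(j : 'I_n) Y j) /\
    (P (\big[setU/set0]_(j : 'I_n) Y j) <= (\sum_(j : 'I_n) (1458 * n%:R * e ^+ 2))%:E)%E.
  apply: (big_ind2 (fun (A : set T) (y : R) => measurable A /\ (P A <= y%:E)%E)).
  - by rewrite measure0; split.
  - move=> A a B b [mA Aa] [mB Bb]; split; first exact: measurableU.
    by apply: le_trans (measureU2 _ _ _) _ => //; rewrite EFinD; exact: leeD.
  - by move=> j _; split; [exact: mY|exact: close_pair_at_le].
move=> _ /le_trans; apply; rewrite lee_fin sumr_const card_ord -[leLHS]mulr_natr.
by rewrite le_eqVlt; apply/orP; left; apply/eqP; ring.
Qed.

End CloseTopPair.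

(** * Close eigenvalues at the top: covering *)

Section CloseEigenvalues.
Context {R : realType} {n : nat}.
Local Notation C := R[i].
Import Normc.
Local Open Scope sesquilinear_scope.
Implicit Types (x y w : 'cV[C]_n) (A B : 'M[C]_n) (j : 'I_n).

(** A top eigenpair of the minor without row and column [j], written with
    vectors of full length: replacing row and column [j] by a very negative
    diagonal entry moves the top eigenvector to the other coordinates. *)
Lemma exists_minor_top_eigenvector A j : A \is hermsymmx -> (1 < n)%N ->
  exists (l : R) (v : 'cV[C]_n), [/\ sqn v = 1, v j ord0 = 0,
    forall i, i != j -> (A *m v) i ord0 = l%:C * v i ord0
    & forall w, w j ord0 = 0 -> qform A w <= l * sqn w].
Proof.
move=> Ah n1; pose c : R := 1 + Num.sqrt (frob2 A).
pose B : 'M[C]_n := \matrix_(a, b) (if (a == j) || (b == j) then (if a == b then (- c)%:C else 0) else A a b).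
have Bh : B \is hermsymmx.
  apply/hermsymmxP/matrixP => a b; rewrite !mxE orbC (eq_sym b a).
  case: ifP => _; last by move/hermsymmxP/matrixP: Ah => /(_ a b); rewrite !mxE.
  by case: ifP => _; rewrite ?conj_real ?rmorph0.
have B1 w i : w j ord0 = 0 -> i != j -> (B *m w) i ord0 = (A *m w) i ord0.
  move=> wj ij; rewrite !mxE; apply: eq_bigr => b _; rewrite mxE (negPf ij) /=.
  by case: eqP => [->|//]; rewrite wj !mulr0.
have B2 w : (B *m w) j ord0 = (- c)%:C * w j ord0.
  rewrite mxE (bigD1 j) //= big1 => [|b /negPf bj]; first by rewrite mxE !eqxx /= addr0.
  by rewrite mxE eqxx /= eq_sym bj mul0r.
have B3 w : w j ord0 = 0 -> qform B w = qform A w.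
  move=> wj; rewrite /qform !Re_sum; apply: eq_bigr => i _.
  by have [->|ij] := eqVneq i j; [rewrite wj rmorph0 !mulr0|rewrite B1].
have [V [d VdB]] := hermitian_diagonalizes Bh.
have [i0 hi0] := exists_max_index (ltnW n1) d.
have top w : qform B w <= d i0 * sqn w by exact: diag_qform_le VdB hi0.
have [i ij] : exists i : 'I_n, i != j.
  have [e|] := eqVneq (Ordinal (ltnW n1)) j; last by exists (Ordinal (ltnW n1)).
  by exists (Ordinal n1); rewrite -e.
have lc : 0 < d i0 + c.
  pose w : 'cV[C]_n := delta_mx i ord0.
  have w1 : sqn w = 1.
    rewrite /sqn (bigD1 i) //= big1 => [|b /negPf bi]; first by rewrite mxE !eqxx normc1 expr1n addr0.
    by rewrite mxE bi normc0 expr0n.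
  have wj : w j ord0 = 0 by rewrite mxE eq_sym (negPf ij).
  have := top w; rewrite B3 // w1 mulr1.
  have := qform_le A w; rewrite w1 mulr1 ler_norml => /andP[h _].
  by rewrite /c; move: h; lra.
pose v := eigvec V i0.
have vj : v j ord0 = 0.
  have := B2 v; rewrite (eigvecP VdB) mxE => /eqP; rewrite -subr_eq0 -mulrBl -rmorphB opprK.
  rewrite mulf_eq0 => /orP[/eqP /(congr1 (@complex.Re R)) /= /eqP|/eqP //].
  by rewrite gt_eqF.
exists (d i0), v; split => //; first exact: sqn_eigvec VdB i0.
  by move=> i' ij'; rewrite -B1 // (eigvecP VdB) mxE.
by move=> w wj; rewrite -B3.
Qed.

(** Approximate a top eigenpair of the minor by rational data. *)
Lemma exists_near_top A j (e : R) : A \is hermsymmx -> (1 < n)%N -> 0 < e ->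
  exists m, near_top j e m A.
Proof.
move=> Ah n1 e0.
have [l [v [v1 vj Av top]]] := exists_minor_top_eigenvector j Ah n1.
(* Replacing the exact pair by one at distance [d] costs at most
   [(b + |l| + 2) * d] in the eigenvalue equation, and the test vector keeps
   norm at least 1 / 2. *)
pose b := Num.sqrt (frob2 A); have b0 : 0 <= b by exact: sqrtr_ge0.
have K0 : 0 < 2 * (b + `|l| + 2) by rewrite mulr_gt0 // ltr_wpDl // addr_ge0.
pose d := Num.min (2^-1) (e / (2 * (b + `|l| + 2))).
have d0 : 0 < d by rewrite lt_min invr_gt0 ltr0n /= divr_gt0.
have d2 : d <= 2^-1 by rewrite ge_min lexx.
have dK : d * (2 * (b + `|l| + 2)) <= e by rewrite -ler_pdivlMr // ge_min lexx orbT.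
have [k [kv kz]] := rational_vector_dense v d0.
have [r [rl _]] := rational_approx l d0.
exists (pickle (k, r)); rewrite /near_top /test_vector /test_value /= pickleK /=.
set q := rational_vector k in kv kz *; set s : R := ratr r in rl *.
have nv : herm_norm v = 1 by rewrite herm_normE v1 sqrtr1.
have qj : q j ord0 = 0 by exact: kz.
have nq : 2^-1 <= herm_norm q.
  have h1 := herm_normD q (v - q); rewrite [q + _]addrC subrK nv -(herm_normN (v - q)) opprB in h1.
  by move: kv d2 h1; lra.
have ds : d <= e.
  have h : d * 1 <= d * (2 * (b + `|l| + 2)).
    by rewrite ler_wpM2l ?(ltW d0) //; have := normr_ge0 l; move: b0; lra.
  by rewrite mulr1 in h; exact: le_trans dK.
split => //.
- by rewrite sqn_gt0 -herm_norm_gt0; apply: lt_le_trans nq; rewrite invr_gt0.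
- pose y : 'cV[C]_n := A *m (q - v) + (- s%:C) *: (q - v) + (l - s)%:C *: v.
  have yE i : i != j -> (A *m q) i ord0 - s%:C * q i ord0 = y i ord0.
    move=> ij; rewrite /y mulmxBr !mxE -[\sum_j0 _]/((fun z => z) _).
    have := Av i ij; rewrite mxE => ->; rewrite rmorphB; ring.
  have ny : herm_norm y <= e * 2^-1.
    apply: le_trans (herm_normD _ _) _; apply: le_trans (lerD (herm_normD _ _) (lexx _)) _.
    rewrite !herm_normZ normcN !normc_real nv mulr1.
    have h1 := herm_norm_mulmx_le A (q - v); rewrite -/b in h1.
    have h2 : `|s| <= `|l| + 2^-1.
      by have := ler_normD (s - l) l; rewrite subrK; move: rl d2; lra.
    have h3 : `|l - s| <= d by rewrite distrC ltW.
    have h4 : b * herm_norm (q - v) <= b * d by rewrite ler_wpM2l // ltW.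
    have h5 : `|s| * herm_norm (q - v) <= (`|l| + 2^-1) * d.
      by apply: ler_pM => //; [exact: herm_norm_ge0|exact: ltW].
    by move: h1 h3 h4 h5 dK d0; move: (herm_norm _) (herm_norm _) (`|l - s|) (`|s| * _) => ? ? ? ?; lra.
  apply: (@le_trans _ _ (sqn y)).
    rewrite (eq_bigr (fun i => normc (y i ord0) ^+ 2)); last by move=> i ij; rewrite yE.
    by rewrite /sqn [leRHS](bigD1 j) //= lerDr sqr_ge0.
  rewrite -!sqr_herm_norm -exprMn lerXn2r ?nnegrE ?mulr_ge0 ?herm_norm_ge0 ?(ltW e0) //.
  by apply: le_trans ny _; rewrite ler_pM2l.
- move=> w wj; apply: le_trans (top _ wj) _; rewrite ler_wpM2r ?sqn_ge0 //.
  by move: rl; rewrite ltr_norml => /andP[h1 h2]; move: h1 ds; lra.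
Qed.

(** By interlacing the top eigenvalue of the minor lies between the two largest
    eigenvalues of [A], so the test value [r] is within [2 * e] of [d i1]. For
    the top eigenvector [u] of [A] and the test vector [q], the identity
    [<A u, q> = <u, A q>] then bounds the product of [u j] with the coordinate
    [j] of [A *m q] by [3 * e * |q|]. *)
Lemma near_top_weak_coupling V A (d : 'I_n -> R) (i1 i2 : 'I_n) j (e : R) m :
  A \is hermsymmx -> diagonalizes V d A -> i1 != i2 -> (forall i, d i <= d i1) ->
  d i1 - e <= d i2 -> 0 < e -> 1 <= n%:R * normc (eigvec V i1 j ord0) ^+ 2 ->
  near_top j e m A -> weak_coupling j (3 * e * Num.sqrt n%:R) m A.
Proof.
move=> Ah VdA i12 hi1 hi2 e0 uj [qj qn herr top].
set q := test_vector m in qj qn herr *; set r := test_value m in herr top *.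
pose u := eigvec V i1; pose u2 := eigvec V i2.
have nqp : 0 < herm_norm q by rewrite sqrtr_gt0.
have su : sqn u = 1 by exact: sqn_eigvec VdA i1.
have su2 : sqn u2 = 1 by exact: sqn_eigvec VdA i2.
have u12 : herm_dot u u2 = 0.
  rewrite (herm_dot_eigvec VdA) (mul_eigvec VdA) mxE.
  by rewrite eq_sym (negPf i12).
have Au : A *m u = (d i1)%:C *: u by exact: eigvecP.
have Au2 : A *m u2 = (d i2)%:C *: u2 by exact: eigvecP.
rewrite -/u in uj; clearbody u u2.
have nu : herm_norm u = 1 by rewrite herm_normE su sqrtr1.
pose err : 'cV[C]_n := \col_i (if i == j then 0 else (A *m q) i ord0 - r%:C * q i ord0).
have nerr : herm_norm err <= e * herm_norm q.
  rewrite -(@ler_pXn2r _ 2) ?nnegrE ?mulr_ge0 ?herm_norm_ge0 ?(ltW e0) //.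
  rewrite exprMn !sqr_herm_norm; apply: le_trans herr.
  rewrite /sqn (bigD1 j) //= mxE eqxx normc0 expr0n add0r.
  by apply: ler_sum => i /negPf ij; rewrite mxE ij.
pose h := (A *m q) j ord0.
have Aq : A *m q = r%:C *: q + err + h *: delta_mx j ord0.
  have aD (X Y : 'cV[C]_n) i : (X + Y) i ord0 = X i ord0 + Y i ord0 by rewrite mxE.
  have aZ c (X : 'cV[C]_n) i : (c *: X) i ord0 = c * X i ord0 by rewrite mxE.
  apply/colP => i; rewrite !(aD, aZ) [err i ord0]mxE [delta_mx _ _ _ _]mxE eqxx andbT.
  case: eqVneq => [->|ij]; first by rewrite qj mulr0 !add0r mulr1.
  by rewrite mulr0 addr0 addrC subrK.
have r1 : r - e <= d i1.
  have h1 : qform A q <= d i1 * sqn q by exact: diag_qform_le VdA hi1.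
  have h2 : (r - e) * sqn q <= qform A q.
    rewrite /qform Aq !herm_dotDl !herm_dotZl herm_dotxx !ReD ReZ.
    have -> : herm_dot (delta_mx j ord0) q = 0.
      rewrite /herm_dot big1 // => i _; have [->|/negPf ij] := eqVneq i j.
        by rewrite qj rmorph0 mulr0.
      by rewrite mxE ij mul0r.
    rewrite mulr0 addr0 mulrBl lerD2l.
    have : `|complex.Re (herm_dot err q)| <= e * sqn q.
      rewrite (le_trans (normc_Re _)) // (le_trans (cauchy_schwarz _ _)) //.
      by rewrite -sqr_herm_norm expr2 mulrA ler_wpM2r // herm_norm_ge0.
    by rewrite ler_norml => /andP[].
  by rewrite -(ler_pM2r qn); exact: le_trans h1.
have uj0 : u j ord0 != 0.
  apply/eqP => uj0; move: uj; rewrite uj0 normc0 expr0n mulr0.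
  by rewrite leNgt ltr01.
have r2 : d i2 <= r + e.
  (* The combination of the two top eigenvectors that vanishes at [j] tests the
     minor. *)
  pose y := u2 j ord0 *: u + (- u j ord0) *: u2.
  have yj : y j ord0 = 0 by rewrite !mxE mulNr [X in X - _]mulrC subrr.
  have sy : sqn y = normc (u2 j ord0) ^+ 2 + normc (u j ord0) ^+ 2.
    rewrite sqnD !sqnZ su su2 herm_dotZl herm_dotZr u12 !mulr0 addr0 normcN.
    by rewrite !mulr1.
  have sy0 : 0 < sqn y.
    rewrite sy ltr_wpDl ?sqr_ge0 // exprn_gt0 // lt_def normc_ge0 andbT.
    by apply: contra uj0 => /eqP /eq0_normc ->.
  have qy : d i2 * sqn y <= qform A y.
    have qu : qform A u = d i1 by rewrite /qform Au herm_dotZl herm_dotxx ReZ su mulr1.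
    have qu2 : qform A u2 = d i2 by rewrite /qform Au2 herm_dotZl herm_dotxx ReZ su2 mulr1.
    rewrite qformD // !qformZ -!scalemxAr Au !herm_dotZl herm_dotZr u12 !mulr0 addr0.
    rewrite qu qu2 sy normcN mulrDr.
    by rewrite lerD // mulrC // ler_wpM2l ?sqr_ge0.
  have ty : qform A y <= (r + e) * sqn y.
    apply: (@qform_le_rational _ _ (pred1 j)) => [k hk|i /eqP ->] //.
    by apply: top; apply: hk; rewrite /= eqxx.
  by rewrite -(ler_pM2r sy0); exact: le_trans ty.
have key : u j ord0 * (h^*)%R = (d i1 - r)%:C * herm_dot u q - herm_dot u err.
  have : herm_dot (A *m u) q = herm_dot u (A *m q) by exact: herm_dot_sym.
  rewrite Au herm_dotZl Aq !herm_dotDr !herm_dotZr conj_real.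
  have -> : herm_dot u (delta_mx j ord0) = u j ord0.
    rewrite /herm_dot (bigD1 j) //= big1 => [|i /negPf ij].
      by rewrite [delta_mx _ _ _ _]mxE !eqxx rmorph1 mulr1 addr0.
    by rewrite [delta_mx _ _ _ _]mxE ij rmorph0 mulr0.
  by move=> E; rewrite rmorphB mulrBl E; ring.
have bound : normc (u j ord0) * normc h <= 3 * e * herm_norm q.
  rewrite -[normc h]normc_conj -normcM key.
  apply: le_trans (normcD _ _) _; rewrite normcN normcM normc_real.
  have c1 := cauchy_schwarz u q; have c2 := cauchy_schwarz u err.
  rewrite nu mul1r in c1; rewrite nu mul1r in c2.
  have dr : `|d i1 - r| <= 2 * e by clear -r1 r2 hi2; rewrite ler_norml; apply/andP; split; lra.
  have : `|d i1 - r| * normc (herm_dot u q) <= 2 * e * herm_norm q.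
    by apply: ler_pM => //; exact: normc_ge0.
  have := le_trans c2 nerr.
  move: (normc (herm_dot u err) : R) (`|d i1 - r| * _) => a b; clear; lra.
rewrite /weak_coupling /= -/q -/h.
have nc : normc h <= normc h * (Num.sqrt n%:R * normc (u j ord0)).
  rewrite ler_peMr ?normc_ge0 // -(@ler_pXn2r _ 2) ?nnegrE ?mulr_ge0 ?sqrtr_ge0 ?normc_ge0 //.
  by rewrite expr1n exprMn sqr_sqrtr // ler0n.
apply: le_trans nc _.
rewrite (_ : normc h * _ = Num.sqrt n%:R * (normc (u j ord0) * normc h)); last by ring.
rewrite [leRHS](_ : _ = Num.sqrt n%:R * (3 * e * herm_norm q)); last by ring.
by rewrite ler_wpM2l // sqrtr_ge0.
Qed.

(** The index [j] is a coordinate at which the top eigenvector is at least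
    [1 / sqrt n]. *)
Lemma close_pair_cover V A (d : 'I_n -> R) (i1 i2 : 'I_n) (e : R) :
  A \is hermsymmx -> diagonalizes V d A -> i1 != i2 -> (forall i, d i <= d i1) ->
  d i1 - e <= d i2 -> 0 < e -> close_pair e A.
Proof.
move=> Ah VdA i12 hi1 hi2 e0.
have n1 : (1 < n)%N.
  rewrite ltnNge; apply/negP => n1; move/eqP: i12; apply; apply/ord_inj.
  have := leq_trans (ltn_ord i1) n1; have := leq_trans (ltn_ord i2) n1.
  by rewrite !ltnS !leqn0 => /eqP -> /eqP ->.
have [j uj] : exists j, 1 <= n%:R * normc (eigvec V i1 j ord0) ^+ 2.
  apply/existsP; rewrite -[X in is_true X]negbK; apply/negP; rewrite negb_exists => /forallP h.
  have := sqn_eigvec VdA i1; rewrite /sqn => s1.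
  have : n%:R * (\sum_j normc (eigvec V i1 j ord0) ^+ 2) < n%:R.
    rewrite mulr_sumr -[ltRHS](_ : \sum_(j < n) 1 = n%:R); last by rewrite sumr_const card_ord.
    apply: ltr_sum; first by apply/hasP; exists i1 => //; exact: mem_index_enum.
    by move=> j _; rewrite ltNge h.
  by rewrite s1 mulr1 ltxx.
rewrite /close_pair (bigD1 j) //=; left.
have [m hm] := exists_near_top j Ah n1 e0.
have : (\bigcup_m near_top j e m) A by exists m.
rewrite seqDU_bigcup_eq => -[k _ hk]; exists k => //; split => //.
by apply: near_top_weak_coupling Ah VdA i12 hi1 hi2 e0 uj _; exact: subset_seqDU hk.
Qed.

End CloseEigenvalues.

(** * The norm of a GUE matrix *)

Section LatticeNet.
Context {R : realType} {n : nat}.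
Local Notation C := R[i].
Import Normc.
Local Open Scope sesquilinear_scope.
Hypothesis n_gt0 : (0 < n)%N.

Let M := (8 * n)%N.
Local Notation net := {ffun 'I_n * bool -> 'I_(M + M).+1}.

(** Integer vectors with coordinates in [-M, M], stored with the offset [M]. *)
Definition net_point (f : net) : 'cV[C]_n :=
  \col_i (((f (i, false) : nat)%:R - M%:R) +i* ((f (i, true) : nat)%:R - M%:R)).

Definition net_dist (k : nat) : nat := ((k - M) + (M - k))%N.

Lemma net_distE k : (net_dist k)%:R ^+ 2 = (k%:R - M%:R) ^+ 2 :> R.
Proof.
rewrite /net_dist; have [kM|kM] := leqP k M.
  by move: (kM); rewrite -subn_eq0 => /eqP ->; rewrite add0n natrB // -sqrrN opprB.
by move: (ltnW kM); rewrite -subn_eq0 => /eqP ->; rewrite addn0 natrB // ltnW.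
Qed.

Definition net_sqn (f : net) : nat := (\sum_t net_dist (f t) ^ 2)%N.

Lemma net_sqnE f : (net_sqn f)%:R = sqn (net_point f) :> R.
Proof.
rewrite /net_sqn natr_sum (eq_bigr (fun p => (net_dist (f (p.1, p.2)) ^ 2)%:R)); last by case.
rewrite -(pair_bigA _ (fun i b => (net_dist (f (i, b)) ^ 2)%:R)) /=.
apply: eq_bigr => i _; rewrite mxE normc_sqr big_bool /= !natrX !net_distE.
by rewrite addrC.
Qed.

(** The exact value, by induction from both ends of the range. *)
Lemma sum_half_dist_le m : \sum_(k < (m + m).+1) (2^-1 : R) ^+ ((k - m) + (m - k)) <= 3 - 2 * 2^-1 ^+ m.
Proof.
elim: m => [|m IH]; first by rewrite big_ord_recl big_ord0 /= !expr0; lra.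
rewrite addSn addnS big_ord_recl big_ord_recr /=.
under eq_bigr do rewrite /bump /= add1n subSS.
have e1 : (bump 0 (m + m).+1 - m.+1 + (m.+1 - bump 0 (m + m).+1))%N = m.+1.
  by rewrite /bump /= add1n subSS; lia.
rewrite e1 sub0n subn0 add0n.
rewrite (eq_bigr (fun k : 'I_(m + m).+1 => (2^-1 : R) ^+ ((k - m) + (m - k)))); last first.
  by move=> k _; congr (_ ^+ _); rewrite /=; lia.
move: IH; set S := \sum_(k < _) _ => IH; rewrite !exprS.
have : 0 <= (2^-1 : R) ^+ m by rewrite exprn_ge0 // invr_ge0.
move: ((2^-1 : R) ^+ m) IH => x; lra.
Qed.

(** Counting by a generating function: each point of the net with squared norm
    at most [L] contributes at least [2 ^- L] to a product of geometric
    sums. *)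
Lemma card_net_le (L : nat) : #|[pred f : net | net_sqn f <= L]%N|%:R <= 2 ^+ L * 9 ^+ n :> R.
Proof.
have p2 k : 0 <= (2^-1 : R) ^+ k by rewrite exprn_ge0 // invr_ge0.
rewrite -sum1_card natr_sum.
apply: (@le_trans _ _ (\sum_(f : net) 2 ^+ L * \prod_t (2^-1 : R) ^+ net_dist (f t))).
  rewrite [leRHS](bigID (fun f => net_sqn f <= L)%N) /= -[leLHS]addr0 lerD //; last first.
    by apply: sumr_ge0 => f _; rewrite mulr_ge0 ?exprn_ge0 // prodr_ge0.
  apply: ler_sum => f fL; rewrite prodrXr.
  have le : (\sum_t net_dist (f t) <= L)%N.
    apply: leq_trans fL; apply: leq_sum => t _.
    by case: (net_dist (f t)) => // k; rewrite expnS expn1 leq_pmulr.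
  by rewrite exprVn ler_pdivlMr ?exprn_gt0 // mul1r ler_weXn2l // ler1n.
rewrite -mulr_sumr ler_wpM2l ?exprn_ge0 //.
rewrite -(bigA_distr_bigA (fun (t : 'I_n * bool) (k : 'I_(M + M).+1) => (2^-1 : R) ^+ net_dist k)) /=.
apply: (@le_trans _ _ (\prod_(t : 'I_n * bool) 3)).
  apply: ler_prod => t _; apply/andP; split; first by apply: sumr_ge0 => k _.
  by apply: le_trans (sum_half_dist_le M) _; rewrite gerBl mulr_ge0.
rewrite prodr_const card_prod card_ord card_bool mulnC exprM (_ : 3 ^+ 2 = 9) //.
by rewrite expr2; ring.
Qed.

(** The net point nearest to [8 * sqrt n] times a unit eigenvector for an
    eigenvalue larger than [60 * sqrt n] has a quadratic form at least [38 * n]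
    times this bound ([large_norm_cover]). *)
Definition net_threshold : R := 38 * n%:R * (60 * Num.sqrt n%:R).

(** The points of squared norm at most [132 * n] suffice: their number is
    exponential in [n], and so is the reciprocal of the tail probability at
    each of them, with a larger rate. *)
Definition large_norm : set (borel_mx R n n) :=
  \big[setU/set0]_(f : net | (net_sqn f <= 132 * n)%N)
    ([set A : 'M[C]_n | net_threshold <= 1 * qform A (net_point f)] `|`
     [set A : 'M[C]_n | net_threshold <= -1 * qform A (net_point f)]).

Lemma measurable_large_norm : measurable large_norm.
Proof.
have mq z s : measurable [set A : borel_mx R n n | net_threshold <= s * qform (A : 'M[C]_n) z].
  apply: measurable_le_set => //; apply: measurable_funM => //.
  exact: (@measurable_qform _ _ (borel_mx R n n) _ id).
by apply: bigsetU_measurable => f _; apply: measurableU; exact: mq.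
Qed.

(** Round [8 * sqrt n] times a top eigenvector to the net. The rounding error
    has squared norm at most [2 * n], so the net point keeps most of its mass
    on this eigenvector, and the other eigenvalues, which are not larger in
    modulus, cannot compensate. *)
Lemma large_norm_cover V A (d : 'I_n -> R) : diagonalizes V d A -> ~ large_norm A ->
  forall i, `|d i| <= 60 * Num.sqrt n%:R.
Proof.
move=> VdA nA i1.
have [i0 hi0] := exists_max_index n_gt0 (fun i => `|d i|).
apply: le_trans (hi0 i1) _; rewrite leNgt; apply/negP => big; apply: nA.
have n0 : 0 < n%:R :> R by rewrite ltr0n.
have n1 : 1 <= n%:R :> R by rewrite ler1n.
pose r := Num.sqrt (n%:R : R); have r0 : 0 < r by rewrite sqrtr_gt0.
have r2 : r ^+ 2 = n%:R by rewrite sqr_sqrtr // ltW.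
have r1 : 1 <= r by rewrite -[leLHS]sqrtr1 ler_wsqrtr.
have rn : r <= n%:R by rewrite -r2 expr2 ler_peMr // ltW.
pose v := eigvec V i0; have v1 : sqn v = 1 := sqn_eigvec VdA i0.
have vi i : normc (v i ord0) <= 1.
  by have := normc_le_herm_norm v i; rewrite herm_normE v1 sqrtr1.
pose w : 'cV[C]_n := (8 * r)%:C *: v.
pose wc (t : 'I_n * bool) : R := if t.2 then complex.Im (w t.1 ord0) else complex.Re (w t.1 ord0).
have wM t : `|wc t| <= M%:R.
  have : `|wc t| <= normc (w t.1 ord0).
    rewrite /wc; case: (t.2); last exact: normc_Re.
    rewrite -(@ler_pXn2r _ 2) ?nnegrE ?normc_ge0 ?normr_ge0 //.
    by rewrite normc_sqr real_normK ?num_real // lerDr sqr_ge0.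
  move=> /le_trans; apply; rewrite mxE normcM normc_real gtr0_norm ?mulr_gt0 //.
  rewrite -[leRHS]mulr1 ler_pM ?normc_ge0 ?mulr_ge0 ?(ltW r0) //.
  by rewrite /M natrM ler_wpM2l.
have wM0 t : 0 <= wc t + M%:R by have := wM t; rewrite ler_norml => /andP[h _]; lra.
pose f : net := [ffun t => inord (Num.truncn (wc t + M%:R))].
have fE t : (f t : nat) = Num.truncn (wc t + M%:R).
  rewrite /f ffunE inordK // ltnS -(ler_nat R) natrD.
  apply: le_trans (_ : _ <= wc t + M%:R) _; first by rewrite truncn_le.
  by rewrite lerD2r (le_trans (ler_norm _)).
have fd t : `|((f t : nat)%:R - M%:R) - wc t| <= 1.
  rewrite fE; have := truncnS_gt (wc t + M%:R).
  have h2 : (Num.truncn (wc t + M%:R))%:R <= wc t + M%:R by rewrite truncn_le.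
  rewrite -natr1 => h1; rewrite ler_norml; apply/andP; split; lra.
pose e : 'cV[C]_n := net_point f - w.
have zE : net_point f = w + e by rewrite /e addrC subrK.
have eE i : e i ord0 = (((f (i, false) : nat)%:R - M%:R) - wc (i, false)) +i*
    (((f (i, true) : nat)%:R - M%:R) - wc (i, true)).
  rewrite /e mxE [net_point f i ord0]mxE [(- w) i ord0]mxE /wc /=.
  by case: (w i ord0) => a b.
have ei i : normc (e i ord0) ^+ 2 <= 2.
  rewrite normc_sqr eE /=; have := fd (i, false); have := fd (i, true).
  move: (_ - _ : R) => a; move: (_ - _ : R) => b ha hb.
  by rewrite -[a ^+ 2]real_normK ?num_real // -[b ^+ 2]real_normK ?num_real //; have := normr_ge0 a; have := normr_ge0 b; nra.
have se : sqn e <= 2 * n%:R.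
  apply: le_trans (ler_sum _ (fun i _ => ei i)) _.
  by rewrite sumr_const card_ord mulr_natr.
pose p : R := complex.Re (herm_dot e v).
have pr : `|p| <= 3 / 2 * r.
  apply: le_trans (normc_Re _) _; apply: le_trans (cauchy_schwarz _ _) _.
  rewrite [herm_norm v]herm_normE v1 sqrtr1 mulr1.
  rewrite -(@ler_pXn2r _ 2) ?nnegrE ?herm_norm_ge0 ?mulr_ge0 ?(ltW r0) //.
  by rewrite sqr_herm_norm exprMn r2; lra.
have sz : sqn (net_point f) = 64 * n%:R + 16 * r * p + sqn e.
  rewrite zE sqnD /w sqnZ v1 normc_real real_normK ?num_real // exprMn r2 mulr1.
  rewrite herm_dotZl ReZ (herm_dotC e v) cRe_conj -/p; ring.
have y0 : (8 * r + p) ^+ 2 <= normc ((V *m net_point f) i0 ord0) ^+ 2.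
  rewrite -(herm_dot_eigvec VdA) zE herm_dotDl /w herm_dotZl herm_dotxx v1 mulr1.
  by rewrite normc_sqr ReD -/p /= lerDl sqr_ge0.
have rp : - (3 / 2 * n%:R) <= r * p /\ r * p <= 3 / 2 * n%:R.
  have h : `|r * p| <= 3 / 2 * n%:R.
    by rewrite normrM gtr0_norm // -r2 expr2 mulrCA ler_wpM2l // ltW.
  by move: h; rewrite ler_norml => /andP[].
have fL : (net_sqn f <= 132 * n)%N.
  by rewrite -(ler_nat R) net_sqnE natrM sz; case: rp => _ h; move: h se; lra.
pose s : R := if 0 <= d i0 then 1 else -1.
have sd0 : s * d i0 = `|d i0|.
  rewrite /s; case: ifPn => [h|]; first by rewrite mul1r ger0_norm.
  by rewrite -ltNge => h; rewrite mulN1r ltr0_norm.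
have sd i : - `|d i0| <= s * d i.
  have h : `|s * d i| <= `|d i0|.
    rewrite normrM (_ : `|s| = 1) ?mul1r ?hi0 //.
    by rewrite /s; case: ifP => _; rewrite ?normrN normr1.
  by move: h; rewrite ler_norml => /andP[].
have big_form : net_threshold <= s * qform A (net_point f).
  rewrite (diag_qform VdA); set y := V *m net_point f in y0 *.
  have sy : sqn y = sqn (net_point f) by rewrite unitary_sqn //; case: VdA.
  have lower : `|d i0| * (2 * normc (y i0 ord0) ^+ 2 - sqn y) <= s * (\sum_i d i * normc (y i ord0) ^+ 2).
    rewrite mulr_sumr (bigD1 i0) //= mulrA sd0.
    have -> : 2 * normc (y i0 ord0) ^+ 2 - sqn y = normc (y i0 ord0) ^+ 2 - \sum_(i | i != i0) normc (y i ord0) ^+ 2.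
      by rewrite /sqn (bigD1 i0) //=; ring.
    rewrite mulrBr lerD2l -mulNr mulr_sumr; apply: ler_sum => i _.
    by rewrite mulrA ler_wpM2r ?sqr_ge0.
  apply: le_trans lower; rewrite /net_threshold mulrC.
  apply: ler_pM; rewrite ?mulr_ge0 ?sqrtr_ge0 ?ler0n //; first exact: ltW.
  rewrite sy sz; case: rp => h1 h2; move: y0 h1 se; rewrite sqrrD exprMn r2.
  have := sqr_ge0 p; rewrite -!mulrA -[8 * _ *+ 2]mulr_natl; move: (normc _ ^+ 2 : R) (p ^+ 2) (sqn e) => a b c; lra.
rewrite /large_norm (bigD1 f) //=; left.
by move: big_form; rewrite /s; case: ifP => _ h; [left|right].
Qed.

Context {dd : measure_display} {T : measurableType dd}.
Variables (P : probability T R) (H : T -> 'M[C]_n).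
Hypothesis HGUE : GUE P H.

Lemma net_point_tail (f : net) (s : R) : s ^+ 2 = 1 -> (net_sqn f <= 132 * n)%N ->
  (P [set w | (net_threshold <= s * qform (H w) (net_point f))%R] <= (expR (- (149 * n%:R)))%:E)%E.
Proof.
move=> s1 fL.
have n0 : 0 < n%:R :> R by rewrite ltr0n.
have r2 : Num.sqrt (n%:R : R) ^+ 2 = n%:R by rewrite sqr_sqrtr // ltW.
have r0 : 0 < Num.sqrt (n%:R : R) by rewrite sqrtr_gt0.
have th0 : 0 < net_threshold by rewrite /net_threshold !mulr_gt0.
have sL : sqn (net_point f) <= 132 * n%:R by rewrite -net_sqnE -natrM ler_nat.
have := sqn_ge0 (net_point f); rewrite le_eqVlt => /orP[/eqP z0|z0].
  rewrite (_ : [set w | _] = set0) ?measure0 ?lee_fin ?expR_ge0 //.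
  apply/seteqP; split => // w /=; rewrite qform_sqn0 // mulr0.
  by rewrite leNgt th0.
apply: le_trans (qform_tail HGUE z0 s1 (ltW th0)) _.
rewrite lee_fin ler_expR lerN2 ler_pdivlMr ?mulr_gt0 ?exprn_gt0 //.
have h2 : sqn (net_point f) ^+ 2 <= (132 * n%:R) ^+ 2.
  by rewrite lerXn2r ?nnegrE ?sqn_ge0 // mulr_ge0 // ler0n.
rewrite /net_threshold.
(* The constants fit as [38 * 60 = 190 / 11 * 132] and
   [2 * 149 = 298 < (190 / 11) ^ 2]. *)
have -> : 38 * n%:R * (60 * Num.sqrt n%:R) = 190 / 11 * (132 * n%:R) * Num.sqrt n%:R :> R by field.
rewrite exprMn r2 [(190 / 11 * _) ^+ 2]exprMn.
apply: (@le_trans _ _ (298 * (132 * n%:R) ^+ 2 * n%:R)).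
  rewrite [leLHS](_ : _ = 298 * sqn (net_point f) ^+ 2 * n%:R); last by ring.
  rewrite ler_pM2r; last exact: n0.
  by rewrite ler_pM2l; [exact: h2|rewrite ltr0n].
rewrite ler_pM2r // ler_wpM2r ?sqr_ge0 //; lra.
Qed.

(** The [2 ^ (132 * n) * 9 ^ n <= exp (136 * n)] points of the net have tails
    at most [exp (- 149 * n)] each, for both signs. *)
Lemma large_norm_le : (P [set w | large_norm (H w)] <= (2 * expR (- (13 * n%:R)))%:E)%E.
Proof.
have mH : measurable_fun [set: T] (H : T -> borel_mx R n n) := proj1 (GUE_quasi_invariant HGUE).
pose Y (f : net) s := [set w | net_threshold <= s * qform (H w) (net_point f)].
have mY f s : measurable (Y f s).
  apply: measurable_le_set => //; apply: measurable_funM => //.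
  exact: measurable_qform.
have -> : [set w | large_norm (H w)] = \big[setU/set0]_(f : net | (net_sqn f <= 132 * n)%N) (Y f 1%R `|` Y f (- 1)%R).
  by rewrite /large_norm; elim/big_ind2: _ => // A A' B B' <- <-.
have [] : measurable (\big[setU/set0]_(f : net | (net_sqn f <= 132 * n)%N) (Y f 1%R `|` Y f (- 1)%R)) /\
    (P (\big[setU/set0]_(f : net | (net_sqn f <= 132 * n)%N) (Y f 1%R `|` Y f (- 1)%R)) <=
      (\sum_(f : net | (net_sqn f <= 132 * n)%N) (expR (- (149 * n%:R)) + expR (- (149 * n%:R))))%:E)%E.
  apply: (big_ind2 (fun (A : set T) (y : R) => measurable A /\ (P A <= y%:E)%E)).
  - by rewrite measure0; split.
  - move=> A a B b [mA Aa] [mB Bb]; split; first exact: measurableU.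
    by apply: le_trans (measureU2 _ _ _) _ => //; rewrite EFinD; exact: leeD.
  - move=> f fL; split; first exact: measurableU.
    apply: le_trans (measureU2 _ _ _) _ => //; rewrite EFinD; apply: leeD; apply: net_point_tail => //.
      by rewrite expr1n.
    by rewrite sqrrN expr1n.
move=> _ /le_trans; apply; rewrite lee_fin sumr_const -[leLHS]mulr_natr.
have e0 x : 0 <= expR x :> R := expR_ge0 x.
apply: le_trans (_ : (expR (- (149 * n%:R)) + expR (- (149 * n%:R))) * (2 ^+ (132 * n) * 9 ^+ n) <= _).
  by rewrite ler_wpM2l ?addr_ge0 //; exact: card_net_le.
have e1 : 2 <= expR 1 :> R by have := expR_ge1Dx (1 : R); lra.
have c1 : 2 ^+ (132 * n) * 9 ^+ n <= expR (136 * n%:R) :> R.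
  apply: (@le_trans _ _ (2 ^+ (136 * n))).
    have -> : (136 * n = 132 * n + 4 * n)%N by rewrite -mulnDl.
    rewrite [leRHS]exprD ler_wpM2l ?exprn_ge0 //.
    by rewrite [leRHS]exprM lerXn2r ?nnegrE // !exprS expr0; lra.
  rewrite -natrM -[X in expR X]mulr1 expRM_natl lerXn2r ?nnegrE //.
apply: le_trans (_ : (expR (- (149 * n%:R)) + expR (- (149 * n%:R))) * expR (136 * n%:R) <= _).
  by rewrite ler_wpM2l ?addr_ge0.
rewrite mulrDl -expRD (_ : - (149 * n%:R) + 136 * n%:R = - (13 * n%:R)); last by ring.
lra.
Qed.

End LatticeNet.

(** * Dyadic scales *)

Section DyadicLevels.
Context {dd : measure_display} {T : measurableType dd} {R : realType}.
Variables (P : probability T R) (J : nat) (D : nat -> set T).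

(** Off [D J] this bounds the reciprocal of the first scale [2 ^- j] whose
    event [D j] does not occur. *)
Definition inverse_scale (w : T) : R :=
  1 + \sum_(j < J) 2 ^+ j.+1 * \1_(D j) w.

Lemma inverse_scale_ge0 w : 0 <= inverse_scale w.
Proof.
by rewrite addr_ge0 // sumr_ge0 // => j _; rewrite mulr_ge0 ?exprn_ge0 // indicE.
Qed.

(** If the first scale that fails is [j.+1], then [D j] occurs and its term
    alone is [2 ^+ j.+1]. *)
Lemma inverse_scaleP w : ~ D J w ->
  exists2 j, ~ D j w & 2 ^+ j <= inverse_scale w.
Proof.
move=> nD; have ex : exists j, `[<~ D j w>] by exists J; apply/asboolP.
case: (ex_minnP ex) => j /asboolP nj jmin; exists j => //.
have jJ : (j <= J)%N by apply: jmin; apply/asboolP.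
have s0 (k : 'I_J) : 0 <= 2 ^+ k.+1 * \1_(D k) w :> R.
  by rewrite mulr_ge0 ?exprn_ge0 // indicE.
case: j nj jmin jJ => [|j] nj jmin jJ; first by rewrite expr0 lerDl sumr_ge0.
have Dj : D j w.
  by apply: contrapT => h; have := jmin j (introT (asboolP _) h); rewrite ltnn.
rewrite /inverse_scale (bigD1 (Ordinal jJ)) //= indicE mem_set // mulr1.
by rewrite addrCA lerDl addr_ge0 // sumr_ge0.
Qed.

Hypothesis mD : forall j, measurable (D j).

Lemma measurable_inverse_scale : measurable_fun [set: T] (fun w => (inverse_scale w)%:E).
Proof.
apply/measurable_EFinP; apply: measurable_funD => //.
apply: measurable_sum => j; apply: measurable_funM => //; exact: measurable_indic.
Qed.

Lemma integral_inverse_scale_le (p : nat -> R) : (forall j, (P (D j) <= (p j)%:E)%E) ->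
  (\int[P]_w (inverse_scale w)%:E <= (1 + \sum_(j < J) 2 ^+ j.+1 * p j)%:E)%E.
Proof.
move=> Dp; have mi j : measurable_fun [set: T] (fun w => (\1_(D j) w : R)%:E).
  by apply/measurable_EFinP; exact: measurable_indic.
have i0 j w : (0 <= (\1_(D j) w : R)%:E)%E by rewrite lee_fin indicE.
have c0 j : (0 <= (2 ^+ j.+1 : R)%:E)%E by rewrite lee_fin exprn_ge0.
under eq_integral do rewrite EFinD -sumEFin.
under eq_integral do under eq_bigr do rewrite EFinM.
have ms : measurable_fun [set: T] (fun w => (\sum_(j < J) (2 ^+ j.+1 : R)%:E * (\1_(D j) w)%:E)%E).
  by apply: emeasurable_sum => j; apply: emeasurable_funM.
rewrite ge0_integralD //; last first.
  by move=> w _; apply: sume_ge0 => j _; exact: mule_ge0.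
have -> : (\int[P]__ 1 = 1)%E.
  transitivity (1%:E * P [set: T])%E; last by rewrite probability_setT mule1.
  exact: integral_cst.
rewrite EFinD leeD2l //.
rewrite ge0_integral_sum //; last by move=> j; apply: emeasurable_funM.
rewrite -sumEFin; apply: lee_sum => j _; rewrite ge0_integralZl //.
rewrite integral_indic // setIT EFinM.
exact: lee_wpmul2l (c0 j) _ _ (Dp j).
Qed.

End DyadicLevels.

(** * Expected cost off the exceptional set *)

Section SeparatedSpectrum.
Context {R : realType} {n : nat}.
Implicit Types (d : 'I_n -> R) (o s L : R).

(** The case of a dominant eigenvalue at the upper end; the other one follows
    by changing signs. An eigenvalue different from both extremes is separated
    in modulus from [d i1] by the two gaps [s], the one at the lower end
    because [- d i2 < d i1]. *)
Lemma extreme_gaps_le d i1 i2 o s L :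
  0 < o -> 0 < s -> 0 < L ->
  (forall i, `|d i| <= L) -> o < d i1 + d i2 -> (forall i, d i <= d i1) -> (forall i, d i2 <= d i) ->
  (forall i, i != i1 -> d i < d i1 - s) -> (forall i, i != i2 -> d i2 + s < d i) ->
  [/\ 0 < `|d i1|,
      i2 != i1 -> `|d i2| <= (1 - Num.min o s / L) * `|d i1|
    & forall i, i != i1 -> i != i2 -> `|d i| <= (1 - s / L) * `|d i1| ].
Proof.
move=> o0 s0 L0 dL oo h1 h2 g1 g2.
have d1 : 0 < d i1 by have := h1 i2; lra.
have a1 : `|d i1| = d i1 by rewrite gtr0_norm.
have key (t x : R) : 0 < t -> `|x| <= d i1 - t -> `|x| <= (1 - t / L) * d i1.
  move=> t0 /le_trans; apply; rewrite mulrBl mul1r lerD2l lerN2.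
  rewrite -[leRHS]mulr1 -mulrA ler_wpM2l ?(ltW t0) // mulrC ler_pdivrMr // mul1r.
  by have := dL i1; rewrite a1.
rewrite a1; split => // [i21|i i1' i2'].
  apply: key; first by rewrite lt_min o0.
  have := g1 _ i21; have : Num.min o s <= o by rewrite ge_min lexx.
  have : Num.min o s <= s by rewrite ge_min lexx orbT.
  by rewrite ler_norml; lra.
apply: key => //; have := g1 _ i1'; have := g2 _ i2'; rewrite ler_norml; lra.
Qed.

End SeparatedSpectrum.

Definition angle_cost {R : realType} (alpha : R) : R := 2 + ln (6 * (Num.sqrt 2 * cot alpha)).

Section PowerIterationOffExceptionalSet.
Context {R : realType} {n : nat}.
Local Notation C := R[i].
Hypothesis n_gt0 : (0 < n)%N.
Variables (alpha : R) (nu : probability (borel_mx R n 1) R) (u1 : 'M[C]_n -> 'cV[C]_n).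
Hypotheses (alpha_gt0 : 0 < alpha) (alpha_lt : alpha < pi / 4).
Hypotheses (nu_unif : uniform_projective nu) (u1_dom : dominant_choice u1).

Let L : R := 60 * Num.sqrt n%:R.
Local Notation b2 := (angle_cost alpha).
Let b3 : R := 2 + ln (n%:R * (6 * (Num.sqrt 2 * cot alpha * Num.sqrt n%:R))).

Lemma sqrt2cot_gt1 : 1 < Num.sqrt 2 * cot alpha.
Proof.
have h : 1 < Num.sqrt 2 :> R by rewrite -[X in X < _]sqrtr1 ltr_sqrt // ltr1n.
by apply: lt_le_trans h _; rewrite ler_peMr ?sqrtr_ge0 // ltW // cot_gt1.
Qed.

Lemma sqrtn_ge1 : 1 <= Num.sqrt n%:R :> R.
Proof. by rewrite -[X in X <= _]sqrtr1 ler_sqrt ?ler0n // ler1n. Qed.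

Lemma angle_cost_ge0 : 0 <= b2.
Proof. by rewrite addr_ge0 // ln_ge0 //; have := sqrt2cot_gt1; lra. Qed.

Lemma b3_ge0 : 0 <= b3.
Proof.
have a1 := ltW sqrt2cot_gt1.
rewrite addr_ge0 // ln_ge0 // mulr_ege1 ?ler1n // mulr_ege1 ?ler1n //.
by rewrite mulr_ege1 // sqrtn_ge1.
Qed.

(** The logarithm of [n] costs at most a factor [sqrt n], which the expectation
    of the reciprocal of the same-end gaps leaves room for. *)
Lemma b3_le : b3 <= b2 + 3 * Num.sqrt n%:R.
Proof.
have s1 := sqrtn_ge1; have s0 : 0 < Num.sqrt n%:R :> R by exact: lt_le_trans s1.
have a1 := sqrt2cot_gt1; have a0 : 0 < Num.sqrt 2 * cot alpha by exact: lt_trans a1.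
rewrite /b3 /angle_cost -[leRHS]addrA lerD2l.
have -> : n%:R * (6 * (Num.sqrt 2 * cot alpha * Num.sqrt n%:R)) =
    6 * (Num.sqrt 2 * cot alpha) * Num.sqrt n%:R ^+ 3.
  by rewrite -[X in X * (6 * _)](@sqr_sqrtr R) ?ler0n //; ring.
have c0 : 0 < 6 * (Num.sqrt 2 * cot alpha) by rewrite mulr_gt0.
rewrite lnM ?posrE ?exprn_gt0 // lerD2l lnXn // -[X in X <= _]mulr_natl ler_wpM2l //.
by apply: ltW; exact: ln_sublinear.
Qed.

(** The gaps are compared with the modulus of the dominant eigenvalue, which is
    at most [L]; as the scales are at most 1, the relative gaps are. *)
Lemma rho_le_scales A (o s : R) : A \is hermsymmx ->
  0 < o -> o <= 1 -> 0 < s -> s <= 1 ->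
  ~ large_norm A -> ~ small_opposite_gap n_gt0 o A -> ~ close_pair s A -> ~ close_pair s (- A) ->
  (rho nu u1 alpha A <= (L * b2 * o^-1 + L * (b2 + b3) * s^-1)%:E)%E.
Proof.
move=> Ah o0 o1 s0 s1 nL nO nT nB.
have [V [d VdA]] := hermitian_diagonalizes Ah.
have VdN := diagonalizes_opp VdA.
have dL := large_norm_cover n_gt0 VdA nL.
have [i1 h1] := exists_max_index n_gt0 d.
have [i2 h2'] := exists_max_index n_gt0 (fun i => - d i).
have h2 i : d i2 <= d i by have := h2' i; rewrite lerN2.
have og : o < `|d i1 + d i2|.
  rewrite ltNge; apply/negP => h; apply: nO.
  by rewrite /small_opposite_gap /= /opposite_gap (lmax_diag n_gt0 VdA h1) (lmax_diag n_gt0 VdN h2') opprK.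
have g1 i : i != i1 -> d i < d i1 - s.
  rewrite eq_sym => ii; rewrite ltNge; apply/negP => h.
  by apply: nT; exact: close_pair_cover Ah VdA ii h1 h s0.
have g2 i : i != i2 -> d i2 + s < d i.
  rewrite eq_sym => ii; rewrite ltNge; apply/negP => h; apply: nB.
  by apply: (close_pair_cover (hermsymmxN Ah) VdN ii h2') => //; lra.
have n1 := sqrtn_ge1; have L0 : 0 < L by rewrite /L; lra.
have L1 : 1 <= L by rewrite /L; lra.
have ms : Num.min o s <= 1 by rewrite ge_min o1.
have m0 : 0 < Num.min o s by rewrite lt_min o0.
have [i0 [i3 [d0 d2 d3]]] : exists i0 i3, [/\ 0 < `|d i0|,
    i3 != i0 -> `|d i3| <= (1 - Num.min o s / L) * `|d i0|
    & forall i, i != i0 -> i != i3 -> `|d i| <= (1 - s / L) * `|d i0| ].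
  have [p|p] := lerP 0 (d i1 + d i2).
    exists i1, i2; apply: (@extreme_gaps_le _ _ d _ _ o s L) => //.
    by move: og; rewrite ger0_norm.
  exists i2, i1; rewrite -normrN -[`|d i1|]normrN.
  have [] := @extreme_gaps_le _ _ (fun i => - d i) i2 i1 o s L o0 s0 L0 => //.
  - by move=> i; rewrite normrN.
  - by move: og; rewrite ltr0_norm // opprD addrC.
  - by move=> i; rewrite lerN2.
  - by move=> i /g2; lra.
  - by move=> i /g1; lra.
  by move=> ? ? h; split => // i; rewrite -(normrN (d i)); exact: h.
have u x : x <= 1 -> x / L <= 1 by move=> x1; rewrite ler_pdivrMr // mul1r (le_trans x1).
have [Vu _] := VdA.
have := @rho_le_gaps R n nu nu_unif V i0 Vu A d i3 u1 alpha (Num.min o s / L) (s / L).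
move=> /(_ VdA (u1_dom Ah) alpha_gt0 alpha_lt) /(_ (divr_gt0 m0 L0) (u _ ms)).
move=> /(_ (divr_gt0 s0 L0) (u _ s1) d0 d2 d3) /le_trans; apply.
rewrite lee_fin -/b3 -/(angle_cost alpha) !invf_div.
have mm : (Num.min o s)^-1 <= o^-1 + s^-1.
  by case: (leP o s) => _; rewrite ?lerDl ?lerDr invr_ge0 ltW.
have b20 := angle_cost_ge0.
have : b2 * (L / Num.min o s) <= b2 * L * (o^-1 + s^-1).
  by rewrite mulrA ler_wpM2l // mulr_ge0 // ltW.
move: (o^-1) (s^-1) => x y h.
apply: (@le_trans _ _ (b2 * L * (x + y) + b3 * (L * y))); first by rewrite lerD2r.
by rewrite le_eqVlt; apply/orP; left; apply/eqP; ring.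
Qed.

Definition opposite_level (j : nat) : set (borel_mx R n n) :=
  small_opposite_gap n_gt0 (2^-1 ^+ j).

(** The scales are divided by [n], as the probability of a close pair is of
    order [n ^ 2 * e ^ 2]. *)
Definition close_level (j : nat) : set (borel_mx R n n) :=
  close_pair (2^-1 ^+ j / n%:R) `|` [set A : 'M[C]_n | close_pair (2^-1 ^+ j / n%:R) (- A)].

(** The smallest scale [2 ^- (12 * n)] makes the probability smaller than
    [exp (- n)], and leaves [12 * n] scales. *)
Definition exceptional : set (borel_mx R n n) :=
  large_norm `|` opposite_level (12 * n) `|` close_level (12 * n).

Lemma measurable_close_level j : measurable (close_level j).
Proof.
apply: measurableU; first exact: measurable_close_pair.
rewrite -[X in measurable X]setTI; apply: measurable_oppmx => //.
exact: measurable_close_pair.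
Qed.

Lemma measurable_exceptional : measurable exceptional.
Proof.
apply: measurableU (measurable_close_level _); apply: measurableU.
  exact: measurable_large_norm.
exact: measurable_small_opposite_gap.
Qed.

Context {dd : measure_display} {T : measurableType dd}.
Variables (P : probability T R) (H : T -> 'M[C]_n).
Hypothesis HGUE : GUE P H.

Let mH : measurable_fun [set: T] (H : T -> borel_mx R n n) := proj1 (GUE_quasi_invariant HGUE).

Let mpre (A : set (borel_mx R n n)) : measurable A -> measurable [set w | A (H w)].
Proof. exact: measurable_preimage_mx. Qed.

Let opposite_event j : set T := [set w | opposite_level j (H w)].
Let close_event j : set T := [set w | close_level j (H w)].

Let half_gt0 j : 0 < 2^-1 ^+ j :> R. Proof. by rewrite exprn_gt0. Qed.

Let half_le1 j : 2^-1 ^+ j <= 1 :> R. Proof. by rewrite exprn_ile1 // invf_le1 // ler1n. Qed.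

Let n0 : 0 < n%:R :> R. Proof. by rewrite ltr0n. Qed.

Lemma opposite_event_le j : (P (opposite_event j) <= (4 * 2^-1 ^+ j * Num.sqrt n%:R)%:E)%E.
Proof. by apply: small_opposite_gap_le (half_gt0 j); exact: GUE_quasi_invariant. Qed.

Lemma close_event_le j : (P (close_event j) <= (2916 * (2^-1 ^+ j) ^+ 2)%:E)%E.
Proof.
have e0 : 0 < 2^-1 ^+ j / n%:R :> R by rewrite divr_gt0.
have qi := GUE_quasi_invariant HGUE.
apply: le_trans (measureU2 _ _ _) _.
- exact: mpre (measurable_close_pair _).
- rewrite -[X in measurable X]setTI; apply: (measurableT_comp measurable_oppmx mH) => //.
  exact: measurable_close_pair.
apply: le_trans (leeD (close_pair_le qi e0) (close_pair_le (quasi_invariantN qi) e0)) _.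
rewrite -EFinD lee_fin expr_div_n le_eqVlt; apply/orP; left; apply/eqP.
by field; rewrite gt_eqF.
Qed.

Lemma rho_le_inverse_scales w : ~ exceptional (H w) ->
  (rho nu u1 alpha (H w) <=
    (L * b2 * inverse_scale (12 * n) opposite_event w +
     L * (b2 + b3) * n%:R * inverse_scale (12 * n) close_event w)%:E)%E.
Proof.
move=> nE.
have [nL nO nC] : [/\ ~ large_norm (H w), ~ opposite_event (12 * n) w & ~ close_event (12 * n) w].
  by split => h; apply: nE; [left; left|left; right|right].
have [j nj hj] := inverse_scaleP (R := R) nO.
have [k nk hk] := inverse_scaleP (R := R) nC.
have Hh : H w \is hermsymmx by case: HGUE => G _ ->; exact: hermitian_part_sym.
have s0 : 0 < 2^-1 ^+ k / n%:R :> R by rewrite divr_gt0.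
have s1 : 2^-1 ^+ k / n%:R <= 1 :> R.
  by rewrite ler_pdivrMr // mul1r (le_trans (half_le1 k)) // ler1n.
apply: le_trans (rho_le_scales Hh (half_gt0 j) (half_le1 j) s0 s1 nL nj _ _) _.
- by move=> h; apply: nk; left.
- by move=> h; apply: nk; right.
have b20 := angle_cost_ge0; have L0 : 0 <= L by rewrite /L mulr_ge0 // sqrtr_ge0.
have b30 := b3_ge0.
rewrite lee_fin; apply: lerD.
  by rewrite -exprVn invrK ler_wpM2l // mulr_ge0.
have c0 : 0 <= L * (b2 + b3) by apply: mulr_ge0 => //; exact: addr_ge0.
rewrite invf_div -exprVn invrK -[leRHS]mulrA; apply: ler_wpM2l => //.
by rewrite ler_wpM2l // ltW.
Qed.

Definition cost_constant : R := 60 * (97 * b2 + 11665 * (2 * b2 + 3)).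

Lemma cost_constant_gt0 : 0 < cost_constant.
Proof. by rewrite /cost_constant; have := angle_cost_ge0; lra. Qed.

(** Each of the [12 * n] scales of the opposite gap contributes [8 * sqrt n];
    the scales of the close pairs contribute a geometric series. *)
Lemma integral_rho_le :
  (\int[P]_(w in ~` [set w | exceptional (H w)]) rho nu u1 alpha (H w) <=
   (cost_constant * n%:R ^+ 2)%:E)%E.
Proof.
pose X := inverse_scale (R := R) (12 * n) opposite_event.
pose Y := inverse_scale (R := R) (12 * n) close_event.
have mO j : measurable (opposite_event j) := mpre (measurable_small_opposite_gap _ _).
have mC j : measurable (close_event j) := mpre (measurable_close_level j).
have mX : measurable_fun [set: T] (fun w => (X w)%:E) by exact: measurable_inverse_scale.
have mY : measurable_fun [set: T] (fun w => (Y w)%:E) by exact: measurable_inverse_scale.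
have b20 := angle_cost_ge0; have b3b := b3_le; have r1 := sqrtn_ge1.
have b30 := b3_ge0.
have L0 : 0 <= L by rewrite /L mulr_ge0 // sqrtr_ge0.
have X0 w : 0 <= X w := inverse_scale_ge0 _ _ _.
have Y0 w : 0 <= Y w := inverse_scale_ge0 _ _ _.
pose a1 : R := L * b2; pose a2 : R := L * (b2 + b3) * n%:R.
have a10 : 0 <= a1 by rewrite mulr_ge0.
have a20 : 0 <= a2 by apply: mulr_ge0 (ltW n0); apply: mulr_ge0 => //; exact: addr_ge0.
have mE : measurable (~` [set w | exceptional (H w)]).
  by apply: measurableC; exact: mpre measurable_exceptional.
have ma1 : measurable_fun [set: T] (fun w => a1%:E * (X w)%:E)%E by exact: emeasurable_funM.
have ma2 : measurable_fun [set: T] (fun w => a2%:E * (Y w)%:E)%E by exact: emeasurable_funM.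
apply: (@le_trans _ _ (\int[P]_(w in ~` [set w | exceptional (H w)]) (a1%:E * (X w)%:E + a2%:E * (Y w)%:E)%E)%E).
  apply: ge0_le_lower_integral => w nE.
    apply: integral_ge0 => x _; apply: le_ereal_inf_tmp => _ [k _ <-].
    by rewrite lee_fin.
  by rewrite -!EFinM -EFinD; exact: rho_le_inverse_scales.
apply: (@le_trans _ _ (\int[P]_w (a1%:E * (X w)%:E + a2%:E * (Y w)%:E)%E)%E).
  apply: ge0_subset_integral => //; first exact: emeasurable_funD.
  by move=> w _; rewrite adde_ge0 // mule_ge0 ?lee_fin.
rewrite ge0_integralD //; last 2 first.
- by move=> w _; rewrite mule_ge0 ?lee_fin.
- by move=> w _; rewrite mule_ge0 ?lee_fin.
rewrite !ge0_integralZl ?lee_fin //; last 2 first.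
- by move=> w _; rewrite lee_fin.
- by move=> w _; rewrite lee_fin.
have iX := integral_inverse_scale_le (12 * n) mO opposite_event_le.
have iY := integral_inverse_scale_le (12 * n) mC close_event_le.
apply: le_trans (leeD (lee_wpmul2l _ iX) (lee_wpmul2l _ iY)) _; rewrite ?lee_fin //.
set r := Num.sqrt n%:R in r1 b3b *.
have rr : r ^+ 2 = n%:R by rewrite sqr_sqrtr // ltW.
have sX : 1 + \sum_(j < 12 * n) 2 ^+ j.+1 * (4 * 2^-1 ^+ j * r) <= 97 * (n%:R * r).
  under eq_bigr => j _.
    rewrite (_ : _ * _ = 8 * r); last first.
      by rewrite exprS exprVn; field; rewrite expf_neq0.
    over.
  rewrite sumr_const card_ord -[X in 1 + X]mulr_natr natrM.
  have : 1 <= n%:R * r by rewrite mulr_ege1 // ler1n.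
  lra.
have sY : 1 + \sum_(j < 12 * n) 2 ^+ j.+1 * (2916 * (2^-1 ^+ j) ^+ 2) <= 11665 :> R.
  have h := @sum_geometric_le R 2^-1 (12 * n).
  have {}h : \sum_(j < 12 * n) (2^-1 : R) ^+ j <= 2.
    have /h : 0 < 2^-1 :> R by [].
    rewrite invf_le1 // ler1n => /(_ isT); rewrite big_mkord invrK.
    by rewrite (_ : 1 - 2^-1 = 2^-1 :> R) //; lra.
  under eq_bigr => j _.
    rewrite (_ : _ * _ = 5832 * 2^-1 ^+ j); last first.
      by rewrite exprS exprVn; field; rewrite expf_neq0.
    over.
  rewrite -mulr_sumr; lra.
apply: le_trans (lerD (ler_wpM2l a10 sX) (ler_wpM2l a20 sY)) _.
have a2b : a2 <= 60 * r * (2 * b2 + 3 * r) * n%:R.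
  by rewrite /a2 /L -/r ler_wpM2r ?(ltW n0) // ler_wpM2l //; lra.
have w0 : 0 < 11665 :> R by rewrite ltr0n.
rewrite /cost_constant; move: (11665 : R) w0 => w w0.
apply: le_trans (lerD (lexx _) (ler_wpM2r (ltW w0) a2b)) _.
rewrite /a1 /L -/r -rr.
have r3 : r ^+ 3 <= r ^+ 4 by rewrite ler_weXn2l.
rewrite [leLHS](_ : _ = 60 * (97 * b2 * r ^+ 4 + w * (2 * b2 * r ^+ 3 + 3 * r ^+ 4))); last by ring.
rewrite [leRHS](_ : _ = 60 * (97 * b2 * r ^+ 4 + w * (2 * b2 * r ^+ 4 + 3 * r ^+ 4))); last by ring.
rewrite ler_pM2l // lerD2l ler_pM2l // lerD2r ler_wpM2l // mulr_ge0 //.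
Qed.

(** All three parts are compared with powers of [t = 2 ^- n], using
    [exp (- n) >= 4 ^- n = t ^ 2]. *)
Lemma exceptional_le : (P [set w | exceptional (H w)] <= (expR (- n%:R))%:E)%E.
Proof.
have mO j : measurable (opposite_event j) := mpre (measurable_small_opposite_gap _ _).
have mC j : measurable (close_event j) := mpre (measurable_close_level j).
have mN : measurable [set w | large_norm (H w)] := mpre (measurable_large_norm).
apply: le_trans (measureU2 _ (measurableU _ _ mN (mO _)) (mC _)) _.
apply: le_trans (leeD (measureU2 _ mN (mO _)) (lexx _)) _.
apply: le_trans (leeD (leeD (large_norm_le n_gt0 HGUE) (opposite_event_le _)) (close_event_le _)) _.
rewrite -!EFinD lee_fin.
pose t : R := 2^-1 ^+ n.
have t0 : 0 < t := half_gt0 n.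
have th : t <= 2^-1.
  by rewrite /t -[leRHS]expr1; apply: ler_wiXn2l => //; rewrite ?invr_ge0 // invf_le1 // ler1n.
have e1 : 2 <= expR 1 :> R by have := expR_ge1Dx (1 : R); lra.
have e4 : expR 1 <= 4 :> R.
  have h : 2^-1 <= expR (- 2^-1) :> R by have := expR_ge1Dx (- 2^-1 : R); lra.
  have h2 : expR 2^-1 <= 2 :> R.
    by move: h; rewrite expRN lef_pV2 ?posrE ?expR_gt0.
  rewrite (_ : 1 = 2^-1 + 2^-1 :> R); last lra.
  by rewrite expRD; have := expR_ge0 (2^-1 : R); nra.
have eN : expR (- n%:R) = (expR 1)^-1 ^+ n :> R.
  by rewrite expRN exprVn -expRM_natl mulr1.
have et : t ^+ 2 <= expR (- n%:R).
  rewrite eN /t -exprM mulnC exprM lerXn2r ?nnegrE ?invr_ge0 ?expR_ge0 //.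
  by rewrite expr2 -invfM lef_pV2 ?posrE ?expR_gt0 //; lra.
have e13 : expR (- (13 * n%:R)) <= t ^+ 13 :> R.
  rewrite -mulrN expRM_natl eN /t lerXn2r ?nnegrE ?exprn_ge0 ?invr_ge0 ?expR_ge0 //.
  by rewrite lerXn2r ?nnegrE ?invr_ge0 ?expR_ge0 // lef_pV2 ?posrE ?expR_gt0.
have rt : Num.sqrt n%:R * t <= 1.
  rewrite /t exprVn ler_pdivrMr ?exprn_gt0 // mul1r.
  apply: (@le_trans _ _ n%:R); last by rewrite -natrX ler_nat ltnW // ltn_expl.
  rewrite -[leRHS](@sqr_sqrtr R) ?ler0n // expr2 ler_peMr ?sqrtr_ge0 //.
  exact: sqrtn_ge1.
have -> : 2^-1 ^+ (12 * n) = t ^+ 12 :> R by rewrite mulnC exprM.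
set v := t ^+ 7; have v0 : 0 <= v by rewrite exprn_ge0 // ltW.
have t1 : t <= 1 by lra.
have vh : v <= 128^-1.
  apply: (@le_trans _ _ (2^-1 ^+ 7)); first by rewrite lerXn2r ?nnegrE // ltW.
  by rewrite exprVn lef_pV2 ?posrE ?exprn_gt0 // !exprS expr0; lra.
have h13 : t ^+ 13 <= v * t ^+ 2.
  by rewrite /v -exprD ler_wiXn2l // ltW.
have h12 : 4 * t ^+ 12 * Num.sqrt n%:R <= 4 * (v * t ^+ 2).
  rewrite -mulrA ler_pM2l // exprSr -mulrA (mulrC t) .
  apply: (@le_trans _ _ (t ^+ 11 * 1)); first by rewrite ler_wpM2l // exprn_ge0 // ltW.
  by rewrite mulr1 /v -exprD ler_wiXn2l // ltW.
have h24 : (t ^+ 12) ^+ 2 <= v * (128^-1 * t ^+ 2).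
  rewrite -exprM; apply: (@le_trans _ _ (v * (v * t ^+ 2))).
    by rewrite /v -!exprD ler_wiXn2l // ltW.
  by rewrite ler_wpM2l // ler_wpM2r // sqr_ge0.
have vt : v * t ^+ 2 <= 128^-1 * t ^+ 2 by rewrite ler_wpM2r // sqr_ge0.
move: h24; rewrite mulrCA => h24; move: (v * t ^+ 2) (t ^+ 2) (sqr_ge0 t) vt h24 h12 h13 et e13 => a b.
lra.
Qed.

End PowerIterationOffExceptionalSet.

Lemma expRN_natr_lt1 {R : realType} (n : nat) : (0 < n)%N -> expR (- n%:R) < 1 :> R.
Proof. by move=> n_gt0; rewrite -[ltRHS]expR0 ltr_expR oppr_lt0 ltr0n. Qed.

Section ConditionalCost.
Context {R : realType} {n : nat}.
Local Notation C := R[i].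
Variables (n_gt0 : (0 < n)%N) (alpha : R).
Hypotheses (alpha_gt0 : 0 < alpha) (alpha_lt : alpha < pi / 4).
Variables (nu : probability (borel_mx R n 1) R) (u1 : 'M[C]_n -> 'cV[C]_n).
Hypotheses (nu_unif : uniform_projective nu) (u1_dom : dominant_choice u1).
Context {dd : measure_display} {T : measurableType dd}.
Variables (P : probability T R) (H : T -> 'M[C]_n).
Hypothesis HGUE : GUE P H.

Let E : set T := H @^-1` exceptional n_gt0.

Lemma measurable_exceptional_event : measurable E.
Proof.
rewrite -[X in measurable X]setTI; apply: (proj1 (GUE_quasi_invariant HGUE)) => //.
exact: measurable_exceptional.
Qed.

Lemma cond_cost_ge0 : (0 <= cond_expectation P (fun w => rho nu u1 alpha (H w)) (~` E))%E.
Proof.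
rewrite /cond_expectation mule_ge0 ?lee_fin ?invr_ge0 ?fine_ge0 //.
apply: integral_ge0 => w _; apply: integral_ge0 => x _.
by apply: le_ereal_inf_tmp => _ [k _ <-]; rewrite lee_fin.
Qed.

Lemma cond_cost_le :
  (cond_expectation P (fun w => rho nu u1 alpha (H w)) (~` E) <=
   (cost_constant alpha * n%:R ^+ 2 / (1 - expR (- n%:R)))%:E)%E.
Proof.
have mE := measurable_exceptional_event.
have e1 := @expRN_natr_lt1 R n n_gt0.
have := exceptional_le n_gt0 HGUE; rewrite -[X in P X]/E => PE.
have c1 : 1 - expR (- n%:R) <= fine (P (~` E)).
  rewrite probability_setC // fineB ?fin_num_measure //= lerD2l lerN2.
  by rewrite -lee_fin fineK // fin_num_measure.
have c0 : 0 < 1 - expR (- n%:R) :> R by rewrite subr_gt0.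
rewrite /cond_expectation EFinM.
apply: lee_pmul; rewrite ?lee_fin ?invr_ge0 ?fine_ge0 //.
- apply: integral_ge0 => w _; apply: integral_ge0 => x _.
  by apply: le_ereal_inf_tmp => _ [k _ <-]; rewrite lee_fin.
- exact: integral_rho_le.
- by rewrite lef_pV2 ?posrE // (lt_le_trans c0).
Qed.

End ConditionalCost.

Theorem theorem1p4 (R : realType) (alpha : R)
    (alpha_gt0 : 0 < alpha) (alpha_lt : alpha < pi / 4) :
  (exists (c : R) (p : nat -> R),
    [/\ 0 < c,
        p =O_\oo (fun n : nat => n%:R ^+ 2 : R)
      & forall (n : nat) (nu : probability (borel_mx R n 1) R)
               (u1 : 'M[R[i]]_n -> 'cV[R[i]]_n),
          (1 <= n)%N -> uniform_projective nu -> dominant_choice u1 ->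
          exists2 E : set (borel_mx R n n), measurable E &
          forall (d : measure_display) (T : measurableType d)
                 (P : probability T R) (H : T -> 'M[R[i]]_n),
            GUE P H ->
            (P (H @^-1` E) <= (expR (- n%:R))%:E)%E /\
            (cond_expectation P (fun w => rho nu u1 alpha (H w))
               (~` (H @^-1` E))
             < (p n / (1 - expR (- (c * n%:R))) * ln (cot alpha))%:E)%E])
  /\
  (exists q : {poly R},
    forall (nu : forall n : nat, probability (borel_mx R n 1) R)
           (u1 : forall n : nat, 'M[R[i]]_n -> 'cV[R[i]]_n)
           (d : nat -> measure_display) (T : forall n : nat, measurableType (d n))
           (P : forall n : nat, probability (T n) R)
           (H : forall n : nat, T n -> 'M[R[i]]_n),
      (forall n : nat, (1 <= n)%N ->
         [/\ uniform_projective (nu n), dominant_choice (@u1 n)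
           & GUE (P n) (@H n)]) ->
      weak_expectation_O P (fun n w => rho (nu n) (@u1 n) alpha (H n w))
        (fun n => q.[n%:R])).
Proof.
have lcot : 0 < ln (cot alpha) by rewrite ln_gt0 // cot_gt1.
have K0 := cost_constant_gt0 alpha_gt0 alpha_lt.
set K := cost_constant alpha in K0.
split.
  exists 1, (fun n => (K + 1) / ln (cot alpha) * n%:R ^+ 2); split => //.
    apply/eqO_exP; exists ((K + 1) / ln (cot alpha)); first by rewrite divr_gt0 // ltr_wpDl // ltW.
    near=> n; rewrite normrM ger0_norm // divr_ge0 // ?addr_ge0 // ltW //.
  move=> n nu u1 n_gt0 nu_unif u1_dom.
  exists (exceptional n_gt0); first exact: measurable_exceptional.
  move=> d T P H HGUE; split; first exact: (exceptional_le n_gt0 HGUE).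
  apply: le_lt_trans (cond_cost_le n_gt0 alpha_gt0 alpha_lt nu_unif u1_dom HGUE) _.
  have e0 : 0 < 1 - expR (- n%:R) :> R by rewrite subr_gt0 expRN_natr_lt1.
  have n2 : 0 < n%:R ^+ 2 :> R by rewrite exprn_gt0 // ltr0n.
  rewrite lte_fin mul1r -/K.
  rewrite [ltRHS](_ : _ = (K + 1) * n%:R ^+ 2 / (1 - expR (- n%:R))); last first.
    by field; rewrite !gt_eqF.
  by rewrite ltr_pM2r ?invr_gt0 // ltr_pM2r // ltrDl.
exists ((2 * K) *: 'X^2) => nu u1 d T P H hyp.
(* The exceptional set depends on a proof that [n] is positive. *)
pose E n : set (T n) := if ltnP 0 n is LtnNotGeq n_gt0 then H n @^-1` exceptional n_gt0 else set0.
have Epos n (n_gt0 : (0 < n)%N) : E n = H n @^-1` exceptional n_gt0.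
  rewrite /E; case: ltnP => [h|]; last by rewrite leqNgt n_gt0.
  by rewrite (bool_irrelevance h n_gt0).
exists E; split.
- case=> [|n]; first by rewrite /E; case: ltnP.
  have [_ _ HGUE] := hyp n.+1 (ltn0Sn n).
  by rewrite (Epos _ (ltn0Sn n)); exact: (measurable_exceptional_event (ltn0Sn n) HGUE).
- exists 1 => //; near=> n.
  have n_gt0 : (0 < n)%N by near: n; exact: nbhs_infty_gt.
  have [_ _ HGUE] := hyp n n_gt0.
  by rewrite mul1r (Epos _ n_gt0); exact: (exceptional_le n_gt0 HGUE).
exists 1 => //; near=> n.
have n_gt0 : (0 < n)%N by near: n; exact: nbhs_infty_gt.
have [nu_unif u1_dom HGUE] := hyp n n_gt0.
rewrite (Epos _ n_gt0) gee0_abs; last exact: cond_cost_ge0.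
apply: le_trans (cond_cost_le n_gt0 alpha_gt0 alpha_lt nu_unif u1_dom HGUE) _.
rewrite -/K mul1r hornerZ hornerXn lee_fin (_ : 2 * K * _ = K * (n%:R ^+ 2 * 2)); last by ring.
rewrite -mulrA ler_pM2l // ler_pM2l ?exprn_gt0 ?ltr0n //.
have e2 : expR (- n%:R) <= 2^-1 :> R.
  rewrite expRN lef_pV2 ?posrE ?expR_gt0 //; have := expR_ge1Dx (n%:R : R).
  by have : 1 <= n%:R :> R; [rewrite ler1n|lra].
rewrite -[leRHS]invrK lef_pV2 ?posrE ?invr_gt0 ?subr_gt0 //; lra.
Unshelve. all: by end_near.
Qed.
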